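(* Let $d\in\mathbb{N}$, $j\in\mathbb{N}_0$, $\tau\in\{0,1\}$, and let $\varrho:\mathbb{R}\to\mathbb{R}$ be exponential (respectively polynomial, exact) $(j,\tau)$-PU-admissible. Then the collection of families of functions $(\Psi^{(j,\tau,N,s)}(\varrho))_{N\in\mathbb{N},s\in\mathbb{R}_{\ge1}}$ is an exponential (respectively polynomial, exact) partition of unity of order $\tau$ and smoothness $j$ (with property (iv) of that notion holding for networks with activation function $\varrho$).
   Context: $\mathbb{N}=\{1,2,\dots\}$, $\mathbb{N}_0=\mathbb{N}\cup\{0\}$; $\|f\|_{W^{k,\infty}(\Omega)}=\max_{|\alpha|\le k}\|D^\alpha f\|_{L^\infty(\Omega)}$. Admissibility. Let $j\in\mathbb{N}_0$, $\tau\in\{0,1\}$. $\varrho:\mathbb{R}\to\mathbb{R}$ is exponential (polynomial, exact) $(j,\tau)$-PU-admissible if (a) $\varrho$ is bounded if $\tau=0$, and Lipschitz continuous if $\tau=1$; (b) there is $R>0$ with $\varrho\in C^j(\mathbb{R}\setminus[-R,R])$; (c) $\varrho'\in W^{j-1,\infty}(\mathbb{R})$ if $j\ge1$; (d) there exist $A=A(\varrho)<B=B(\varrho)$ in $\mathbb{R}$ and $C=C(\varrho,j)>0$, $D=D(\varrho,j)>0$ such that (d.1) $|B-\varrho^{(\tau)}(x)|\le Ce^{-Dx}$ (respectively $\le Cx^{-D}$ if polynomial, $=0$ if exact) for all $x>R$; (d.2) $|A-\varrho^{(\tau)}(x)|\le Ce^{Dx}$ (respectively $\le C|x|^{-D}$,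 $=0$) for all $x<-R$; (d.3) $|\varrho^{(k)}(x)|\le Ce^{-D|x|}$ (respectively $\le C|x|^{-D}$, $=0$) for all $x\in\mathbb{R}\setminus[-R,R]$ and all $k=\tau+1,\dots,j$. Bumps. For such $\varrho$ and $s\ge1$ define $\psi^s:\mathbb{R}\to\mathbb{R}$ by $\psi^s(x)=\frac1{B-A}\big(\varrho(s(x+3/2))-\varrho(s(x-3/2))\big)$ if $\tau=0$, and $\psi^s(x)=\frac1{s(B-A)}\big(\varrho(s(x+2))-\varrho(s(x+1))-\varrho(s(x-1))+\varrho(s(x-2))\big)$ if $\tau=1$. For $N,d\in\mathbb{N}$ and $m\in\{0,\dots,N\}^d$ let $\phi_m^s(x)=\prod_{l=1}^d\psi^s\big(3N(x_l-\frac{m_l}N)\big)$, $x\in\mathbb{R}^d$, and $\Psi^{(j,\tau,N,s)}(\varrho)=\{\phi_m^s:m\in\{0,\dots,N\}^d\}$. Neural networks. A neural network with input dimension $d=N_0$, $L$ layers and output dimension $N_L$ is a family $\Phi=((A_\ell,b_\ell))_{\ell=1}^L$ with $A_\ell\in\mathbb{R}^{N_\ell\times N_{\ell-1}}$, $b_\ell\in\mathbb{R}^{N_\ell}$. The entries of the $A_\ell,b_\ell$ are its weights; $\|\Phi\|_{\max}$ is the maximal absolute value of all weights. Its realization $R_\varrho(\Phi)$ is the map $x\mapsto x_L$, where $x_0=x$, $x_\ell=\varrho(A_\ell x_{\ell-1}+b_\ell)$ for $\ell=1,\dots,L-1$ ($\varrho$ acting componentwise), $x_L=A_Lx_{L-1}+b_L$;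 $[\cdot]_l$ denotes the $l$-th output component. Partitions of unity (PU). A collection $(\Psi^{(j,\tau,N,s)})_{N\in\mathbb{N},s\in\mathbb{R}_{\ge1}}$, where each $\Psi^{(j,\tau,N,s)}=\{\phi_m^s:m\in\{0,\dots,N\}^d\}$ consists of $(N+1)^d$ functions $\phi_m^s:\mathbb{R}^d\to\mathbb{R}$, is an exponential (respectively polynomial, exact) partition of unity of order $\tau$ and smoothness $j$ if there are $D>0$, $C=C(k,d)>0$, $S>0$ such that for all $N\in\mathbb{N}$, $s\ge S$, $k\in\{0,\dots,j\}$: (i) $\|\phi_m^s\|_{W^{k,\infty}(\mathbb{R}^d)}\le CN^ks^{\max\{0,k-\tau\}}$ for every $\phi_m^s\in\Psi^{(j,\tau,N,s)}$; (ii) with $\Omega_m^c=\{x\in\mathbb{R}^d:\|x-\frac mN\|_\infty\ge\frac1N\}$, for every $\phi_m^s\in\Psi^{(j,\tau,N,s)}$ the norm $\|\phi_m^s\|_{W^{k,\infty}(\Omega_m^c)}$ is at most $CN^ks^{\max\{0,k-\tau\}}e^{-Ds}$ (exponential), $CN^ks^{\max\{0,k-\tau\}}s^{-D}$ (polynomial), $0$ (exact); (iii) $\|\mathbf{1}_{(0,1)^d}-\sum_{m\in\{0,\dots,N\}^d}\phi_m^s\|_{W^{k,\infty}((0,1)^d)}$ is at most $CN^ks^{\max\{0,k-\tau\}}e^{-Ds}$ (exponential), $CN^ks^{\max\{0,k-\tau\}}s^{-D}$ (polynomial), $0$ (exact); (iv) there is a function $\varrho:\mathbb{R}\to\mathbb{R}$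 such that for each $\phi_m^s$ there is a neural network $\Phi_m^s$ with $d$-dimensional input, $d$-dimensional output, two layers and at most $C$ nonzero weights with $\prod_{l=1}^d[R_\varrho(\Phi_m^s)]_l=\phi_m^s$, $\|R_\varrho(\Phi_m^s)\|_{W^{k,\infty}((0,1)^d)}\le CN^ks^{\max\{0,k-\tau\}}$ and $\|\Phi_m^s\|_{\max}\le CsN$. (The constants may depend on the fixed function $\varrho$ and on $j$.) *)

(* Defs.v *)
(* R^d is 'cV[R]_d, whose library norm is the sup norm. *)
From HB Require Import structures.
From mathcomp Require Import all_boot all_order all_algebra.
From mathcomp Require Import all_classical all_reals all_analysis.

Set Implicit Arguments.
Unset Strict Implicit.
Unset Printing Implicit Defensive.
Import Order.TTheory GRing.Theory Num.Theory.
Import numFieldNormedType.Exports.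
Local Open Scope classical_set_scope.
Local Open Scope ring_scope.

(* 'cV[T]_n carries the product sigma-algebra, as n.-tuple T does. *)
Definition measure_cV_display : measure_display -> measure_display.
Proof. exact. Qed.

Section measurable_cV.
Context {dT} {T : sigmaRingType dT}.
Variable n : nat.

Let coors : 'I_n -> 'cV[T]_n -> T := fun i x => x i ord0.

Let cV_set0 : g_sigma_preimage coors set0.
Proof. exact: sigma_algebra0. Qed.

Let cV_setC A : g_sigma_preimage coors A -> g_sigma_preimage coors (~` A).
Proof. exact: sigma_algebraC. Qed.

Let cV_bigcup (F : _^nat) : (forall i, g_sigma_preimage coors (F i)) ->
  g_sigma_preimage coors (\bigcup_i (F i)).
Proof. exact: sigma_algebra_bigcup. Qed.

HB.instance Definition _ := @isMeasurable.Build (measure_cV_display dT)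
  'cV[T]_n (g_sigma_preimage coors) cV_set0 cV_setC cV_bigcup.

End measurable_cV.

Lemma measurable_coord dT (T : sigmaRingType dT) n (i : 'I_n) :
  measurable_fun [set: 'cV[T]_n] (fun x : 'cV[T]_n => x i ord0).
Proof.
move=> _ Y mY; rewrite setTI; apply: sub_sigma_algebra => /=.
rewrite -bigcup_seq/=; exists i => /=; first by rewrite mem_index_enum.
by exists Y => //; rewrite setTI.
Qed.

Lemma measurable_fun_cVP d1 d2 (T1 : measurableType d1) (T2 : measurableType d2)
    n (f : T1 -> 'cV[T2]_n) :
  (forall i, measurable_fun [set: T1] (fun x => f x i ord0)) ->
  measurable_fun [set: T1] f.
Proof.
move=> mf _ A mA; rewrite setTI.
suff sub : @measurable _ 'cV[T2]_n `<=` [set B | measurable (f @^-1` B)].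
  exact: sub mA.
apply: smallest_sub => [|B]; first split => [|B mB|F mF] /=.
- by rewrite preimage_set0.
- by rewrite setTD -preimage_setC; exact: measurableC.
- by rewrite preimage_bigcup; exact: bigcupT_measurable.
rewrite -bigcup_seq => -[/= i _ [Y mY <-]]; rewrite setTI.
by have := mf i measurableT Y mY; rewrite setTI.
Qed.

Section lebesgue.
Context {R : realType}.

Definition cV_cons n (p : R * 'cV[R]_n) : 'cV[R]_n.+1 :=
  col_mx (p.1%:M : 'cV[R]_1) p.2.

Definition cV_uncons n (x : 'cV[R]_n.+1) : R * 'cV[R]_n :=
  (x ord0 ord0, \col_i x (lift ord0 i) ord0).

Lemma cV_consE0 n (p : R * 'cV[R]_n) : cV_cons p ord0 ord0 = p.1.
Proof.
rewrite /cV_cons (_ : ord0 = lshift n ord0 :> 'I_(1 + n)); last exact/val_inj.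
by rewrite (@col_mxEu _ 1) mxE.
Qed.

Lemma cV_consES n (p : R * 'cV[R]_n) i :
  cV_cons p (lift ord0 i) ord0 = p.2 i ord0.
Proof.
rewrite /cV_cons (_ : lift ord0 i = rshift 1 i :> 'I_(1 + n)).
  by rewrite (@col_mxEd _ 1).
exact/val_inj.
Qed.

Lemma cV_consK n : cancel (@cV_cons n) (@cV_uncons n).
Proof.
move=> [t x]; rewrite /cV_uncons cV_consE0; congr pair.
by apply/colP => i; rewrite mxE cV_consES.
Qed.

Lemma cV_unconsK n : cancel (@cV_uncons n) (@cV_cons n).
Proof.
move=> x; apply/colP => i; case: (unliftP ord0 i) => [j|] ->.
  by rewrite cV_consES mxE.
by rewrite cV_consE0.
Qed.

Lemma measurable_cV_cons n : measurable_fun setT (@cV_cons n).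
Proof.
apply: measurable_fun_cVP => i; case: (unliftP ord0 i) => [j|] ->.
  under eq_fun do rewrite cV_consES.
  exact: (measurableT_comp (measurable_coord j) measurable_snd).
by under eq_fun do rewrite cV_consE0; exact: measurable_fst.
Qed.

Lemma measurable_cV_uncons n : measurable_fun setT (@cV_uncons n).
Proof.
apply: measurable_fun_pair => /=; first exact: measurable_coord.
apply: measurable_fun_cVP => i.
by under eq_fun do rewrite mxE; exact: measurable_coord.
Qed.

Section lebesgue_cons.
Variables (n : nat) (mu : {sigma_finite_measure set 'cV[R]_n -> \bar R}).

Definition lebesgue_cons : set 'cV[R]_n.+1 -> \bar R :=
  pushforward (@lebesgue_measure R \x mu)%E (@cV_cons n).

Let lebesgue_cons0 : lebesgue_cons set0 = 0%E.
Proof. by rewrite /lebesgue_cons /pushforward preimage_set0 measure0. Qed.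

Let lebesgue_cons_ge0 A : (0 <= lebesgue_cons A)%E.
Proof. by rewrite /lebesgue_cons /pushforward measure_ge0. Qed.

Let lebesgue_cons_sigma_additive : semi_sigma_additive lebesgue_cons.
Proof.
have mcons : forall A : set 'cV[R]_n.+1, measurable A ->
    measurable (@cV_cons n @^-1` A).
  by move=> A mA; rewrite -[X in measurable X]setTI; exact: measurable_cV_cons.
move=> F mF tF mUF; rewrite /lebesgue_cons /pushforward preimage_bigcup.
apply: measure_semi_sigma_additive => [k||].
- exact: mcons.
- apply/trivIsetP => /= i j _ _ ij; rewrite -preimage_setI.
  by move/trivIsetP : tF => /(_ _ _ _ _ ij) ->//; rewrite preimage_set0.
- by rewrite -preimage_bigcup; exact: mcons.
Qed.

HB.instance Definition _ := isMeasure.Build _ _ _ lebesgue_cons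
  lebesgue_cons0 lebesgue_cons_ge0 lebesgue_cons_sigma_additive.

Let lebesgue_cons_sigma_finite : sigma_finite setT lebesgue_cons.
Proof.
have /sigma_finiteP[F [TF ndF Foo]] := sigma_finiteT (@lebesgue_measure R).
have /sigma_finiteP[G [TG ndG Goo]] := sigma_finiteT mu.
exists (fun k => @cV_uncons n @^-1` (F k `*` G k)).
  rewrite -preimage_bigcup (_ : \bigcup_k _ = setT) ?preimage_setT//.
  rewrite -subTset => -[x y] _.
  have [i _ Fix] : (\bigcup_i F i) x by rewrite -TF.
  have [j _ Gjy] : (\bigcup_j G j) y by rewrite -TG.
  exists (maxn i j) => //; split.
  - by move: x Fix; exact/subsetPset/ndF/leq_maxl.
  - by move: y Gjy; exact/subsetPset/ndG/leq_maxr.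
move=> k; have [mF Fkoo] := Foo k; have [mG Gkoo] := Goo k; split.
  rewrite -[X in measurable X]setTI; apply: measurable_cV_uncons => //.
  exact: measurableX.
rewrite /lebesgue_cons /pushforward -comp_preimage.
rewrite (_ : _ \o _ = id); last by apply/funext => p; exact: cV_consK.
by rewrite preimage_id product_measure1E// lte_mul_pinfty// ge0_fin_numE.
Qed.

HB.instance Definition _ := Measure_isSigmaFinite.Build _ _ _ lebesgue_cons
  lebesgue_cons_sigma_finite.

End lebesgue_cons.

Definition lebesgue0 : set 'cV[R]_0 -> \bar R := dirac (0 : 'cV[R]_0).
HB.instance Definition _ := Measure.on lebesgue0.

Let lebesgue0_sigma_finite : sigma_finite setT lebesgue0.
Proof.
exists (fun=> setT); first by rewrite bigcup_const.
by move=> k; split => //; rewrite /lebesgue0 diracT ltry.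
Qed.

HB.instance Definition _ := Measure_isSigmaFinite.Build _ _ _ lebesgue0
  lebesgue0_sigma_finite.

Fixpoint lebesgue d : {sigma_finite_measure set 'cV[R]_d -> \bar R} :=
  match d return {sigma_finite_measure set 'cV[R]_d -> \bar R} with
  | 0 => lebesgue0
  | n.+1 => lebesgue_cons (lebesgue n)
  end.

End lebesgue.

Section sobolev.
Context {R : realType} {d : nat}.
Implicit Types (Om : set 'cV[R]_d) (f g phi : 'cV[R]_d -> R).

Definition partial (i : 'I_d) f : 'cV[R]_d -> R :=
  fun x => 'D_(delta_mx i ord0) f x.

Definition smooth phi := forall s : seq 'I_d,
  continuous (foldr partial phi s) /\
  forall (i : 'I_d) x, derivable (foldr partial phi s) x (delta_mx i ord0).

Definition mderiv (al : 'I_d -> nat) f : 'cV[R]_d -> R :=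
  foldr (fun i => iter (al i) (partial i)) f (enum 'I_d).

Definition morder (al : 'I_d -> nat) : nat := (\sum_(i < d) al i)%N.

Definition test_function Om phi :=
  smooth phi /\
  exists K : set 'cV[R]_d,
    [/\ compact K, K `<=` Om & forall x, ~ K x -> phi x = 0].

Definition locally_integrable_on Om f :=
  measurable_fun Om f /\
  forall K : set 'cV[R]_d, compact K -> K `<=` Om ->
    (\int[lebesgue d]_(x in K) `|f x|%:E < +oo)%E.

(* g is a weak derivative D^al f on the open set Om. The representative f0 is
   needed because the sigma-algebra of 'cV[R]_d is the Borel one: f itself only
   has to be equal to a Borel function almost everywhere, that is, to be
   Lebesgue measurable. *)
Definition weak_derivative Om (al : 'I_d -> nat) f g :=
  exists f0 : 'cV[R]_d -> R,
    [/\ {ae lebesgue d, forall x, Om x -> f x = f0 x},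
        locally_integrable_on Om f0,
        locally_integrable_on Om g &
        forall phi, test_function Om phi ->
          (\int[lebesgue d]_(x in Om) (f0 x * mderiv al phi x)%:E =
           ((-1) ^+ morder al)%:E *
             \int[lebesgue d]_(x in Om) (g x * phi x)%:E)%E].

Definition Linfty_norm Om f : \bar R :=
  Lnorm (lebesgue d) +oo%E (EFin \o (f \_ Om)).

(* A weak derivative is unique up to a null set, so the infimum is the norm of
   D^al f; it is +oo when f has no weak derivative of index al. *)
Definition weak_derivative_norm Om (al : 'I_d -> nat) f : \bar R :=
  ereal_inf [set Linfty_norm Om g | g in weak_derivative Om al f].

(* The index al = 0 is treated apart because D^0 f is f. *)
Definition Wnorm Om (k : nat) f : \bar R :=
  Order.max (Linfty_norm Om f)
    (ereal_sup [set weak_derivative_norm Om al f |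
                al in [set al | (0 < morder al <= k)%N]]).

Definition Wnorm_vec Om (k n : nat) (F : 'cV[R]_d -> 'cV[R]_n) : \bar R :=
  \big[Order.max/0%E]_(l < n) Wnorm Om k (fun x => F x l ord0).

End sobolev.

Inductive pu_kind := PUExponential | PUPolynomial | PUExact.

Section admissible.
Context {R : realType}.

Definition decay (kind : pu_kind) (D t : R) : R :=
  match kind with
  | PUExponential => expR (- (D * t))
  | PUPolynomial => t `^ (- D)
  | PUExact => 0
  end.

Definition on_R1 (f : R -> R) : 'cV[R]_1 -> R := fun x => f (x ord0 ord0).

Definition weak_derivative_in_W (k : nat) (f : R -> R) :=
  exists g : 'cV[R]_1 -> R,
    weak_derivative setT (fun=> 1%N) (on_R1 f) g /\ (Wnorm setT k g < +oo)%E.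

(* Besides f in C^j outside of [-r, r], the first clause on derivatives asks
   for the existence of f^(tau) there when j < tau, as the bounds on B - f^(tau)
   and A - f^(tau) presuppose. The reals A and B are determined by f. *)
Definition pu_admissible (kind : pu_kind) (j tau : nat) (f : R -> R)
    (A B : R) :=
  [/\ (tau = 0%N -> bounded_fun f) /\ (tau = 1%N -> lipschitz f),
      (0 < j)%N -> weak_derivative_in_W j.-1 f,
      A < B &
      exists r C D : R, [/\ 0 < r, 0 < C, 0 < D &
        [/\ forall (x : R) k, r < `|x| -> (k < maxn j tau)%N ->
              derivable (derive1n k f) x 1,
            forall (x : R) k, r < `|x| -> (k <= j)%N ->
              {for x, continuous (derive1n k f)},
            forall x : R, r < x -> `|B - derive1n tau f x| <= C * decay kind D x,
            forall x : R, x < - r ->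
              `|A - derive1n tau f x| <= C * decay kind D (- x) &
            forall (x : R) k, r < `|x| -> (tau < k <= j)%N ->
              `|derive1n k f x| <= C * decay kind D `|x| ]]].

Definition psi (tau : nat) (f : R -> R) (A B s x : R) : R :=
  if tau == 0%N then
    (B - A)^-1 * (f (s * (x + 3 / 2)) - f (s * (x - 3 / 2)))
  else
    (s * (B - A))^-1 * (f (s * (x + 2)) - f (s * (x + 1))
                        - f (s * (x - 1)) + f (s * (x - 2))).

Definition pu_bump (d tau : nat) (f : R -> R) (A B : R)
    (N : nat) (s : R) (m : {ffun 'I_d -> 'I_N.+1}) (x : 'cV[R]_d) : R :=
  \prod_(l < d) psi tau f A B s (3 * N%:R * (x l ord0 - (m l)%:R / N%:R)).

End admissible.

Section networks.
Context {R : realType}.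

(* network p q: input dimension p, output dimension q *)
Inductive network : nat -> nat -> Type :=
| OutputLayer p q (W : 'M[R]_(q, p)) (b : 'cV[R]_q) : network p q
| HiddenLayer p n q (W : 'M[R]_(n, p)) (b : 'cV[R]_n) :
    (0 < n)%N -> network n q -> network p q.

Fixpoint realization (f : R -> R) p q (Phi : network p q) :
    'cV[R]_p -> 'cV[R]_q :=
  match Phi with
  | OutputLayer _ _ W b => fun x => W *m x + b
  | HiddenLayer _ _ _ W b _ Phi' =>
      fun x => realization f Phi' (map_mx f (W *m x + b))
  end.

Fixpoint nb_layers p q (Phi : network p q) : nat :=
  match Phi with
  | OutputLayer _ _ _ _ => 1
  | HiddenLayer _ _ _ _ _ _ Phi' => (nb_layers Phi').+1
  end.

Definition nb_nonzero m n (W : 'M[R]_(m, n)) : nat :=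
  #|[set ij : 'I_m * 'I_n | W ij.1 ij.2 != 0]|.

Fixpoint nb_nonzero_weights p q (Phi : network p q) : nat :=
  match Phi with
  | OutputLayer _ _ W b => (nb_nonzero W + nb_nonzero b)%N
  | HiddenLayer _ _ _ W b _ Phi' =>
      (nb_nonzero W + nb_nonzero b + nb_nonzero_weights Phi')%N
  end.

(* `|W| is the largest absolute value of the entries of W *)
Fixpoint max_weight p q (Phi : network p q) : R :=
  match Phi with
  | OutputLayer _ _ W b => Num.max `|W| `|b|
  | HiddenLayer _ _ _ W b _ Phi' =>
      Num.max (Num.max `|W| `|b|) (max_weight Phi')
  end.

End networks.

Section partition_of_unity.
Context {R : realType}.

Definition unit_cube d : set 'cV[R]_d :=
  [set x | forall l, 0 < x l ord0 < 1].

Definition node d (N : nat) (m : {ffun 'I_d -> 'I_N.+1}) : 'cV[R]_d :=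
  \col_l ((m l)%:R / N%:R).

Definition far_from_node d (N : nat) (m : {ffun 'I_d -> 'I_N.+1}) :
    set 'cV[R]_d :=
  [set x | N%:R^-1 <= `|x - node m|].

(* The activation function f of the networks in the last clause is a parameter;
   a collection is a partition of unity when this holds for some f. Since
   W^{k,oo} is a space of functions on an open set, the norm over the closed set
   far_from_node m is taken over its interior, which differs from it by a null
   set. Subtraction on nat being truncated, k - tau is max {0, k - tau}. *)
Definition partition_of_unity_with (f : R -> R) (kind : pu_kind)
    (d j tau : nat)
    (Psi : forall N : nat, R -> {ffun 'I_d -> 'I_N.+1} -> 'cV[R]_d -> R) :=
  exists (D S : R) (C : nat -> R),
    [/\ 0 < D, 0 < S, forall k, 0 < C k &
     forall (N : nat) (s : R) (k : nat),
       (0 < N)%N -> 1 <= s -> S <= s -> (k <= j)%N ->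
       let M : R := C k * N%:R ^+ k * s ^+ (k - tau) in
       [/\ forall m, (Wnorm setT k (Psi N s m) <= M%:E)%E,
           forall m, (Wnorm (interior (far_from_node m)) k (Psi N s m)
                      <= (M * decay kind D s)%:E)%E,
           (Wnorm (@unit_cube d) k
              (fun x => \1_(@unit_cube d) x - \sum_m Psi N s m x)%R
            <= (M * decay kind D s)%:E)%E &
           forall m, exists Phi : @network R d d,
             [/\ nb_layers Phi = 2%N,
                 (nb_nonzero_weights Phi)%:R <= C k,
                 forall x, \prod_(l < d) realization f Phi x l ord0
                           = Psi N s m x,
                 (Wnorm_vec (@unit_cube d) k (realization f Phi) <= M%:E)%E &
                 max_weight Phi <= C k * s * N%:R]]].

End partition_of_unity.

(* Main.v *)
(* With E(y) = rho(s(y + 3/2)) for tau = 0 and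
   E(y) = (rho(s(y + 2)) - rho(s(y + 1))) / s for tau = 1, one has
   psi(y) = (E(y) - E(y - 3)) / (B - A). By admissibility (and the mean value
   theorem if tau = 1), E is within C * decay(s) of B on [0, +oo[ and of A on
   ]-oo, -3]. Hence psi is small for |y| >= 3, and the sum over m of
   psi(3 N x - 3 m) telescopes to a function close to 1 on ]0, 1[. Every
   derivative of E gains a factor s, except the first one if tau = 1.

   The weak derivatives of rho, which are only controlled against smooth test
   functions, agree almost everywhere outside of [-r, r] with the classical
   derivatives (integration by parts and the fundamental lemma of the calculus
   of variations), so that the decay bounds apply to them. By Fubini's theorem,
   a product of functions of one coordinate has as weak derivative of index al
   the product of the one-dimensional weak derivatives of orders al_l. *)
Require Import Defs.
From mathcomp Require Import all_boot all_order all_algebra.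
From mathcomp Require Import all_classical all_reals all_analysis.
From mathcomp Require Import measurable_realfun ess_sup_inf ring lra zify.
Set Implicit Arguments.
Unset Strict Implicit.
Unset Printing Implicit Defensive.
Import Order.TTheory GRing.Theory Num.Theory.
Import numFieldNormedType.Exports.
Local Open Scope classical_set_scope.
Local Open Scope ring_scope.

(** * Smooth cutoff functions on the line *)

(** Admissibility bounds the function itself at every point, but its derivatives only almost
    everywhere; for [j = 0] and [tau = 0] the function may even fail to be measurable. Hence two
    objects run in parallel: the values, estimated pointwise without measure theory, and a chain of
    Borel functions [e 0], [e 1], ... whose first term agrees with the values almost everywhere. The
    chain is chosen so that its bounds hold at every point; estimating a tensor product then amounts
    to multiplying numbers. For both values of [tau], all arguments of rho in [E(y)] lie in
    [[s y + s, s y + 2 s]]. This interval is beyond [s] for [y >= 0] and below [-s] for [y <= -3]: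
    hence the shift 3, and the decay at [s] with the same [D] as soon as [s > r]. The delicate order
    is [k = tau = 1]: rho' tends to [B] or [A], not to 0, and only the difference of its two values
    in [E'] is small. *)

Section smooth_on_R.
Context {R : realType}.
Implicit Types (f g phi : R -> R) (n m : nat).

Definition smooth1 phi := forall n t, derivable (derive1n n phi) t 1.

(** The recursion differentiates first, whereas [derive1n] differentiates last. An induction
    generalized over [f] then needs only the first derivative of a sum, a product or an affine
    substitution. *)
Fixpoint ndiff n f : Prop :=
  (forall t, derivable f t 1) /\ (if n is m.+1 then ndiff m (derive1 f) else True).

Lemma ndiff_derivable n f t : ndiff n f -> derivable f t 1.
Proof. by case: n => [|n] [+ _]; exact. Qed.

Lemma smooth1P f : smooth1 f <-> forall n, ndiff n f.
Proof.
split.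
  move=> sf n; elim: n f sf => [|n IH] f sf; split => //.
  - exact: (sf 0%N).
  - exact: (sf 0%N).
  - by apply: IH => m t; rewrite -derive1Sn; exact: sf.
move=> nf n t; elim: n f nf => [|n IH] f nf; first exact: ndiff_derivable (nf 0%N).
by rewrite derive1Sn; apply: IH => m; have [] := nf m.+1.
Qed.

Lemma smooth1_derive phi : smooth1 phi -> smooth1 (derive1 phi).
Proof. by move=> sf n t; rewrite -derive1Sn; exact: sf. Qed.

Lemma smooth1_derive1n k phi : smooth1 phi -> smooth1 (derive1n k phi).
Proof.
move=> sf; elim: k => [//|k IH]; rewrite derive1nS; exact: smooth1_derive.
Qed.

Lemma smooth1_continuous phi : smooth1 phi -> continuous phi.
Proof.
by move=> sf t; apply/differentiable_continuous/derivable1_diffP/(sf 0%N).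
Qed.

Lemma derive1_fun f g : (forall t : R, is_derive t 1 f (g t)) -> derive1 f = g.
Proof. by move=> fg; apply/funext => t; rewrite derive1E derive_val. Qed.

Lemma derivable_is_derive f t : derivable f t 1 -> is_derive t 1 f (derive1 f t).
Proof. by move=> df; rewrite derive1E; exact: derivableP. Qed.

Lemma ndiffD n f g : ndiff n f -> ndiff n g -> ndiff n (f \+ g).
Proof.
elim: n f g => [|n IH] f g.
  by move=> [df _] [dg _]; split; [move=> t; exact: derivableD|exact: I].
move=> [df nf] [dg ng]; split; first by move=> t; exact: derivableD.
rewrite (_ : derive1 (f \+ g) = derive1 f \+ derive1 g); first exact: IH.
by apply/derive1_fun => t; apply: is_deriveD; exact: derivable_is_derive.
Qed.

Lemma ndiffZ n (k : R) f : ndiff n f -> ndiff n (fun t => k * f t).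
Proof.
elim: n f => [|n IH] f [df nf]; split.
- by move=> t; exact: derivableZ.
- exact: I.
- by move=> t; exact: derivableZ.
rewrite (_ : derive1 _ = (fun t => k * derive1 f t)); first exact: IH.
by apply/derive1_fun => t; apply: is_deriveZ; exact: derivable_is_derive.
Qed.

Lemma ndiffS n f : ndiff n.+1 f -> ndiff n f.
Proof. by elim: n f => [|n IH] f [df nf]; split => //; exact: IH. Qed.

Lemma ndiffM n f g : ndiff n f -> ndiff n g -> ndiff n (fun t => f t * g t).
Proof.
elim: n f g => [|n IH] f g.
  move=> [df _] [dg _]; split; [move=> t; exact: derivableM|exact: I].
move=> nfS ngS; have nf := ndiffS nfS; have ng := ndiffS ngS.
move: nfS ngS => [df nf'] [dg ng']; split; first by move=> t; exact: derivableM.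
rewrite (_ : derive1 _ = (fun t => f t * derive1 g t) \+ (fun t => g t * derive1 f t)).
  by apply: ndiffD; exact: IH.
by apply/derive1_fun => t; apply: is_deriveM; exact: derivable_is_derive.
Qed.

Lemma is_derive_affine f df (a b t : R) :
  is_derive (a * t + b) 1 f df -> is_derive t 1 (fun t => f (a * t + b)) (a * df).
Proof.
move=> fdf; have aff : is_derive t (1 : R) ((a *: (@id R)) + cst b) a.
  apply: is_derive_eq; last by rewrite addr0; exact: mulr1.
by rewrite mulrC; exact: is_derive1_comp.
Qed.

Lemma ndiff_affine n f (a b : R) : ndiff n f -> ndiff n (fun t => f (a * t + b)).
Proof.
have da g (t : R) : (forall t, derivable g t 1) ->
    is_derive t 1 (fun t => g (a * t + b)) (a * derive1 g (a * t + b)).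
  by move=> dg; apply/is_derive_affine/derivable_is_derive.
elim: n f => [|n IH] f [df nf]; split.
- by move=> t; have [] := da _ t df.
- exact: I.
- by move=> t; have [] := da _ t df.
rewrite (_ : derive1 _ = (fun t => a * derive1 f (a * t + b))); first exact/ndiffZ/IH.
by apply/derive1_fun => t; exact: da.
Qed.

Lemma smooth1_affine phi (a b : R) : smooth1 phi -> smooth1 (fun t => phi (a * t + b)).
Proof. by move=> /smooth1P sf; apply/smooth1P => n; exact: ndiff_affine. Qed.

Lemma derive1_affine phi (a b : R) : (forall t, derivable phi t 1) ->
  derive1 (fun t => phi (a * t + b)) = (fun t => a * derive1 phi (a * t + b)).
Proof.
by move=> dphi; apply/derive1_fun => t; apply/is_derive_affine/derivable_is_derive.
Qed.

Lemma smooth1M phi psi : smooth1 phi -> smooth1 psi -> smooth1 (fun t => phi t * psi t).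
Proof.
by move=> /smooth1P s1 /smooth1P s2; apply/smooth1P => n; exact: ndiffM.
Qed.

(* The factors x ^- m make this family stable under differentiation. *)
Definition flat_exp m (x : R) : R := if 0 < x then x ^- m * expR (- x^-1) else 0.

Lemma expR_ge_expn m (y : R) : 0 < y -> y ^+ m.+1 / m.+1`!%:R <= expR y.
Proof.
by move=> y0; apply: le_trans (expR_ge1Dxn m (ltW y0)); rewrite lerDr.
Qed.

(** Since [exp(1/x)] is at least its Taylor term of degree [m + 2], it beats [x ^- m] with two
    powers of [x] to spare, which is what a zero derivative at 0 requires. *)
Lemma flat_exp_le m (x : R) : 0 < x -> flat_exp m x <= m.+2`!%:R * x ^+ 2.
Proof.
move=> x0; rewrite /flat_exp x0 expRN.
have y0 : 0 < x^-1 by rewrite invr_gt0.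
have f0 : 0 < m.+2`!%:R :> R by rewrite ltr0n fact_gt0.
rewrite ler_pdivrMr ?expR_gt0//.
apply: le_trans (_ : m.+2`!%:R * x ^+ 2 * (x^-1 ^+ m.+2 / m.+2`!%:R) <= _); last first.
  by rewrite ler_wpM2l ?expR_ge_expn// mulr_ge0 ?ltW// exprn_gt0.
rewrite le_eqVlt exprVn -(addn2 m) exprD; apply/orP; left; apply/eqP; field.
by rewrite !gt_eqF ?exprn_gt0.
Qed.

Lemma is_derive_flat_exp m (x : R) :
  is_derive x 1 (flat_exp m) (- m%:R * flat_exp m.+1 x + flat_exp m.+2 x).
Proof.
have [x0|x0|->] := ltgtP x 0.
- have z k : flat_exp k x = 0 by rewrite /flat_exp ltNge ltW.
  rewrite !z mulr0 addr0.
  apply: (@near_eq_is_derive _ _ _ (cst 0)).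
  near=> y; rewrite /flat_exp ltNge ltW//.
  by near: y; exact: lt_nbhsl.
- have xn0 : x != 0 by rewrite gt_eqF.
  have di : is_derive x (1 : R) (fun y : R => y^-1) (- x ^- 2).
    apply: DeriveDef; first exact: derivableV.
    by rewrite deriveV// derive_id; exact: mulr1.
  have dE : is_derive x (1 : R) (expR \o (fun y : R => - y^-1)) (expR (- x^-1) * (- - x ^- 2)).
    by apply: is_derive1_comp; exact: is_deriveN.
  apply: (@near_eq_is_derive _ _ _
    (((fun y : R => y^-1) ^+ m) * (expR \o (fun y : R => - y^-1)))).
    near=> y; rewrite /= /flat_exp ifT.
      by rewrite -[LHS]/((GRing.exp (fun y : R => y^-1) m) y * expR (- y^-1)) exprfctE exprVn.
    by near: y; exact: lt_nbhsr.
  apply: is_derive_eq.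
  rewrite /flat_exp x0 exprfctE /=.

  rewrite -![_ *: _]/(_ * _); case: m => [|k] /=; first by rewrite !mul0r; field.
  by rewrite !exprS !exprVn; field; rewrite xn0 expf_neq0.
- rewrite /flat_exp ltxx mulr0 addr0 -/(flat_exp m).
  (* The difference quotient at 0 is 0 for [h <= 0] and at most [(m + 2)! h] for [h > 0]. *)
  have lim0 : h^-1 *: (flat_exp m (h *: 1 + 0) - flat_exp m 0) @[h --> 0^'] --> (0 : R).
    have c0 : 0 < m.+2`!%:R :> R by rewrite ltr0n fact_gt0.
    apply/cvgrPdist_le => e e0; near=> h.
    rewrite sub0r normrN addr0 [h *: 1]mulr1 {2}/flat_exp ltxx subr0.
    have [h0|h0] := ltP 0 h; last first.
      by rewrite /flat_exp ltNge h0/= scaler0 normr0 ltW.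
    rewrite normrZ normfV gtr0_norm// ler_pdivrMl// ger0_norm.
      apply: le_trans (flat_exp_le m h0) _.
      rewrite expr2 mulrCA ler_pM2l// mulrC -ler_pdivlMr//.
      rewrite -(gtr0_norm h0) ltW//; near: h; apply: dnbhs0_lt.
      exact: divr_gt0.
    by rewrite /flat_exp h0 mulr_ge0 ?expR_ge0// invr_ge0 exprn_ge0// ltW.
  split; first by apply/cvg_ex; exists 0.
  exact: (cvg_lim (@Rhausdorff R) lim0).
Unshelve. all: by end_near.
Qed.

Lemma ndiff_flat_exp n m : ndiff n (flat_exp m).
Proof.
elim: n m => [|n IH] m; (split; first by move=> t; have [] := is_derive_flat_exp m t).
  exact: I.
rewrite (derive1_fun (is_derive_flat_exp m)).
by apply: ndiffD => //; exact: ndiffZ.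
Qed.

Definition test_fun1 phi :=
  smooth1 phi /\ exists c : R, forall t, c < `|t| -> phi t = 0.

(** The factors are [exp(-1/(n (t - a)))] and [exp(-1/(n (b - t)))], extended by 0: the product
    vanishes off []a, b[] and tends to the indicator of that interval as [n] grows. *)
Definition cutoff (a b : R) n : R -> R :=
  fun t => flat_exp 0 (n%:R * t + - n%:R * a) * flat_exp 0 (- n%:R * t + n%:R * b).

Lemma flat_exp0_le1 x : flat_exp 0 x <= 1.
Proof.
rewrite /flat_exp; case: ifPn => // x0.
by rewrite expr0 invr1 mul1r expR_le1 oppr_le0 invr_ge0 ltW.
Qed.

Lemma flat_exp_ge0 m x : 0 <= flat_exp m x.
Proof.
rewrite /flat_exp; case: ifPn => // x0.
by rewrite mulr_ge0 ?expR_ge0// invr_ge0 exprn_ge0// ltW.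
Qed.

Lemma cutoff_ge0 a b n t : 0 <= cutoff a b n t.
Proof. by rewrite mulr_ge0 ?flat_exp_ge0. Qed.

Lemma cutoff_le1 a b n t : cutoff a b n t <= 1.
Proof. by rewrite mulr_ile1 ?flat_exp_ge0 ?flat_exp0_le1. Qed.

Lemma cutoff_out a b n t : ~~ (a < t < b) -> cutoff a b n t = 0.
Proof.
rewrite /cutoff /flat_exp !mulNr => tab.
case: ifPn; last by rewrite mul0r.
rewrite -mulrBr => nta; case: ifPn; last by rewrite mulr0.
rewrite addrC -mulrBr => ntb; case/negP: tab.
have [n0|n0] := eqVneq n 0%N; first by move: nta; rewrite n0 mul0r ltxx.
have n0' : 0 < n%:R :> R by rewrite ltr0n lt0n.
by move: nta ntb; rewrite !pmulr_rgt0// !subr_gt0 => -> ->.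
Qed.

Lemma smooth1_cutoff a b n : smooth1 (cutoff a b n).
Proof.
by apply: smooth1M; apply: smooth1_affine; apply/smooth1P => k; exact: ndiff_flat_exp.
Qed.

Lemma test_fun1_cutoff a b n : test_fun1 (cutoff a b n).
Proof.
split; first exact: smooth1_cutoff.
exists (Num.max `|a| `|b|) => t; rewrite gt_max => /andP[ta tb].
apply: cutoff_out; apply/negP => /andP[at_ tb_].
move: ta; apply/negP; rewrite -leNgt.
have [t0|t0] := leP 0 t.
  by move: tb; rewrite (ger0_norm t0) ltNge (le_trans (ltW tb_))// ler_norm.
by rewrite (ltr0_norm t0) -normrN (le_trans _ (ler_norm _))// lerN2 ltW.
Qed.

Lemma cvg_flat_exp0 (x : R) : 0 < x -> flat_exp 0 (n%:R * x) @[n --> \oo] --> (1 : R).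
Proof.
move=> x0; rewrite -[X in _ --> X](@expR0 R).
apply: (@cvg_trans _ (expR (- (n%:R * x)^-1) @[n --> \oo])).
  apply: near_eq_cvg; near=> n; rewrite /flat_exp ifT ?expr0 ?invr1 ?mul1r//.
  by rewrite mulr_gt0// ltr0n; near: n; exact: nbhs_infty_gt.
apply: continuous_cvg; first exact: continuous_expR.
rewrite -oppr0; apply: cvgN; apply/gtr0_cvgV0.
  by near=> n; rewrite mulr_gt0// ltr0n; near: n; exact: nbhs_infty_gt.
apply/cvgryPge => A; near=> n; rewrite -ler_pdivrMr//.
by near: n; exact: nbhs_infty_ger.
Unshelve. all: by end_near. Qed.

Lemma cvg_cutoff a b t : a < t < b -> cutoff a b n t @[n --> \oo] --> (1 : R).
Proof.
move=> /andP[at_ tb]; rewrite -[X in _ --> X](mulr1 1).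
apply: cvgM.
  under eq_cvg do rewrite mulNr -mulrBr.
  by apply: cvg_flat_exp0; rewrite subr_gt0.
under eq_cvg do rewrite mulNr addrC -mulrBr.
by apply: cvg_flat_exp0; rewrite subr_gt0.
Qed.

End smooth_on_R.

(** * The fundamental lemma of the calculus of variations on the line *)

Section fundamental_lemma.
Context {R : realType}.
Local Notation mu := (@lebesgue_measure R).

Lemma measurable_cutoff (a b : R) n : measurable_fun setT (cutoff a b n).
Proof.
by apply: continuous_measurable_fun; apply: smooth1_continuous; exact: smooth1_cutoff.
Qed.

Lemma Rintegral_cvg_cutoff (w : R -> R) (a b : R) :
  mu.-integrable setT (EFin \o w) ->
  (\int[mu]_t (w t * cutoff a b n t)%:E @[n --> \oo] -->
   \int[mu]_(t in `]a, b[) (w t)%:E)%E.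
Proof.
move=> iw; rewrite integral_mkcond.
have mw : measurable_fun setT w by apply/measurable_EFinP; case/integrableP : iw.
apply: (@dominated_cvg _ _ _ mu setT measurableT _ _ (fun t => `|(w t)%:E|%E)).
- move=> n; apply/measurable_EFinP; apply: measurable_funM => //.
  exact: measurable_cutoff.
- move=> t _; rewrite patchE; case: ifPn => [|].
    rewrite inE/= in_itv/= => tab.
    apply: cvg_EFin; first exact: nearW.
    rewrite -[X in _ --> X]mulr1; by apply: cvgM; [exact: cvg_cst|exact: cvg_cutoff].
  rewrite notin_setE/= in_itv/= => /negP tab.
  by apply: cvg_near_cst; apply: nearW => n; rewrite cutoff_out ?mulr0//; apply/negP.
- by [].
- exact: integrable_abse.
- move=> n t _; rewrite lee_fin normrM ler_piMr//.
  by rewrite ger0_norm ?cutoff_le1// cutoff_ge0.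
Qed.

(** Letting [n] tend to infinity, dominated convergence turns the hypothesis into the vanishing of
    the integrals of [w] over all [[a, c]]. At a Lebesgue point, [w] is the derivative of this
    primitive. *)
Lemma ae_eq0_cutoff (w : R -> R) (a b : R) :
  mu.-integrable setT (EFin \o w) ->
  (forall c n, a < c < b -> \int[mu]_t (w t * cutoff a c n t) = 0) ->
  {ae mu, forall t, a < t < b -> w t = 0}.
Proof.
move=> iw w0.
have mw : measurable_fun setT w by apply/measurable_EFinP; case/integrableP : iw.
have F0 c : a < c < b -> \int[mu]_(t in `[a, c]) w t = 0.
  move=> acb; rewrite -Rintegral_itv_bndo_bndc; last exact: integrableS iw.
  rewrite -Rintegral_itv_obnd_cbnd; last exact: integrableS iw.
  have lim := @Rintegral_cvg_cutoff w a c iw.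
  rewrite /Rintegral -(cvg_lim _ lim)//.
  rewrite (_ : (fun n => _) = cst 0%E) ?lim_cst//.
  apply/funext => n; rewrite -[RHS]/((0 : R)%:E) -(w0 c n acb) /Rintegral fineK//.
  apply: integrable_fin_num => //.
  apply: le_integrable iw => //.
    apply/measurable_EFinP; apply: measurable_funM; last exact: measurable_cutoff.
    exact: mw.
  move=> t _ /=; rewrite lee_fin normrM ler_piMr//.
  by rewrite ger0_norm ?cutoff_le1// cutoff_ge0.
have lw : locally_integrable setT w by apply: open_integrable_locally => //; exact: openT.
have FF := ae_filter_ringOfSetsType mu.
have := lebesgue_differentiation lw; apply: filterS => x xw /andP[ax xb].
have iw' : mu.-integrable [set` Interval (BLeft a) (BRight b)] (EFin \o w).
  exact: integrableS iw.
have [|_ <-] := FTC1_lebesgue_pt xb iw' _ xw; first by rewrite lte_fin.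
(* The primitive is identically 0 near [x]. *)
rewrite derive1E -(@derive_cst R R^o R^o 0 x 1); apply: near_eq_derive.
near=> y; apply: F0; apply/andP; split; near: y; [exact: lt_nbhsr|exact: lt_nbhsl].
Unshelve. all: by end_near. Qed.

End fundamental_lemma.

Section integrable_bounded.
Context d (T : measurableType d) (R : realType) (mu : {measure set T -> \bar R}).

Lemma integrable_bounded_support (F : T -> R) (D : set T) (M : R) :
  measurable D -> (mu D < +oo)%E -> measurable_fun setT F ->
  (forall x, `|F x| <= M) -> (forall x, ~ D x -> F x = 0) ->
  mu.-integrable setT (EFin \o F).
Proof.
move=> mD fD mF FM F0.
(* The sign of [M] is read off at a point, so the empty space is treated apart. *)
have [T0|/set0P[x0 _]] := eqVneq [set: T] set0; first by rewrite T0; exact: integrable_set0.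
have M0 : 0 <= M by exact: le_trans (FM x0).
apply/integrableP; split; first exact/measurable_EFinP.
apply: (@le_lt_trans _ _ (\int[mu]_x (M%:E * (\1_D x)%:E))%E).
  apply: ge0_le_integral => //.
  - by apply/measurable_EFinP; exact: measurableT_comp.
  - by apply/measurable_EFinP; apply: measurable_funM.
  move=> x _; rewrite lee_fin.
  have [Dx|nDx] := pselect (D x); last by rewrite F0// normr0 mulr_ge0.
  by rewrite indicE mem_set// mulr1.
rewrite ge0_integralZl//; last by apply/measurable_EFinP.
by rewrite integral_indic// setIT lte_mul_pinfty.
Qed.

Lemma RintegralE (F : T -> R) : mu.-integrable setT (EFin \o F) ->
  (\int[mu]_x (F x)%:E = (\int[mu]_x F x)%R%:E)%E.
Proof. by move=> iF; rewrite /Rintegral fineK// integrable_fin_num. Qed.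

End integrable_bounded.

(** * Measure and integration on R^d *)

Section open_measurable_cV.
Context {R : realType} {d : nat}.

Lemma measurable_cV_box (P : 'I_d -> set R) :
  (forall i, measurable (P i)) ->
  measurable [set x : 'cV[R]_d | forall i, P i (x i ord0)].
Proof.
move=> mP; rewrite (_ : [set x | _] =
    \bigcap_(i in [set: 'I_d]) ((fun x : 'cV[R]_d => x i ord0) @^-1` P i)).
  apply: fin_bigcap_measurable => // i _; rewrite -[X in measurable X]setTI.
  exact: measurable_coord.
by apply/seteqP; split => x /= h i; [move=> _; exact: h|exact: h].
Qed.

(** The sigma-algebra is generated by the coordinates, so [U] is written as a countable union of
    boxes: the cubes with rational centre and radius [1/(k + 1)] that it contains. *)
Lemma open_measurable_cV (U : set 'cV[R]_d) : open U -> measurable U.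
Proof.
move=> oU.
pose box (p : 'cV[rat]_d * nat) : set 'cV[R]_d :=
  [set x | forall i, ball (ratr (p.1 i ord0) : R) p.2.+1%:R^-1 (x i ord0)].
have mbox p : measurable (box p).
  apply: (measurable_cV_box (P := fun i => ball (ratr (p.1 i ord0) : R) p.2.+1%:R^-1)).
  by move=> i; exact: measurable_ball.
pose F p := if `[< box p `<=` U >] then box p else set0.
rewrite (_ : U = \bigcup_p F p).
  apply: countable_bigcupT_measurable; first exact: countableP.
  by move=> p; rewrite /F; case: ifPn.
apply/seteqP; split => [x Ux|x [p _]]; last first.
  by rewrite /F; case: asboolP => // pU /pU.
have /nbhs_ballP[e /= e0 xeU] : nbhs x U by exact: open_nbhs_nbhs.
(* A cube of radius below [e / 2] that contains [x] stays within distance [e] of [x]. *)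
have [k ke] : exists k : nat, k.+1%:R^-1 < e / 2.
  have e2 : 0 < e / 2 by exact: divr_gt0.
  exists (Num.truncn (e / 2)^-1); rewrite invf_plt ?posrE//.
  by rewrite truncnS_gt.
have qx i : exists q : rat, ball (ratr q : R) k.+1%:R^-1 (x i ord0).
  have : x i ord0 - k.+1%:R^-1 < x i ord0 + k.+1%:R^-1 :> R.
    by rewrite ltrD2l gt0_cp// invr_gt0.
  move=> /rat_in_itvoo[q]; rewrite in_itv/= => /andP[q1 q2].
  by exists q; rewrite /ball/= ltr_distl q1 q2.
have [q qE] := choice qx.
exists (\col_i q i, k) => //; rewrite /F; case: asboolP => [_|[]] i; first by rewrite /= mxE.
move=> bi; apply: xeU; split => // a b; rewrite (ord1 b).
have := bi a; have := qE a; rewrite mxE /ball/= => qa ia.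
rewrite (le_lt_trans (ler_distD (ratr (q a)) _ _))// (splitr e) ltrD//.
  by rewrite distrC (lt_trans qa).
exact: lt_trans ke.
Qed.

Lemma compact_measurable_cV (K : set 'cV[R]_d) : compact K -> measurable K.
Proof.
move=> cK; have clK : closed K by apply: compact_closed => //; exact: norm_hausdorff.
rewrite -(setCK K); apply: measurableC; apply: open_measurable_cV.
exact: closed_openC.
Qed.

Lemma continuous_measurable_cV (f : 'cV[R]_d -> R) :
  continuous f -> measurable_fun setT f.
Proof.
move=> /continuousP cf; apply: (measurability _ (RGenOpens.measurableE R)).
move=> _ [_ [a [b ->] <-]]; rewrite setTI; apply: open_measurable_cV.
exact/cf/interval_open.
Qed.

End open_measurable_cV.

(** * Fubini's theorem for the recursively defined Lebesgue measure *)

Section cV_fubini.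
Context {R : realType}.
Local Notation leb := (@lebesgue_measure R).

Definition cV_cube d (c : R) : set 'cV[R]_d := [set x | forall i, `|x i ord0| <= c].

Lemma measurable_cV_cube d c : measurable (@cV_cube d c).
Proof.
apply: (measurable_cV_box (P := fun=> [set t : R | `|t| <= c])) => i.
rewrite (_ : [set t | _] = `[- c, c]%classic); first exact: measurable_itv.
by apply/seteqP; split => t /=; rewrite in_itv/= ler_norml.
Qed.

Lemma lebesgue_cV_cube_lty d c : (lebesgue d (@cV_cube d c) < +oo)%E.
Proof.
elim: d => [|d IH] /=; first by rewrite /lebesgue0 diracE ltry.
rewrite /lebesgue_cons /pushforward.
rewrite (_ : _ @^-1` _ = `[- c, c]%classic `*` @cV_cube d c).
  rewrite product_measure1E//; last exact: measurable_cV_cube.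
  rewrite lte_mul_pinfty// ge0_fin_numE// [X in (X < _)%E]lebesgue_measure_itv/=.
  by case: ifPn => // _; rewrite -EFinB ltry.
apply/seteqP; split => [[t x]/= h|[t x]/= [ht hx] i].
  split; first by have := h ord0; rewrite cV_consE0 in_itv/= ler_norml.
  by move=> i; have := h (lift ord0 i); rewrite cV_consES.
case: (unliftP ord0 i) => [j|] ->; first by rewrite cV_consES.
by rewrite cV_consE0 ler_norml; rewrite in_itv/= in ht.
Qed.

Definition bounded_support d (F : 'cV[R]_d -> R) :=
  exists c : R, forall (x : 'cV[R]_d) i, c < `|x i ord0| -> F x = 0.

Definition bounded_on_R (T : Type) (F : T -> R) := exists M : R, forall x, `|F x| <= M.

(** This class is closed under slices, and its members are integrable, so that both Fubini formulas
    hold for it without further conditions. *)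
Definition bounded_csupp d (F : 'cV[R]_d -> R) :=
  [/\ measurable_fun setT F, bounded_on_R F & bounded_support F].

Lemma bounded_csupp_integrable d (F : 'cV[R]_d -> R) : bounded_csupp F ->
  (lebesgue d).-integrable setT (EFin \o F).
Proof.
move=> [mF [M FM] [c Fc]].
apply: (@integrable_bounded_support _ _ _ _ F (@cV_cube d c) M) => //.
- exact: measurable_cV_cube.
- exact: lebesgue_cV_cube_lty.
move=> x /existsNP[i /negP]; rewrite -ltNge; exact: Fc.
Qed.

Definition bounded_csupp1 (F : R -> R) :=
  [/\ measurable_fun setT F, bounded_on_R F & exists c : R, forall t, c < `|t| -> F t = 0].

Lemma bounded_csupp1_integrable F : bounded_csupp1 F -> leb.-integrable setT (EFin \o F).
Proof.
move=> [mF [M FM] [c Fc]].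
apply: (@integrable_bounded_support _ (measurableTypeR R) R leb F `[- c, c]%classic M) => //.
- by rewrite [X in (X < _)%E]lebesgue_measure_itv/=; case: ifPn => // _; rewrite -EFinB ltry.
by move=> t; rewrite /= in_itv/= -ler_norml => /negP; rewrite -ltNge; exact: Fc.
Qed.

Section cons.
Variables (d : nat) (F : 'cV[R]_d.+1 -> R).
Hypothesis nF : bounded_csupp F.

Let measurable_cons : measurable_fun setT (fun p => F (@cV_cons R d p)).
Proof.
by case: nF => mF _ _; apply: measurableT_comp mF _; exact: measurable_cV_cons.
Qed.

Let integrable_cons : (leb \x lebesgue d)%E.-integrable setT (EFin \o (F \o @cV_cons R d)).
Proof.
case: nF => mF [M FM] [c Fc].
apply: (@integrable_bounded_support _ (measurableTypeR R * 'cV[R]_d)%type R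
  (leb \x lebesgue d)%E (F \o @cV_cons R d)
  (`[- c, c]%classic `*` @cV_cube d c) M) => //=.
- by apply: measurableX => //; exact: measurable_cV_cube.
- rewrite product_measure1E//; last exact: measurable_cV_cube.
  rewrite lte_mul_pinfty//; last exact: lebesgue_cV_cube_lty.
  rewrite ge0_fin_numE// [X in (X < _)%E]lebesgue_measure_itv/=.
  by case: ifPn => // _; rewrite -EFinB ltry.
move=> [t x] /= /not_andP[].
  rewrite in_itv/= -ler_norml => /negP; rewrite -ltNge => ct.
  by apply: (Fc _ ord0); rewrite cV_consE0.
move=> /existsNP[i /negP]; rewrite -ltNge => cx.
by apply: (Fc _ (lift ord0 i)); rewrite cV_consES.
Qed.

Lemma bounded_csupp_slice t : bounded_csupp (fun x => F (cV_cons (t, x))).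
Proof.
case: nF => mF [M FM] [c Fc]; split.
- exact: (measurableT_comp measurable_cons (pair1_measurable t)).
- by exists M => x.
by exists c => x i cx; apply: (Fc _ (lift ord0 i)); rewrite cV_consES.
Qed.

Lemma bounded_csupp1_slice x : bounded_csupp1 (fun t => F (cV_cons (t, x))).
Proof.
case: nF => mF [M FM] [c Fc]; split.
- exact: (measurableT_comp measurable_cons (pair2_measurable x)).
- by exists M => t.
by exists c => t ct; apply: (Fc _ ord0); rewrite cV_consE0.
Qed.

Let integral_cons : (\int[lebesgue d.+1]_x (F x)%:E =
  \int[(leb \x lebesgue d)%E]_p (F (cV_cons p))%:E)%E.
Proof.
case: nF => mF _ _.
rewrite /= /lebesgue_cons integral_pushforward//.
- exact: measurable_cV_cons.
- exact/measurable_EFinP.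
Qed.

(** Both orders of integration are provided: a derivative in the first coordinate is treated with
    that coordinate innermost, any other derivative with it outermost. *)
Lemma Rintegral_cons1 : \int[lebesgue d.+1]_x F x =
  \int[leb]_t \int[lebesgue d]_x F (cV_cons (t, x)).
Proof.
rewrite {1}/Rintegral integral_cons -(integral12_prod_meas1 integrable_cons)/=.
rewrite {1}/Rintegral; congr fine; apply: eq_integral => t _.
by rewrite /fubini_F /= RintegralE//; exact/bounded_csupp_integrable/bounded_csupp_slice.
Qed.

Lemma Rintegral_cons2 : \int[lebesgue d.+1]_x F x =
  \int[lebesgue d]_x \int[leb]_t F (cV_cons (t, x)).
Proof.
rewrite {1}/Rintegral integral_cons -(integral21_prod_meas1 integrable_cons)/=.
rewrite {1}/Rintegral; congr fine; apply: eq_integral => x _.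
by rewrite /fubini_G /= RintegralE//; exact/bounded_csupp1_integrable/bounded_csupp1_slice.
Qed.

Lemma integrable_cons1 :
  leb.-integrable setT (fun t => (\int[lebesgue d]_x F (cV_cons (t, x)))%:E).
Proof.
rewrite (_ : (fun t => _) = fubini_F (lebesgue d) (EFin \o (F \o @cV_cons R d))).
  exact: integrable_fubini_F integrable_cons.
apply/funext => t; rewrite /fubini_F /= RintegralE//.
exact/bounded_csupp_integrable/bounded_csupp_slice.
Qed.

(** The absolute value of the inner integral is at most the inner integral of the absolute value,
    whose integral is finite by Tonelli's theorem. *)
Lemma integrable_cons2 :
  (lebesgue d).-integrable setT (fun x => (\int[leb]_t F (cV_cons (t, x)))%:E).
Proof.
rewrite (_ : (fun x => _) = fubini_G leb (EFin \o (F \o @cV_cons R d))); last first.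
  apply/funext => x; rewrite /fubini_G /= RintegralE//.
  exact/bounded_csupp1_integrable/bounded_csupp1_slice.
have mF : measurable_fun setT (EFin \o (F \o @cV_cons R d)) by apply/measurable_EFinP.
apply/integrableP; split; first exact: measurable_fubini_G integrable_cons.
apply: le_lt_trans ((integrable21ltyP leb (lebesgue d) mF).1 integrable_cons).
apply: ge0_le_integral => //.
- by apply: measurableT_comp => //; exact: measurable_fubini_G integrable_cons.
- apply: (measurable_fun_fubini_tonelli_G (m1 := leb)
    (abse \o (EFin \o (F \o @cV_cons R d)))) => //=.
  exact: measurableT_comp.
move=> x _; apply: le_abse_integral => //.
exact: measurableT_comp.
Qed.

End cons.

(** The set is a slab, of measure [0 * +oo = 0] at worst. This carries almost-everywhere statements
    on one coordinate over to the whole space. *)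
Lemma lebesgue_coord_null d (i : 'I_d) (Z : set R) :
  measurable Z -> leb Z = 0%E ->
  lebesgue d ((fun x : 'cV[R]_d => x i ord0) @^-1` Z) = 0%E.
Proof.
move=> mZ Z0; elim: d i => [[]//|d IH] i.
rewrite /= /lebesgue_cons /pushforward.
case: (unliftP ord0 i) => [j|] ->.
  rewrite (_ : _ @^-1` _ = setT `*` ((fun x : 'cV[R]_d => x j ord0) @^-1` Z)).
    rewrite product_measure1E//; first by rewrite IH mule0.
    by rewrite -[X in measurable X]setTI; exact: measurable_coord.
  by apply/seteqP; split => -[t x] /=; rewrite cV_consES => // -[].
rewrite (_ : _ @^-1` _ = Z `*` setT).
  by rewrite product_measure1E// [X in (X * _)%E]Z0 mul0e.
by apply/seteqP; split => -[t x] /=; rewrite cV_consE0 => // -[].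
Qed.

Lemma ae_coord d (i : 'I_d) (P : R -> Prop) :
  {ae leb, forall t, P t} -> {ae lebesgue d, forall x : 'cV[R]_d, P (x i ord0)}.
Proof.
move=> [Z [mZ Z0 PZ]]; exists ((fun x : 'cV[R]_d => x i ord0) @^-1` Z); split.
- by rewrite -[X in measurable X]setTI; exact: measurable_coord.
- exact: lebesgue_coord_null.
by move=> x /= Px; exact: PZ.
Qed.

End cV_fubini.

(** * Weak derivatives of tensor products *)

Section test_functions.
Context {R : realType}.
Local Notation leb := (@lebesgue_measure R).

Lemma le_coord_norm d (x : 'cV[R]_d) i : `|x i ord0| <= `|x|.
Proof.
rewrite [leRHS]/Num.Def.normr /= mx_normrE; apply/bigmax_geP; right => /=.
by exists (i, ord0).
Qed.

(* Unlike test_function, this notion passes to the slices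
   x |-> phi (cV_cons (t, x)). *)
Definition test_fun d (phi : 'cV[R]_d -> R) := forall s : seq 'I_d,
  (forall i x, derivable (foldr partial phi s) x (delta_mx i ord0)) /\
  bounded_csupp (foldr partial phi s).

Lemma test_fun_partial d (phi : 'cV[R]_d -> R) i : test_fun phi -> test_fun (partial i phi).
Proof. by move=> tphi s; have := tphi (rcons s i); rewrite foldr_rcons. Qed.

Lemma test_fun_foldr d (phi : 'cV[R]_d -> R) s : test_fun phi -> test_fun (foldr partial phi s).
Proof. by move=> tphi; elim: s => [//|i s IH] /=; exact: test_fun_partial. Qed.

Lemma test_fun_bounded_csupp d (phi : 'cV[R]_d -> R) : test_fun phi -> bounded_csupp phi.
Proof. by move=> /(_ [::]) []. Qed.

Lemma foldr_partial_out d (phi : 'cV[R]_d -> R) (K : set 'cV[R]_d) s :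
  closed K -> (forall x, ~ K x -> phi x = 0) ->
  forall x, ~ K x -> foldr partial phi s x = 0.
Proof.
move=> cK phi0; elim: s => [//|i s IH] x Kx /=.
rewrite /partial -[RHS](@derive_cst R 'cV[R]_d R 0 x (delta_mx i ord0)).
apply: near_eq_derive; near=> y; apply: IH; near: y.
by apply: open_nbhs_nbhs; split => //; exact: closed_openC.
Unshelve. all: by end_near. Qed.

Lemma test_function_test_fun d (Om : set 'cV[R]_d) phi : test_function Om phi -> test_fun phi.
Proof.
move=> [sphi [K [cK KOm phi0]]] s.
have [cs ds] := sphi s; split; first by move=> i x; exact: ds.
have clK : closed K by apply: compact_closed => //; exact: norm_hausdorff.
have s0 := foldr_partial_out s clK phi0.
split.
- exact: continuous_measurable_cV.
- have : compact (foldr partial phi s @` K).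
    by apply: continuous_compact => //; exact: continuous_subspaceT.
  move=> /compact_bounded[M [_ /(_ (M + 1))]]; rewrite ltrDl ltr01 => /(_ isT) MK.
  exists (Num.max 0 (M + 1)) => x; rewrite le_max.
  have [Kx|Kx] := pselect (K x); last by rewrite s0// normr0 lexx.
  by rewrite (MK (foldr partial phi s x)) ?orbT//; exists x.
- have /compact_bounded[M [_ /(_ (M + 1))]] := cK.
  rewrite ltrDl ltr01 => /(_ isT) MK; exists (M + 1) => x i Mx; apply: s0 => Kx.
  by have := le_lt_trans (MK _ Kx) Mx; rewrite ltNge le_coord_norm.
Qed.

Lemma cV_cons_shift0 d (h t : R) (x : 'cV[R]_d) :
  cV_cons (h *: 1 + t, x) = h *: delta_mx ord0 ord0 + cV_cons (t, x).
Proof.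
apply/colP => k; rewrite [RHS]mxE [X in _ = X + _]mxE [delta_mx _ _ _ _]mxE.
case: (unliftP ord0 k) => [j|] ->.
  by rewrite !cV_consES andbC/= mulr0 add0r.
by rewrite !cV_consE0 eqxx.
Qed.

Lemma cV_cons_shiftS d (h t : R) (x : 'cV[R]_d) i :
  cV_cons (t, h *: delta_mx i ord0 + x) =
  h *: delta_mx (lift ord0 i) ord0 + cV_cons (t, x).
Proof.
apply/colP => k; rewrite [RHS]mxE [X in _ = X + _]mxE [delta_mx _ _ _ _]mxE.
case: (unliftP ord0 k) => [j|] ->.
  by rewrite !cV_consES !mxE/= (inj_eq (@lift_inj _ _)).
by rewrite !cV_consE0/= mulr0 add0r.
Qed.

Section slice.
Variables (d : nat) (phi : 'cV[R]_d.+1 -> R).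

Lemma derivable_sliceS t (x : 'cV[R]_d) i :
  derivable phi (cV_cons (t, x)) (delta_mx (lift ord0 i) ord0) ->
  derivable (fun x => phi (cV_cons (t, x))) x (delta_mx i ord0).
Proof.
rewrite /derivable => dphi.
by under eq_fun do rewrite /= cV_cons_shiftS.
Qed.

Lemma partial_sliceS t i :
  partial i (fun x : 'cV[R]_d => phi (cV_cons (t, x))) =
  (fun x => partial (lift ord0 i) phi (cV_cons (t, x))).
Proof.
apply/funext => x; rewrite /partial /derive; congr (lim _).
by under eq_fun do rewrite /= cV_cons_shiftS.
Qed.

Lemma derivable_slice0 t (x : 'cV[R]_d) :
  derivable phi (cV_cons (t, x)) (delta_mx ord0 ord0) ->
  derivable (fun t => phi (cV_cons (t, x))) t 1.
Proof.
rewrite /derivable => dphi.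
by under eq_fun do rewrite /= cV_cons_shift0.
Qed.

Lemma derive1_slice0 (x : 'cV[R]_d) :
  derive1 (fun t => phi (cV_cons (t, x))) =
  (fun t => partial ord0 phi (cV_cons (t, x))).
Proof.
apply/funext => t; rewrite derive1E /partial /derive; congr (lim _).
by under eq_fun do rewrite /= cV_cons_shift0.
Qed.

End slice.

Lemma foldr_partial_slice d (phi : 'cV[R]_d.+1 -> R) t s :
  foldr partial (fun x : 'cV[R]_d => phi (cV_cons (t, x))) s =
  (fun x => foldr partial phi (map (lift ord0) s) (cV_cons (t, x))).
Proof. by elim: s => [//|i s IH] /=; rewrite IH partial_sliceS. Qed.

Lemma test_fun_slice d (phi : 'cV[R]_d.+1 -> R) t : test_fun phi ->
  test_fun (fun x : 'cV[R]_d => phi (cV_cons (t, x))).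
Proof.
move=> tphi s; rewrite foldr_partial_slice.
have [ds ns] := tphi (map (lift ord0) s); split.
  by move=> i x; apply: derivable_sliceS; exact: ds.
exact: bounded_csupp_slice.
Qed.

Lemma derive1n_slice0 d (phi : 'cV[R]_d.+1 -> R) (x : 'cV[R]_d) n :
  derive1n n (fun t => phi (cV_cons (t, x))) =
  (fun t => foldr partial phi (nseq n ord0) (cV_cons (t, x))).
Proof. by elim: n => [//|n IH]; rewrite derive1nS IH derive1_slice0. Qed.

Lemma test_fun1_slice d (phi : 'cV[R]_d.+1 -> R) (x : 'cV[R]_d) : test_fun phi ->
  test_fun1 (fun t => phi (cV_cons (t, x))).
Proof.
move=> tphi; split.
  move=> n t; rewrite derive1n_slice0; apply: derivable_slice0.
  by have [+ _] := tphi (nseq n ord0); exact.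
by have [_ _] := bounded_csupp1_slice (test_fun_bounded_csupp tphi) x.
Qed.

Definition locally_bounded (f : R -> R) :=
  forall c : R, exists M : R, forall t, `|t| <= c -> `|f t| <= M.

(** Local boundedness at every point, stronger than local integrability, makes a tensor product of
    such functions times a test function bounded, so that Fubini applies. Global boundedness would
    exclude Lipschitz activations. *)
Definition weak_deriv1 (f g : R -> R) :=
  [/\ measurable_fun setT f, measurable_fun setT g, locally_bounded f,
      locally_bounded g & forall phi, test_fun1 phi ->
      \int[leb]_t (f t * derive1 phi t) = - \int[leb]_t (g t * phi t)].

Lemma bounded_csupp1M (f phi : R -> R) : measurable_fun setT f -> locally_bounded f ->
  bounded_csupp1 phi -> bounded_csupp1 (fun t => f t * phi t).
Proof.
move=> mf lf [mphi [M phiM] [c phi0]]; split.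
- exact: measurable_funM.
- have [Mf fM] := lf c; exists (Num.max 0 (Mf * M)) => t.
  rewrite le_max normrM; have [tc|tc] := leP `|t| c.
    by rewrite ler_pM ?orbT// fM.
  by rewrite phi0// normr0 mulr0 lexx.
by exists c => t ct; rewrite phi0 ?mulr0.
Qed.

Lemma bounded_csupp_tensorM d (w : 'I_d -> R -> R) phi :
  (forall l, measurable_fun setT (w l)) -> (forall l, locally_bounded (w l)) ->
  bounded_csupp phi -> bounded_csupp (fun x : 'cV[R]_d => (\prod_(l < d) w l (x l ord0)) * phi x).
Proof.
move=> mw lw [mphi [M phiM] [c phi0]]; split.
- apply: measurable_funM => //; apply: measurable_prod => l _.
  by apply: measurableT_comp => //; exact: measurable_coord.
- have /choice[Mw wM] : forall l, exists N : R, forall t, `|t| <= c -> `|w l t| <= N.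
    by move=> l; exact: lw.
  exists (Num.max 0 ((\prod_(l < d) Mw l) * M)) => x; rewrite le_max normrM.
  have [xc|] := pselect (forall l, `|x l ord0| <= c); last first.
    by move=> /existsNP[l /negP]; rewrite -ltNge => /phi0 ->; rewrite normr0 mulr0 lexx.
  rewrite ler_pM ?orbT// normr_prod ler_prod// => l _.
  by rewrite normr_ge0 wM.
by exists c => x i xc; rewrite (phi0 _ i) ?mulr0.
Qed.

(** Induction on [d] by Fubini. If [i] is the first coordinate, the inner integral over it is the
    one-dimensional identity on a slice of [phi]. Otherwise the first factor comes out of the inner
    integral, and the induction hypothesis applies to a slice in the other coordinates. *)
Lemma tensor_partial d (w w' : 'I_d -> R -> R) (i : 'I_d) phi :
  (forall l, measurable_fun setT (w l)) -> (forall l, locally_bounded (w l)) ->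
  weak_deriv1 (w i) (w' i) -> (forall l, l != i -> w' l = w l) -> test_fun phi ->
  \int[lebesgue d]_x ((\prod_(l < d) w l (x l ord0)) * partial i phi x) =
  - \int[lebesgue d]_x ((\prod_(l < d) w' l (x l ord0)) * phi x).
Proof.
elim: d => [|d IH] in w w' i phi *; first by case: i.
move=> mw lw wi w'E tphi.
have mw' l : measurable_fun setT (w' l).
  by have [->|/w'E ->//] := eqVneq l i; case: wi.
have lw' l : locally_bounded (w' l).
  by have [->|/w'E ->//] := eqVneq l i; case: wi.
have nL := bounded_csupp_tensorM mw lw (test_fun_bounded_csupp (test_fun_partial i tphi)).
have nR := bounded_csupp_tensorM mw' lw' (test_fun_bounded_csupp tphi).
have prodE (v : 'I_d.+1 -> R -> R) t (x : 'cV[R]_d) :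
    \prod_(l < d.+1) v l ((cV_cons (t, x)) l ord0) =
    v ord0 t * \prod_(l < d) v (lift ord0 l) (x l ord0).
  rewrite big_ord_recl cV_consE0; congr (_ * _).
  by apply: eq_bigr => l _; rewrite cV_consES.
case: (unliftP ord0 i) => [j iE|iE]; rewrite {}iE in wi w'E nL *.
  rewrite (Rintegral_cons1 nL) (Rintegral_cons1 nR).
  rewrite -[RHS]mulN1r -RintegralZl//.
    apply: eq_Rintegral => t _.
    under eq_Rintegral do rewrite prodE -mulrA.
    under [in RHS]eq_Rintegral do rewrite prodE -mulrA.
    rewrite RintegralZl//.
      rewrite RintegralZl//.
        rewrite [RHS]mulrCA mulN1r w'E//; congr (_ * _).
        have := IH (fun l => w (lift ord0 l)) (fun l => w' (lift ord0 l)) j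
          (fun x => phi (cV_cons (t, x))).
        rewrite partial_sliceS; apply => //; last exact: test_fun_slice.
        by move=> l lj; rewrite w'E// (inj_eq (@lift_inj _ _)).
      apply/bounded_csupp_integrable/(bounded_csupp_tensorM (w := fun l => w' (lift ord0 l))) => //.
      exact: (bounded_csupp_slice (test_fun_bounded_csupp tphi)).
    apply/bounded_csupp_integrable/(bounded_csupp_tensorM (w := fun l => w (lift ord0 l))) => //.
    exact: (bounded_csupp_slice (test_fun_bounded_csupp (test_fun_partial _ tphi))).
  exact: (integrable_cons1 nR).
rewrite (Rintegral_cons2 nL) (Rintegral_cons2 nR).
rewrite -[RHS]mulN1r -RintegralZl//.
  apply: eq_Rintegral => x _.
  under eq_Rintegral do rewrite prodE mulrAC.
  under [in RHS]eq_Rintegral do rewrite prodE mulrAC.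
  have [mw0 mw0' lw0 lw0' E] := wi.
  have t1 := test_fun1_slice x tphi.
  rewrite RintegralZr//.
    rewrite RintegralZr//.
      rewrite mulrA mulN1r -E// derive1_slice0; congr (_ * _).
      by apply: eq_bigr => l _; rewrite w'E.
    apply: bounded_csupp1_integrable; apply: bounded_csupp1M => //.
      exact: (bounded_csupp1_slice (test_fun_bounded_csupp tphi)).
  apply: bounded_csupp1_integrable; apply: bounded_csupp1M => //.
  exact: (bounded_csupp1_slice (test_fun_bounded_csupp (test_fun_partial _ tphi))).
exact: (integrable_cons2 nR).
Qed.

End test_functions.

(** * Weak derivatives of arbitrary multi-index *)

Section multi_index.
Context {R : realType}.
Local Notation leb := (@lebesgue_measure R).

(** The derivatives listed in [s] are moved from [phi] onto the tensor one at a time; [b] records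
    the orders already reached, which the induction must let vary. *)
Lemma tensor_foldr_partial d (h : 'I_d -> nat -> R -> R) (b : 'I_d -> nat)
    (s : seq 'I_d) phi :
  (forall l i, (i <= b l + count_mem l s)%N ->
     measurable_fun setT (h l i) /\ locally_bounded (h l i)) ->
  (forall l i, (i < b l + count_mem l s)%N -> weak_deriv1 (h l i) (h l i.+1)) ->
  test_fun phi ->
  \int[lebesgue d]_x ((\prod_(l < d) h l (b l) (x l ord0)) * foldr partial phi s x) =
  (-1) ^+ size s *
    \int[lebesgue d]_x ((\prod_(l < d) h l (b l + count_mem l s)%N (x l ord0)) * phi x).
Proof.
elim: s b => [|i s IH] b mh wh tphi /=.
  rewrite expr0 mul1r; apply: eq_Rintegral => x _; congr (_ * _).
  by apply: eq_bigr => l _; rewrite addn0.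
rewrite (@tensor_partial _ _ (fun l => h l (b l)) (fun l => h l (b l + (i == l))%N)).
- rewrite (IH (fun l => (b l + (i == l))%N))//.
  + rewrite exprS mulN1r mulNr; congr (- (_ * _)).
    by apply: eq_Rintegral => x _; congr (_ * _); apply: eq_bigr => l _; rewrite -addnA.
  + by move=> l k; rewrite -addnA; exact: mh.
  + by move=> l k; rewrite -addnA; exact: wh.
- by move=> l; apply: (mh l _ _).1; rewrite leq_addr.
- by move=> l; apply: (mh l _ _).2; rewrite leq_addr.
- by rewrite eqxx addn1; apply: wh; rewrite /= eqxx -[ltnLHS]addn0 ltn_add2l.
- by move=> l; rewrite eq_sym => /negPf ->; rewrite addn0.
- exact: test_fun_foldr.
Qed.

Definition directions d (al : 'I_d -> nat) : seq 'I_d :=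
  flatten [seq nseq (al i) i | i <- enum 'I_d].

Lemma mderivE d (al : 'I_d -> nat) (phi : 'cV[R]_d -> R) :
  mderiv al phi = foldr partial phi (directions al).
Proof.
rewrite /mderiv /directions; elim: (enum 'I_d) => [//|i s IH] /=.
by rewrite foldr_cat -IH; elim: (al i) => [//|n IHn] /=; rewrite IHn.
Qed.

Lemma count_directions d (al : 'I_d -> nat) l : count_mem l (directions al) = al l.
Proof.
rewrite /directions count_flatten -map_comp sumnE big_map big_enum/=.
rewrite (bigD1 l)//= count_nseq/= eqxx mul1n big1 ?addn0// => i il.
by rewrite count_nseq/= (negPf il).
Qed.

Lemma size_directions d (al : 'I_d -> nat) : size (directions al) = morder al.
Proof.
rewrite /directions size_flatten /shape -map_comp sumnE big_map big_enum/=.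
by apply: eq_bigr => i _; rewrite size_nseq.
Qed.

Lemma tensor_mderiv d (h : 'I_d -> nat -> R -> R) (al : 'I_d -> nat) phi :
  (forall l i, (i <= al l)%N ->
     measurable_fun setT (h l i) /\ locally_bounded (h l i)) ->
  (forall l i, (i < al l)%N -> weak_deriv1 (h l i) (h l i.+1)) -> test_fun phi ->
  \int[lebesgue d]_x ((\prod_(l < d) h l 0%N (x l ord0)) * mderiv al phi x) =
  (-1) ^+ morder al *
    \int[lebesgue d]_x ((\prod_(l < d) h l (al l) (x l ord0)) * phi x).
Proof.
move=> mh wh tphi; rewrite mderivE (tensor_foldr_partial (b := fun=> 0%N))//.
- rewrite size_directions; congr (_ * _); apply: eq_Rintegral => x _.
  by congr (_ * _); apply: eq_bigr => l _; rewrite add0n count_directions.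
- by move=> l i; rewrite add0n count_directions; exact: mh.
- by move=> l i; rewrite add0n count_directions; exact: wh.
Qed.

Lemma bounded_locally_integrable d (Om : set 'cV[R]_d) f :
  measurable_fun setT f -> bounded_on_R f -> locally_integrable_on Om f.
Proof.
move=> mf [M fM]; split; first exact: measurable_funS mf.
move=> K cK KOm.
have mK := compact_measurable_cV cK.
have [N [_ /(_ (N + 1))]] := compact_bounded cK.
rewrite ltrDl ltr01 => /(_ isT) NK.
have KN : K `<=` cV_cube (N + 1).
  by move=> x Kx i; apply: le_trans (le_coord_norm _ _) (NK _ Kx).
have M0 : 0 <= M by apply: le_trans (fM 0).
apply: (@le_lt_trans _ _ (\int[lebesgue d]_(x in K) M%:E)%E).
  apply: ge0_le_integral => //.
  - by apply/measurable_EFinP; apply: measurableT_comp => //; exact: measurable_funS mf.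
  - by move=> x _; rewrite lee_fin.
rewrite integral_cst// lte_mul_pinfty//.
apply: le_lt_trans (lebesgue_cV_cube_lty d (N + 1)).
by apply: le_measure; rewrite ?inE//; exact: measurable_cV_cube.
Qed.

Lemma bounded_csupp_boundedM d (f phi : 'cV[R]_d -> R) : measurable_fun setT f ->
  bounded_on_R f -> bounded_csupp phi -> bounded_csupp (fun x => f x * phi x).
Proof.
move=> mf [Mf fM] [mphi [M phiM] [c phi0]]; split.
- exact: measurable_funM.
- by exists (Mf * M) => x; rewrite normrM ler_pM.
by exists c => x i xc; rewrite (phi0 _ i) ?mulr0.
Qed.

(** A test function on [Om] vanishes off a compact subset of [Om], so the integrals over [Om] are
    integrals over the whole space, where the identity is asked for the larger class [test_fun]. *)
Lemma weak_derivative_bounded d (Om : set 'cV[R]_d) al (f f0 g : 'cV[R]_d -> R) :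
  {ae lebesgue d, forall x, Om x -> f x = f0 x} ->
  measurable_fun setT f0 -> bounded_on_R f0 ->
  measurable_fun setT g -> bounded_on_R g ->
  (forall phi, test_fun phi -> \int[lebesgue d]_x (f0 x * mderiv al phi x) =
     (-1) ^+ morder al * \int[lebesgue d]_x (g x * phi x)) ->
  weak_derivative Om al f g.
Proof.
move=> ff0 mf0 bf0 mg bg wfg; exists f0; split => //.
- exact: bounded_locally_integrable.
- exact: bounded_locally_integrable.
move=> phi tphi; have tsphi := test_function_test_fun tphi.
have [_ [K [cK KOm phi0]]] := tphi.
have clK : closed K by apply: compact_closed => //; exact: norm_hausdorff.
have dphi0 := foldr_partial_out (directions al) clK phi0.
have extend (u v : 'cV[R]_d -> R) : (forall x, ~ K x -> v x = 0) ->
    (\int[lebesgue d]_(x in Om) (u x * v x)%:E = \int[lebesgue d]_x (u x * v x)%:E)%E.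
  move=> v0; rewrite integral_mkcond; apply: eq_integral => x _.
  rewrite patchE; case: ifPn => //; rewrite notin_setE => nOm.
  by rewrite v0 ?mulr0// => /KOm.
rewrite extend; last by rewrite mderivE.
rewrite extend// !RintegralE; first by rewrite -EFinM wfg.
- exact/bounded_csupp_integrable/bounded_csupp_boundedM/test_fun_bounded_csupp.
- apply: bounded_csupp_integrable; apply: bounded_csupp_boundedM => //.
  by rewrite mderivE; exact/test_fun_bounded_csupp/test_fun_foldr.
Qed.

End multi_index.

(** * Weak derivatives on the line *)

Section change_of_variables.
Context {R : realType}.
Local Notation leb := (@lebesgue_measure R).

Lemma measurable_affine (a b : R) :
  measurable_fun setT (fun t : measurableTypeR R => a * t + b : measurableTypeR R).
Proof.
by apply: measurable_funD => //; apply: measurable_funM.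
Qed.

(** The pushforward of the Lebesgue measure, scaled by [a], has the right value on half-open
    intervals, and these determine the Lebesgue measure. *)
Lemma lebesgue_measure_affine (a b : R) (A : set (measurableTypeR R)) : 0 < a ->
  measurable A ->
  leb A = (a%:E * leb ((fun t => (a * t + b)%R) @^-1` A))%E.
Proof.
move=> a0 mA.
pose pf : {measure set (measurableTypeR R) -> \bar R} :=
  measure_function_pushforward__canonical__measure_function_Measure leb
    (measurable_affine a b).
pose nu : {measure set (measurableTypeR R) -> \bar R} := mscale (NngNum (ltW a0)) pf.
have -> := @lebesgue_measure_unique R nu; [by []| |by []].
move=> _ [[c e] _ <-] /=; rewrite /nu /mscale /= /pushforward.
have aNge (u t : R) : (u < a * t + b) = ((u - b) / a < t).
  by rewrite ltr_pdivrMr// ltrBlDr mulrC.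
have ale (u t : R) : (a * t + b <= u) = (t <= (u - b) / a).
  by rewrite ler_pdivlMr// lerBrDr mulrC.
rewrite (_ : _ @^-1` _ = `](c - b) / a, (e - b) / a]%classic); last first.
  by apply/seteqP; split => t /=; rewrite !in_itv/= aNge ale.
rewrite [LHS]lebesgue_measure_itv [X in (_ * X)%E]lebesgue_measure_itv/= !lte_fin.
rewrite ltr_pM2r ?invr_gt0// ltrD2r; case: ifPn => _; last by rewrite mule0.
by rewrite -!EFinD -EFinM; congr (_%:E); field; rewrite gt_eqF.
Qed.

Lemma ge0_integral_affine (a b : R) (F : R -> \bar R) : 0 < a ->
  measurable_fun setT F -> (forall t, 0 <= F t)%E ->
  (\int[leb]_t F t = a%:E * \int[leb]_t F (a * t + b)%R)%E.
Proof.
move=> a0 mF F0.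
pose pf : {measure set (measurableTypeR R) -> \bar R} :=
  measure_function_pushforward__canonical__measure_function_Measure leb
    (measurable_affine a b).
pose nu : {measure set (measurableTypeR R) -> \bar R} := mscale (NngNum (ltW a0)) pf.
rewrite (eq_measure_integral nu); last first.
  by move=> A mA _; exact: lebesgue_measure_affine.
rewrite ge0_integral_mscale//= ge0_integral_pushforward//.
- exact: measurable_affine.
Qed.

Lemma Rintegral_affine (a b : R) (F : R -> R) : 0 < a -> bounded_csupp1 F ->
  \int[leb]_t F t = a * \int[leb]_t F (a * t + b).
Proof.
move=> a0 [mF bF sF].
have maF : measurable_fun setT (fun t => F (a * t + b)).
  exact: measurableT_comp mF (measurable_affine a b).
have iaF : leb.-integrable setT (fun t => (F (a * t + b))%:E).
  apply: bounded_csupp1_integrable; split => //.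
    by have [M FM] := bF; exists M => t.
  have [c Fc] := sF; exists ((c + `|b|) / a) => t; rewrite ltr_pdivrMr// => ct.
  apply: Fc; have := ler_normB (a * t + b) b.
  by rewrite addrK normrM (gtr0_norm a0) mulrC; lra.
have P : (\int[leb]_t (EFin \o F)^\+ t =
    a%:E * \int[leb]_t ((fun t => (F (a * t + b)%R)%:E)^\+ t))%E.
  rewrite (ge0_integral_affine b a0)//; last first.
    by apply: measurable_funepos; apply/measurable_EFinP.
  by congr (_ * _)%E; apply: eq_integral => t _; rewrite !funeposE.
have N : (\int[leb]_t (EFin \o F)^\- t =
    a%:E * \int[leb]_t ((fun t => (F (a * t + b)%R)%:E)^\- t))%E.
  rewrite (ge0_integral_affine b a0)//; last first.
    by apply: measurable_funeneg; apply/measurable_EFinP.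
  by congr (_ * _)%E; apply: eq_integral => t _; rewrite !funenegE.
rewrite {1}/Rintegral integralE P N -muleBr//; last first.
  apply: fin_num_adde_defl; rewrite fin_numN.
  exact: (integrable_neg_fin_num measurableT iaF).
rewrite -integralE fineM//.
exact: integrable_fin_num iaF.
Qed.

End change_of_variables.

Section weak_deriv1_closure.
Context {R : realType}.
Local Notation leb := (@lebesgue_measure R).
Implicit Types f g phi : R -> R.

Lemma derive1_out phi (c t : R) : (forall u, c < `|u| -> phi u = 0) ->
  c < `|t| -> derive1 phi t = 0.
Proof.
move=> phi0 ct; rewrite derive1E -(@derive_cst R R^o R^o 0 t 1).
apply: near_eq_derive; near=> u; apply: phi0; near: u.
by apply: (@cvgr_norm_gt _ R^o) ct => //; exact: cvg_id.
Unshelve. all: by end_near. Qed.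

Lemma test_fun1_derive phi : test_fun1 phi -> test_fun1 (derive1 phi).
Proof.
move=> [sphi [c phi0]]; split; first exact: smooth1_derive.
by exists c => t; exact: derive1_out.
Qed.

Lemma test_fun1_derive1n k phi : test_fun1 phi -> test_fun1 (derive1n k phi).
Proof. by move=> tphi; elim: k => [//|k IH]; rewrite derive1nS; exact: test_fun1_derive. Qed.

Lemma test_fun1_bounded_csupp1 phi : test_fun1 phi -> bounded_csupp1 phi.
Proof.
move=> [sphi [c phi0]]; have cphi := smooth1_continuous sphi; split.
- exact: continuous_measurable_fun.
- have : compact (phi @` `[- c, c]).
    apply: continuous_compact; last exact: segment_compact.
    exact: continuous_subspaceT.
  move=> /compact_bounded[M [_ /(_ (M + 1))]]; rewrite ltrDl ltr01 => /(_ isT) MK.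
  exists (Num.max 0 (M + 1)) => t; rewrite le_max.
  have [tc|tc] := leP `|t| c; last by rewrite phi0// normr0 lexx.
  by rewrite (MK (phi t)) ?orbT//; exists t => //=; rewrite in_itv/= -ler_norml.
- by exists c.
Qed.

Lemma test_fun1_affine phi (a b : R) : a != 0 -> test_fun1 phi -> test_fun1 (fun t => phi (a * t + b)).
Proof.
move=> a0 [sphi [c phi0]]; split; first exact: smooth1_affine.
exists ((c + `|b|) / `|a|) => t; rewrite ltr_pdivrMr ?normr_gt0// => ct.
apply: phi0; have := ler_normB (a * t + b) b.
by rewrite addrK normrM mulrC; lra.
Qed.

Lemma integral_by_parts (u phi : R -> R) (a b : R) : a < b ->
  (forall t, a <= t <= b -> derivable u t 1) ->
  (forall t, a <= t <= b -> {for t, continuous (derive1 u)}) ->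
  smooth1 phi -> phi a = 0 -> phi b = 0 ->
  \int[leb]_(t in `[a, b]) (u t * derive1 phi t) =
  - \int[leb]_(t in `[a, b]) (derive1 u t * phi t).
Proof.
move=> ab du cdu sphi phia phib.
have cont (f : R -> R) t : derivable f t 1 -> {for t, continuous f}.
  by move=> /derivable1_diffP/differentiable_continuous.
have bnd (f : R -> R) : (forall t, a <= t <= b -> derivable f t 1) ->
    derivable_oo_LRcontinuous f a b.
  move=> df; split.
  - by move=> t; rewrite in_itv/= => /andP[at_ tb]; apply: df; rewrite !ltW.
  - by apply: cvg_at_right_filter; apply: cont; apply: df; rewrite lexx ltW.
  - by apply: cvg_at_left_filter; apply: cont; apply: df; rewrite lexx ltW.
have within (f : R -> R) : (forall t, a <= t <= b -> {for t, continuous f}) ->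
    {within `[a, b], continuous f}.
  move=> cf; apply: continuous_in_subspaceT => t.
  by rewrite inE/= in_itv/=; exact: cf.
rewrite (@Rintegration_by_parts R u phi (derive1 u) (derive1 phi))//.
- by rewrite phia phib !mulr0 subr0 sub0r.
- exact: within.
- exact: bnd.
- by apply: within => t _; exact/smooth1_continuous/smooth1_derive.
- by apply: bnd => t _; exact: (sphi 0%N).
Qed.

(** This serves the constant factors of tensor products. The integral reduces to [[-m, m]], with [m]
    beyond the supports of [phi] and [phi'], and vanishes by parts. *)
Lemma weak_deriv1_cst (k : R) : weak_deriv1 (fun=> k) (fun=> 0).
Proof.
split => //.
- by move=> c; exists `|k|.
- by move=> c; exists `|0 : R|.
move=> phi tphi.
under [in RHS]eq_Rintegral do rewrite mul0r.
rewrite Rintegral_cst// mul0r oppr0.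
have [_ _ [c dphi0]] := test_fun1_bounded_csupp1 (test_fun1_derive tphi).
have [sphi [c' phi0]] := tphi.
pose m := Num.max `|c| `|c'| + 1.
have mc : c < m.
  rewrite (le_lt_trans (ler_norm c))//.
  by rewrite (@le_lt_trans _ _ (Num.max `|c| `|c'|)) ?le_max ?lexx// ltrDl.
have mc' : c' < m.
  rewrite (le_lt_trans (ler_norm c'))//.
  by rewrite (@le_lt_trans _ _ (Num.max `|c| `|c'|)) ?le_max ?lexx ?orbT// ltrDl.
have m0 : 0 < m by rewrite ltr_wpDl// le_max normr_ge0.
rewrite (_ : \int[leb]_t _ = \int[leb]_(t in `[- m, m]) (k * derive1 phi t)); last first.
  rewrite [RHS]Rintegral_mkcond; apply: eq_Rintegral => t _.
  rewrite patchE; case: ifPn => //; rewrite notin_setE/= in_itv/= -ler_norml => /negP.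
  by rewrite -ltNge => mt; rewrite dphi0 ?mulr0// (lt_trans mc).
rewrite (@integral_by_parts (fun=> k))//; first last.
- by rewrite phi0// gtr0_norm.
- by rewrite phi0// normrN gtr0_norm.
- move=> t _; rewrite (_ : derive1 _ = fun=> 0); first exact: cvg_cst.
  by apply/funext => u; rewrite derive1_cst.
- by rewrite gtrN.
under eq_Rintegral do rewrite derive1_cst mul0r.
by rewrite Rintegral_cst// mul0r oppr0.
Qed.

Lemma locally_boundedZ (k : R) f : locally_bounded f -> locally_bounded (fun t => k * f t).
Proof.
move=> lf c; have [M fM] := lf c; exists (`|k| * M) => t tc.
by rewrite normrM ler_wpM2l// fM.
Qed.

Lemma locally_boundedD f g : locally_bounded f -> locally_bounded g ->
  locally_bounded (fun t => f t + g t).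
Proof.
move=> lf lg c; have [M fM] := lf c; have [N gN] := lg c; exists (M + N) => t tc.
by rewrite (le_trans (ler_normD _ _))// lerD ?fM ?gN.
Qed.

Lemma locally_bounded_affine (a b : R) f : locally_bounded f ->
  locally_bounded (fun t => f (a * t + b)).
Proof.
move=> lf c; have [M fM] := lf (`|a| * c + `|b|); exists M => t tc; apply: fM.
by rewrite (le_trans (ler_normD _ _))// lerD2r normrM ler_wpM2l.
Qed.

Lemma locally_bounded_integrable f phi : measurable_fun setT f -> locally_bounded f ->
  test_fun1 phi -> leb.-integrable setT (EFin \o (fun t => f t * phi t)).
Proof.
by move=> mf lf tphi; apply/bounded_csupp1_integrable/bounded_csupp1M/test_fun1_bounded_csupp1.
Qed.

Lemma weak_deriv1Z (k : R) f g : weak_deriv1 f g ->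
  weak_deriv1 (fun t => k * f t) (fun t => k * g t).
Proof.
move=> [mf mg lf lg fg]; split.
- exact: measurable_funM.
- exact: measurable_funM.
- exact: locally_boundedZ.
- exact: locally_boundedZ.
move=> phi tphi.
under eq_Rintegral do rewrite -mulrA.
under [in RHS]eq_Rintegral do rewrite -mulrA.
rewrite !RintegralZl//; first by rewrite fg// mulrN.
- exact: locally_bounded_integrable.
- by apply: locally_bounded_integrable => //; exact: test_fun1_derive.
Qed.

Lemma weak_deriv1D f g f' g' : weak_deriv1 f g -> weak_deriv1 f' g' ->
  weak_deriv1 (fun t => f t + f' t) (fun t => g t + g' t).
Proof.
move=> [mf mg lf lg fg] [mf' mg' lf' lg' fg']; split.
- exact: measurable_funD.
- exact: measurable_funD.
- exact: locally_boundedD.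
- exact: locally_boundedD.
move=> phi tphi; have tdphi := test_fun1_derive tphi.
under eq_Rintegral do rewrite mulrDl.
under [in RHS]eq_Rintegral do rewrite mulrDl.
rewrite !RintegralD//; first by rewrite fg// fg'// opprD.
- exact: locally_bounded_integrable.
- exact: locally_bounded_integrable.
- exact: locally_bounded_integrable.
- exact: locally_bounded_integrable.
Qed.

(** The hypothesis is tested against [phi((y - b) / a)], and [y = a t + b] is substituted; the [1/a]
    of the chain rule cancels the Jacobian on one side only. *)
Lemma weak_deriv1_affine (a b : R) f g : 0 < a -> weak_deriv1 f g ->
  weak_deriv1 (fun t => f (a * t + b)) (fun t => a * g (a * t + b)).
Proof.
move=> a0 [mf mg lf lg fg].
have maf := measurableT_comp mf (measurable_affine a b).
have mag := measurableT_comp mg (measurable_affine a b).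
split => //.
- exact: measurable_funM.
- exact: locally_bounded_affine.
- exact/locally_boundedZ/locally_bounded_affine.
move=> phi tphi; have an0 : a != 0 by rewrite gt_eqF.
pose psi t := phi (a^-1 * t + - (a^-1 * b)).
have tpsi : test_fun1 psi by apply: test_fun1_affine => //; rewrite invr_eq0.
have psiE t : psi (a * t + b) = phi t.
  by rewrite /psi mulrDr mulKf// addrK.
have dpsiE t : derive1 psi (a * t + b) = a^-1 * derive1 phi t.
  rewrite /psi derive1_affine; last by case: tphi => /(_ 0%N).
  by rewrite mulrDr mulKf// addrK.
have := fg psi tpsi.
rewrite (Rintegral_affine b a0); last first.
  by apply/bounded_csupp1M => //; exact/test_fun1_bounded_csupp1/test_fun1_derive.
rewrite [in X in _ = X -> _](Rintegral_affine b a0); last first.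
  by apply/bounded_csupp1M => //; exact/test_fun1_bounded_csupp1.
under eq_Rintegral do rewrite dpsiE mulrCA.
under [in X in _ = X -> _]eq_Rintegral do rewrite psiE.
rewrite RintegralZl//; last first.
  apply: locally_bounded_integrable => //; first exact: locally_bounded_affine.
  exact: test_fun1_derive.
rewrite mulrA divff// mul1r => ->.
under [in RHS]eq_Rintegral do rewrite -mulrA.
rewrite RintegralZl//.
by apply: locally_bounded_integrable => //; exact: locally_bounded_affine.
Qed.

End weak_deriv1_closure.

(** * Agreement of weak and classical derivatives *)

Section weak_eq_classical.
Context {R : realType}.
Local Notation leb := (@lebesgue_measure R).

Definition locally_integrable1 (u : R -> R) :=
  measurable_fun setT u /\ forall c : R, leb.-integrable `[- c, c]%classic (EFin \o u).

Lemma locally_integrable1_itv u (a b : R) : locally_integrable1 u ->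
  leb.-integrable `[a, b]%classic (EFin \o u).
Proof.
move=> [mu iu]; apply: integrableS (iu (Num.max `|a| `|b|)) => //.
move=> t /=; rewrite !in_itv/= -ler_norml => /andP[at_ tb]; rewrite le_max.
have [t0|t0] := leP 0 t.
  by rewrite (ger0_norm t0) (le_trans tb (ler_norm b)) orbT.
by rewrite (ltr0_norm t0) -[`|a|]normrN (le_trans _ (ler_norm _))// lerN2.
Qed.

Lemma integrable_locally_test_fun1 u phi : locally_integrable1 u -> test_fun1 phi ->
  leb.-integrable setT (EFin \o (fun t => u t * phi t)).
Proof.
move=> lu tphi; have [mphi [M phiM] [c phi0]] := test_fun1_bounded_csupp1 tphi.
have [mu iu] := lu.
rewrite (_ : (fun t => u t * phi t) = (fun t => phi t * u t) \_ `[- c, c]); last first.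
  apply/funext => t; rewrite patchE; case: ifPn; first by rewrite mulrC.
  rewrite notin_setE/= in_itv/= -ler_norml => /negP; rewrite -ltNge => ct.
  by rewrite phi0// mulr0.
rewrite -restrict_EFin -integrable_mkcond//.
apply: (@integrableMr _ (measurableTypeR R) R leb _ _ phi (EFin \o u)) => //.
- exact: measurable_funS mphi.
- exists M; split; first exact: num_real.
  by move=> x Mx t _; apply: le_trans (phiM t) _; exact: ltW.
Qed.

(** By parts on [[a, b]], [v] and [U'] have the same integral against every cutoff of []a, c[] with
    [c < b], so the fundamental lemma applies to their difference. As [u] and [U] agree only almost
    everywhere, the result can be iterated along the orders of derivation. *)
Lemma weak_eq_classical (u v U : R -> R) (a b : R) : a < b ->
  locally_integrable1 u -> locally_integrable1 v ->
  (forall phi, test_fun1 phi ->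
     \int[leb]_t (u t * derive1 phi t) = - \int[leb]_t (v t * phi t)) ->
  {ae leb, forall t, a <= t <= b -> u t = U t} ->
  (forall t, a <= t <= b -> derivable U t 1) ->
  (forall t, a <= t <= b -> {for t, continuous (derive1 U)}) ->
  {ae leb, forall t, a < t < b -> v t = derive1 U t}.
Proof.
move=> ab lu lv uv uU dU cdU.
have contU : {within `[a, b], continuous U}.
  apply: continuous_in_subspaceT => t; rewrite inE/= in_itv/= => tab.
  by apply/differentiable_continuous/derivable1_diffP; exact: dU.
have contdU : {within `[a, b], continuous (derive1 U)}.
  by apply: continuous_in_subspaceT => t; rewrite inE/= in_itv/=; exact: cdU.
have iU' : leb.-integrable `[a, b]%classic (EFin \o derive1 U).
  by apply: continuous_compact_integrable => //; exact: segment_compact.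
have iU : leb.-integrable `[a, b]%classic (EFin \o U).
  by apply: continuous_compact_integrable => //; exact: segment_compact.
have iv := locally_integrable1_itv a b lv.
(* The restriction makes [w] integrable on the line: [v] is only locally integrable, and [U] is
   controlled on [[a, b]] alone. *)
pose w := (v \- derive1 U) \_ `[a, b].
have iw : leb.-integrable setT (EFin \o w).
  rewrite /w -restrict_EFin -integrable_mkcond//.
  exact: (integrableB _ iv iU').
have restr (g phi : R -> R) : (forall t, ~~ (a <= t <= b) -> phi t = 0) ->
    \int[leb]_t (g t * phi t) = \int[leb]_(t in `[a, b]) (g t * phi t).
  move=> phi0; rewrite [RHS]Rintegral_mkcond; apply: eq_Rintegral => t _.
  rewrite patchE; case: ifPn => //; rewrite notin_setE/= in_itv/= => /negP tab.
  by rewrite phi0// mulr0.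
have w0 : {ae leb, forall t, a < t < b -> w t = 0}.
  apply: ae_eq0_cutoff => // c n /andP[ac cb].
  set phi := cutoff a c n.
  have tphi : test_fun1 phi := test_fun1_cutoff a c n.
  have sphi : smooth1 phi by case: tphi.
  have phi0 t : ~~ (a <= t <= b) -> phi t = 0.
    move=> tab; apply: cutoff_out; apply: contra tab => /andP[/ltW -> /ltW tc].
    by rewrite (le_trans tc)// ltW.
  have dphi0 t : ~~ (a <= t <= b) -> derive1 phi t = 0.
    move=> tab; rewrite derive1E -(@derive_cst R R^o R^o 0 t 1).
    apply: near_eq_derive; near=> y; apply: phi0; near: y.
    move: tab; rewrite negb_and -!ltNge => /orP[ta|bt].
      by near=> y; rewrite negb_and -!ltNge; apply/orP; left; near: y; exact: lt_nbhsl.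
    by near=> y; rewrite negb_and -!ltNge; apply/orP; right; near: y; exact: lt_nbhsr.
  have mphi : measurable_fun setT phi by have [] := test_fun1_bounded_csupp1 tphi.
  have mdphi : measurable_fun setT (derive1 phi).
    by have [] := test_fun1_bounded_csupp1 (test_fun1_derive tphi).
  have [_ [N phiN] _] := test_fun1_bounded_csupp1 tphi.
  have bphi : [bounded phi x | x in `[a, b]%classic].
    exists N; split; first exact: num_real.
    by move=> x Nx t _; apply: le_trans (phiN t) _; exact: ltW.
  have imul (g : R -> R) : leb.-integrable `[a, b]%classic (EFin \o g) ->
      leb.-integrable `[a, b]%classic (EFin \o (fun t => g t * phi t)).
    move=> ig; rewrite (_ : EFin \o _ = (EFin \o phi) \* (EFin \o g))%E; last first.
      by apply/funext => t /=; rewrite mulrC EFinM.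
    by apply: integrableMr => //; exact: measurable_funS mphi.
  rewrite (restr _ _ phi0).
  rewrite (_ : \int[leb]_(t in `[a, b]) _ =
      \int[leb]_(t in `[a, b]) (v t * phi t - derive1 U t * phi t)); last first.
    by apply: eq_Rintegral => t tab; rewrite /w patchE tab -mulrBl.
  rewrite RintegralB//; [|exact: imul|exact: imul].
  rewrite -(restr v _ phi0) -[X in X - _]opprK -uv// (restr _ _ dphi0).
  rewrite (_ : \int[leb]_(t in `[a, b]) _ = \int[leb]_(t in `[a, b]) (U t * derive1 phi t)).
    rewrite (@integral_by_parts _ U phi a b)//.
    - by rewrite opprK subrr.
    - by rewrite /phi cutoff_out// ltxx.
    - by rewrite /phi cutoff_out// negb_and -!leNgt (ltW cb) orbT.
  congr fine; apply: ae_eq_integral => //.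
  - apply/measurable_EFinP; apply: measurable_funM.
      by apply: measurable_funS lu.1.
    by apply: measurable_funS mdphi.
  - apply/measurable_EFinP; apply: measurable_funM; last by apply: measurable_funS mdphi.
    by apply/measurable_EFinP; case/integrableP : iU.
  - have FF := ae_filter_ringOfSetsType leb.
    move: uU; apply: filterS => t h; rewrite /= in_itv/= => tab.
    by rewrite h.
have FF := ae_filter_ringOfSetsType leb.
move: w0; apply: filterS => t h tab; have := h tab.
have tab' : t \in `[a, b]%classic by rewrite inE/= in_itv/=; case/andP: tab => /ltW -> /ltW ->.
by rewrite /w patchE tab' => /eqP; rewrite subr_eq0 => /eqP.
Unshelve. all: by end_near.
Qed.

(** The set [r < |t|] is a countable union of open intervals whose closures avoid [[-r, r]], so only
    countably many null sets have to be joined. *)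
Lemma ae_outside (r : R) (P : R -> Prop) : 0 <= r ->
  (forall a b, a < b -> (forall t, a <= t <= b -> r < `|t|) ->
     {ae leb, forall t, a < t < b -> P t}) ->
  {ae leb, forall t, r < `|t| -> P t}.
Proof.
move=> r0 abP; have FF := ae_filter_ringOfSetsType leb.
have pos : {ae leb, forall t, forall n, r + n.+1%:R^-1 < t < r + n.+2%:R -> P t}.
  apply: ae_foralln => n; apply: abP.
    rewrite ltrD2l (@le_lt_trans _ _ 1) ?ltr1n//.
    by rewrite invf_le1// ler1n.
  move=> t /andP[nt _].
  have : r < t by apply: lt_le_trans nt; rewrite ltrDl invr_gt0.
  by move=> rt; apply: lt_le_trans rt (ler_norm t).
have neg : {ae leb, forall t, forall n, - (r + n.+2%:R) < t < - (r + n.+1%:R^-1) -> P t}.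
  apply: ae_foralln => n; apply: abP.
    rewrite ltrN2 ltrD2l (@le_lt_trans _ _ 1) ?ltr1n//.
    by rewrite invf_le1// ler1n.
  move=> t /andP[_ nt].
  have : t < - r by apply: le_lt_trans nt _; rewrite ltrN2 ltrDl invr_gt0.
  by rewrite ltrNr -normrN => rt; apply: lt_le_trans rt (ler_norm _).
have key (u : R) : r < u ->
    exists n : nat, r + n.+1%:R^-1 < u < r + n.+2%:R.
  move=> ru; pose e := u - r.
  have e0 : 0 < e by rewrite subr_gt0.
  (* This [n] satisfies both [1 / (n + 1) < e] and [e < n + 1]. *)
  exists (maxn (Num.truncn e^-1) (Num.truncn e)).
  apply/andP; split.
    rewrite -ltrBrDl -/e invf_plt ?posrE//; apply: lt_le_trans (truncnS_gt _) _.
    by rewrite ler_nat ltnS leq_maxl.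
  rewrite -ltrBlDl -/e; apply: lt_le_trans (truncnS_gt _) _.
  by rewrite ler_nat ltnS leqW// leq_maxr.
move: pos neg; apply: filterS2 => t post negt rt.
have [t0|t0] := leP 0 t.
  rewrite (ger0_norm t0) in rt.
  by have [n nt] := key t rt; exact: post nt.
rewrite (ltr0_norm t0) in rt.
have [n /andP[n1 n2]] := key (- t) rt.
by apply: (negt n); rewrite ltrNl n2 ltrNr n1.
Qed.

End weak_eq_classical.

(** * The weak derivatives of an admissible function *)

Section cV1.
Context {R : realType}.
Local Notation leb := (@lebesgue_measure R).

(** Using [cV_cons] makes preimages under this map match the recursive definition of [lebesgue 1], a
    product with the Dirac mass on the one-point space R^0. *)
Definition cV1_of (t : R) : 'cV[R]_1 := cV_cons (t, 0).

Lemma cV1_ofE t : cV1_of t ord0 ord0 = t.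
Proof. by rewrite /cV1_of cV_consE0. Qed.

Lemma cV1_ofK (x : 'cV[R]_1) : cV1_of (x ord0 ord0) = x.
Proof. by apply/colP => i; rewrite (ord1 i) cV1_ofE. Qed.

Lemma measurable_cV1_of : measurable_fun setT cV1_of.
Proof.
exact: (measurableT_comp (@measurable_cV_cons R 0) (pair2_measurable (0 : 'cV[R]_0))).
Qed.

Lemma lebesgue1E (A : set 'cV[R]_1) : measurable A -> lebesgue 1 A = leb (cV1_of @^-1` A).
Proof.
move=> mA; rewrite /= /lebesgue_cons /pushforward /product_measure1.
have mE : measurable (cV1_of @^-1` A).
  by rewrite -[X in measurable X]setTI; exact: measurable_cV1_of.
rewrite -(setIT (cV1_of @^-1` A)) -[RHS](integral_indic leb measurableT mE).
apply: eq_integral => t _; rewrite /= /lebesgue0 diracE indicE; congr (_%:R%:E).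
have E : xsection (cV_cons (n:=0) @^-1` A) t 0 <-> (cV1_of @^-1` A) t.
  by rewrite /xsection /= inE.
by congr (nat_of_bool _); exact: asbool_equiv_eq E.
Qed.

Let pf : {measure set 'cV[R]_1 -> \bar R} :=
  measure_function_pushforward__canonical__measure_function_Measure leb measurable_cV1_of.

Lemma ge0_integral_cV1 (F : 'cV[R]_1 -> \bar R) : measurable_fun setT F ->
  (forall x, 0 <= F x)%E -> (\int[lebesgue 1]_x F x = \int[leb]_t F (cV1_of t))%E.
Proof.
move=> mF F0; rewrite (eq_measure_integral pf); last first.
  by move=> A mA _; exact: lebesgue1E.
by rewrite /= ge0_integral_pushforward//; exact: measurable_cV1_of.
Qed.

Lemma integral_cV1 (F : 'cV[R]_1 -> \bar R) : measurable_fun setT F ->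
  leb.-integrable setT (F \o cV1_of) ->
  (\int[lebesgue 1]_x F x = \int[leb]_t F (cV1_of t))%E.
Proof.
move=> mF iF; rewrite (eq_measure_integral pf); last first.
  by move=> A mA _; exact: lebesgue1E.
by rewrite /= integral_pushforward//; exact: measurable_cV1_of.
Qed.

Lemma ae_cV1 (P : 'cV[R]_1 -> Prop) :
  {ae lebesgue 1, forall x, P x} -> {ae leb, forall t, P (cV1_of t)}.
Proof.
move=> [Z [mZ Z0 PZ]]; exists (cV1_of @^-1` Z); split.
- by rewrite -[X in measurable X]setTI; exact: measurable_cV1_of.
- by rewrite -lebesgue1E.
by move=> t Pt; exact: PZ.
Qed.

Lemma continuous_cV1_of : continuous cV1_of.
Proof.
move=> t; rewrite (_ : cV1_of = (fun t => t *: cV1_of 1)).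
  by apply: cvgZr_tmp; exact: cvg_id.
apply/funext => u; apply/colP => i; rewrite (ord1 i) [RHS]mxE !cV1_ofE.
by rewrite mulr1.
Qed.

Lemma locally_integrable1_cV1_of (f : 'cV[R]_1 -> R) :
  locally_integrable_on setT f -> locally_integrable1 (f \o cV1_of).
Proof.
move=> [mf lf]; split; first exact: measurableT_comp mf measurable_cV1_of.
move=> c; have cK : compact (cV1_of @` `[- c, c]).
  apply: continuous_compact; last exact: segment_compact.
  by apply: continuous_subspaceT; exact: continuous_cV1_of.
have := lf _ cK (@subsetT _ _).
have mK := compact_measurable_cV cK.
move=> fK; apply/integrableP; split.
  apply/measurable_EFinP; apply: measurable_funS (measurableT_comp mf measurable_cV1_of) => //.
apply: le_lt_trans fK; rewrite integral_mkcond [leRHS]integral_mkcond.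
rewrite ge0_integral_cV1.
- rewrite le_eqVlt; apply/orP; left; apply/eqP; apply: eq_integral => t _.
  rewrite !patchE; congr (if _ then _ else _).
  apply/idP/idP; rewrite !inE; first by move=> tc; exists t.
  by move=> [u uc ut]; rewrite -(cV1_ofE t) -ut cV1_ofE.
- apply/(measurable_restrictT _ mK); apply/measurable_EFinP; apply: measurableT_comp => //.
  exact: measurable_funS mf.
- by move=> x; rewrite patchE; case: ifPn => // _; rewrite lee_fin.
Qed.

Lemma partial_on_R1 (f : R -> R) : partial ord0 (on_R1 f) = on_R1 (derive1 f).
Proof.
apply/funext => x; rewrite /partial /on_R1 derive1E /derive; congr (lim _).
under eq_fun do rewrite /= !mxE eqxx.
by [].
Qed.

Lemma derivable_on_R1 (f : R -> R) (x : 'cV[R]_1) : derivable f (x ord0 ord0) 1 ->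
  derivable (on_R1 f) x (delta_mx ord0 ord0).
Proof.
rewrite /derivable /on_R1 => df.
under eq_fun do rewrite /= !mxE eqxx.
by [].
Qed.

Lemma foldr_partial_on_R1 (f : R -> R) (s : seq 'I_1) :
  foldr partial (on_R1 f) s = on_R1 (derive1n (size s) f).
Proof.
elim: s => [//|i s IH]; rewrite [LHS]/= IH (ord1 i) partial_on_R1.
by rewrite [size _]/= derive1nS.
Qed.

Lemma continuous_coord0 : continuous (fun x : 'cV[R]_1 => x ord0 ord0).
Proof. exact: coord_continuous. Qed.

Lemma test_fun1_test_function (phi : R -> R) : test_fun1 phi -> test_function setT (on_R1 phi).
Proof.
move=> [sphi [c phi0]]; split.
  move=> s; rewrite foldr_partial_on_R1; have sd := @smooth1_derive1n _ (size s) _ sphi.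
  split; last by move=> i x; rewrite (ord1 i); apply: derivable_on_R1; exact: (sd 0%N).
  move=> x; apply: (@continuous_comp _ _ _ (fun x : 'cV[R]_1 => x ord0 ord0)
    (derive1n (size s) phi)).
    exact: continuous_coord0.
  exact: smooth1_continuous.
exists (cV1_of @` `[- c, c]); split => //.
  apply: continuous_compact; last exact: segment_compact.
  by apply: continuous_subspaceT; exact: continuous_cV1_of.
move=> x xK; apply: phi0; rewrite ltNge; apply/negP => xc; apply: xK.
by exists (x ord0 ord0); [rewrite /= in_itv/= -ler_norml|exact: cV1_ofK].
Qed.

Lemma mderiv_on_R1 (al : 'I_1 -> nat) (phi : R -> R) :
  mderiv al (on_R1 phi) = on_R1 (derive1n (al ord0) phi).
Proof. by rewrite mderivE foldr_partial_on_R1 size_directions /morder big_ord1. Qed.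

(** The representative [u] stands in for [f], which may fail to be Borel. *)
Lemma weak_derivative_cV1_of (al : 'I_1 -> nat) (f g : 'cV[R]_1 -> R) :
  weak_derivative setT al f g -> exists u : R -> R,
  [/\ {ae leb, forall t, f (cV1_of t) = u t}, locally_integrable1 u,
      locally_integrable1 (g \o cV1_of) & forall phi, test_fun1 phi ->
      \int[leb]_t (u t * derive1n (al ord0) phi t) =
      (-1) ^+ al ord0 * \int[leb]_t (g (cV1_of t) * phi t)].
Proof.
move=> [f0 [ff0 lf0 lg wfg]]; exists (f0 \o cV1_of).
have lu := locally_integrable1_cV1_of lf0; have lv := locally_integrable1_cV1_of lg.
split => //.
  have FF := ae_filter_ringOfSetsType leb.
  by have := ae_cV1 ff0; apply: filterS => t; exact.
move=> phi tphi; have := wfg _ (test_fun1_test_function tphi).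
rewrite mderiv_on_R1 /morder big_ord1.
have mul (v : 'cV[R]_1 -> R) psi : measurable_fun setT v -> locally_integrable1 (v \o cV1_of) ->
    test_fun1 psi -> (\int[lebesgue 1]_x (v x * on_R1 psi x)%:E =
      (\int[leb]_t (v (cV1_of t) * psi t))%R%:E)%E.
  move=> mv lov tpsi; have iv := integrable_locally_test_fun1 lov tpsi.
  rewrite integral_cV1.
  - by rewrite -RintegralE//; apply: eq_integral => t _; rewrite /on_R1 cV1_ofE.
  - apply/measurable_EFinP; apply: measurable_funM => //.
    by apply: measurableT_comp (measurable_coord _); have [] := test_fun1_bounded_csupp1 tpsi.
  - rewrite (_ : _ \o _ = EFin \o (fun t => (v \o cV1_of) t * psi t))//.
    by apply/funext => t /=; rewrite /on_R1 cV1_ofE.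
rewrite mul//; [|by case: lf0|exact: test_fun1_derive1n].
by rewrite mul//; [rewrite -EFinM => -[]|case: lg].
Qed.

End cV1.

(** * Pointwise and essential bounds *)

Section Linfty.
Context {R : realType} {d : nat}.
Implicit Types (f : 'cV[R]_d -> R) (Om : set 'cV[R]_d).

Lemma Linfty_norm_le Om f (M : R) : 0 <= M -> (forall x, Om x -> `|f x| <= M) ->
  (Linfty_norm Om f <= M%:E)%E.
Proof.
move=> M0 fM; rewrite /Linfty_norm unlock; case: ifPn => [_|_]; last by rewrite lee_fin.
apply/ess_supP; apply: nearW => x /=; rewrite lee_fin patchE.
by case: ifPn => [|_]; [rewrite inE; exact: fM|rewrite normr0].
Qed.

Lemma Linfty_norm_ae_bounded f : (Linfty_norm setT f < +oo)%E ->
  exists M : R, {ae lebesgue d, forall x, `|f x| <= M}.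
Proof.
rewrite /Linfty_norm unlock; case: ifPn => [mu0|mu0] ess.
  have [M essM] : exists M : R, (ess_sup (lebesgue d) (abse \o (EFin \o f \_ setT)) <= M%:E)%E.
    move: ess; case: (ess_sup _ _) => [r _| |] //; first by exists r.
    by exists 0; rewrite leNye.
  exists M; move/ess_supP : essM.
  have FF := ae_filter_ringOfSetsType (lebesgue d).
  by apply: filterS => x /=; rewrite lee_fin patchE in_setT.
(* When the whole space is null, the norm is 0 by convention and the whole space serves as
   exceptional set. *)
exists 0, setT; split => //.
by apply/eqP; rewrite eq_le measure_ge0 andbT leNgt.
Qed.

End Linfty.

Section raw_chain.
Context {R : realType}.
Local Notation leb := (@lebesgue_measure R).

(** Membership in the Sobolev space yields, for each order separately, a weak derivative of [g]
    tested against [phi^(i)]. Testing order [k] on [phi'] and order [k + 1] on [phi] links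
    consecutive orders, the form that tensor products require. *)
Lemma weak_derivative_in_W_chain (n : nat) (f : R -> R) : weak_derivative_in_W n f ->
  exists (G : nat -> R -> R) (M : R),
  [/\ {ae leb, forall t, f t = G 0%N t},
      forall k, (k <= n.+1)%N -> locally_integrable1 (G k),
      forall k phi, (k <= n)%N -> test_fun1 phi ->
        \int[leb]_t (G k t * derive1 phi t) = - \int[leb]_t (G k.+1 t * phi t) &
      forall k, (0 < k <= n.+1)%N -> {ae leb, forall t, `|G k t| <= M}].
Proof.
move=> [g [/weak_derivative_cV1_of[u [fu lu lg wug]] Wg]].
have FF := ae_filter_ringOfSetsType leb.
have [Mg gM] : exists M : R, {ae leb, forall t, `|g (cV1_of t)| <= M}.
  have [|M gM] := @Linfty_norm_ae_bounded R 1 g.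
    by apply: le_lt_trans Wg; rewrite /Wnorm le_max lexx.
  by exists M; exact: ae_cV1 gM.
have ex i : exists vM : (R -> R) * R, (i <= n)%N ->
    [/\ locally_integrable1 vM.1,
        forall phi, test_fun1 phi -> \int[leb]_t (g (cV1_of t) * derive1n i phi t) =
          (-1) ^+ i * \int[leb]_t (vM.1 t * phi t),
        {ae leb, forall t, `|vM.1 t| <= vM.2} &
        i = 0%N -> vM.1 = g \o cV1_of].
  case: i => [|i].
    by exists (g \o cV1_of, Mg) => _; split => // phi tphi; rewrite expr0 mul1r.
  (* Beyond order [n] an arbitrary pair makes the family total, as [choice] demands. *)
  have [ilen|] := leqP i.+1 n; last by exists (g \o cV1_of, 0).
  have : (weak_derivative_norm setT (fun=> i.+1) g < +oo)%E.
    apply: le_lt_trans Wg; rewrite /Wnorm le_max; apply/orP; right.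
    apply: ereal_sup_ubound; exists (fun=> i.+1) => //=.
    by rewrite /morder big_ord1.
  (* An infimum over the empty set is [+oo], so a finite value provides a weak derivative of finite
     norm. *)
  rewrite /weak_derivative_norm => /ereal_inf_lt[_ [v wv <-] vy].
  have [w [gw lw lv wvw]] := weak_derivative_cV1_of wv.
  have [M vM] := Linfty_norm_ae_bounded vy.
  exists (v \o cV1_of, M) => _; split => //; last exact: ae_cV1 vM.
  move=> phi tphi; rewrite -wvw//; congr fine.
  have tdphi := test_fun1_derive1n i.+1 tphi.
  apply: ae_eq_integral => //.
  - apply/measurable_EFinP; apply: measurable_funM; first exact: lg.1.
    by have [] := test_fun1_bounded_csupp1 tdphi.
  - apply/measurable_EFinP; apply: measurable_funM; first exact: lw.1.
    by have [] := test_fun1_bounded_csupp1 tdphi.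
  - by move: gw; apply: filterS => t gwt _; rewrite gwt.
have [V VE] := choice ex.
have V0 := (VE 0%N (leq0n n)).
(* Index 0 is a representative of [f], index [i + 1] the weak derivative of [g] of order [i]. The
   sum dominates the finitely many bounds at once. *)
exists (fun k => if k is i.+1 then (V i).1 else u), (\sum_(i < n.+1) `|(V i).2|).
split.
- by move: fu; apply: filterS => t; rewrite /on_R1 cV1_ofE.
- by move=> [|k] kn //; have [] := VE k kn.
- move=> [|k] phi kn tphi.
    rewrite wug// expr1 mulN1r; congr (- _).
    by have [_ _ _ ->] := V0.
  have [_ wk _ _] := VE k (ltnW kn).
  have [_ wkS _ _] := VE k.+1 kn.
  have := wkS phi tphi; rewrite derive1Sn wk; last exact: test_fun1_derive.
  rewrite exprS -mulrA mulN1r -mulrN.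
  by move/mulfI; apply; rewrite signr_eq0.
- move=> [//|k] /andP[_]; rewrite ltnS => kn; have [_ _ + _] := VE k kn.
  apply: filterS => t /le_trans; apply.
  have kn' : (k < n.+1)%N by rewrite ltnS.
  rewrite (bigD1 (Ordinal kn'))//= (le_trans (ler_norm _))// lerDl.
  by apply: sumr_ge0 => i _.
Qed.

End raw_chain.

Section admissible_chain.
Context {R : realType}.
Local Notation leb := (@lebesgue_measure R).

(** Outside [[-r, r]] the weak derivatives equal the classical ones almost everywhere, by induction
    on the order. Redefining them there, and wherever their bound fails, thus changes them on null
    sets only and keeps the integral identities. For [tau = 1], order 0 is [f] itself, unbounded in
    general, which the last clause leaves out. *)
Lemma admissible_chain (j tau : nat) (f : R -> R) (r Mf Mo : R) :
  (tau <= 1)%N -> 0 <= r -> (0 < j)%N -> weak_derivative_in_W j.-1 f ->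
  (tau = 0%N -> forall t, `|f t| <= Mf) ->
  (tau = 1%N -> continuous f) ->
  (forall (t : R) k, r < `|t| -> (k < j)%N -> derivable (derive1n k f) t 1) ->
  (forall (t : R) k, r < `|t| -> (k <= j)%N -> {for t, continuous (derive1n k f)}) ->
  (forall (t : R) k, r < `|t| -> (0 < k <= j)%N -> `|derive1n k f t| <= Mo) ->
  exists (h : nat -> R -> R) (M : R),
  [/\ {ae leb, forall t, f t = h 0%N t},
      tau = 1%N -> h 0%N = f,
      forall k t, r < `|t| -> h k t = derive1n k f t,
      forall k, (k < j)%N -> weak_deriv1 (h k) (h k.+1) &
      forall k t, (tau == 0%N) || (0 < k)%N -> (k <= j)%N -> `|h k t| <= M].
Proof.
move=> tau1 r0 j0 fW fb fc fd fcont fo.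
have FF := ae_filter_ringOfSetsType leb.
have [G [M [fG lG GG GM]]] := weak_derivative_in_W_chain fW.
rewrite (prednK j0) in lG GM.
have GG' k phi : (k < j)%N -> test_fun1 phi ->
    \int[leb]_t (G k t * derive1 phi t) = - \int[leb]_t (G k.+1 t * phi t).
  by move=> kj; apply: GG; rewrite -ltnS prednK.
have Gd k : (k <= j)%N -> {ae leb, forall t, r < `|t| -> G k t = derive1n k f t}.
  elim: k => [_|k IH kj]; first by move: fG; apply: filterS => t ft _; exact: esym.
  apply: ae_outside => // a b ab abr; rewrite derive1nS.
  apply: (weak_eq_classical ab (lG k (ltnW kj)) (lG k.+1 kj)).
  - by move=> phi; exact: GG'.
  - by move: (IH (ltnW kj)); apply: filterS => t Gt /abr; exact: Gt.
  - by move=> t /abr rt; exact: fd.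
  - by move=> t /abr rt; rewrite -derive1nS; exact: fcont.
(* One bound for all orders, inside and outside [[-r, r]]; the 0 covers the default value in [h]. *)
pose N := Num.max (Num.max Mf M) (Num.max Mo 0).
have N0 : 0 <= N by rewrite !le_max lexx !orbT.
(* [h k] is a representative of the k-th weak derivative for which the bounds and
   the equality with the classical derivative outside of [-r, r] hold everywhere,
   not only almost everywhere. *)
pose b (k : nat) (t : R) := (r < `|t|) || ((k == 0%N) && (tau == 1%N)).
pose h (k : nat) (t : R) :=
  if b k t then derive1n k f t else if `|G k t| <= N then G k t else 0.
have hN k t : ~~ b k t -> `|h k t| <= N.
  by rewrite /h => /negPf ->; case: ifPn => //; rewrite normr0.
have hb k t : r < `|t| -> h k t = derive1n k f t by rewrite /h /b => ->.
have hf : tau = 1%N -> h 0%N = f.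
  by move=> taue; apply/funext => t; rewrite /h /b taue !eqxx orbT.
have hM k t : (tau == 0%N) || (0 < k)%N -> (k <= j)%N -> `|h k t| <= N.
  move=> tauk kj; have [rt|rt] := ltP r `|t|; last first.
    apply: hN; rewrite /b ltNge rt/= negb_and.
    by move: tauk => /orP[/eqP ->|]; [rewrite orbT|rewrite lt0n => ->].
  rewrite hb//; have [k0|k0] := posnP k; last first.
    by rewrite !le_max fo ?orbT// k0.
  move: tauk; rewrite {}k0 ltnn orbF => /eqP tau0.
  by rewrite !le_max fb.
have mh k : (k <= j)%N -> measurable_fun setT (h k).
  move=> kj; have mG := (lG k kj).1.
  have mg : measurable_fun setT (fun t => if `|G k t| <= N then G k t else 0).
    apply: measurable_fun_ifT => //.
    by apply: measurable_fun_ler => //; exact: measurableT_comp.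
  have mr : measurable_fun setT (fun t : R => r < `|t|).
    by apply: measurable_fun_ltr => //; exact: measurableT_comp.
  have [/andP[/eqP k0 /eqP taue]|k0] := boolP ((k == 0%N) && (tau == 1%N)).
    by rewrite k0 hf//; apply: continuous_measurable_fun; exact: fc.
  rewrite (_ : h k = fun t => if r < `|t| then derive1n k f t else
      if `|G k t| <= N then G k t else 0); last first.
    by apply/funext => t; rewrite /h /b (negPf k0) orbF.
  apply: measurable_fun_if => //; last by apply: measurable_funS mg.
  (* The classical derivative is continuous on this open set, hence measurable there; inside
     [[-r, r]] it need not exist. *)
  have oD : open [set t : R | r < `|t|].
    rewrite (_ : [set t | _] = Num.norm @^-1` [set u | r < u])//.
    by apply: open_comp; [move=> t _; exact: norm_continuous|exact: open_gt].
  apply: (@measurable_funS _ _ _ _ [set t : R | r < `|t|]).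
  - exact: open_measurable.
  - by move=> t [].
  apply: open_continuous_measurable_fun => //.
  by move=> t; rewrite inE => rt; exact: fcont.
have aeh k : (k <= j)%N -> {ae leb, forall t, G k t = h k t}.
  move=> kj; have [tk|tk] := boolP ((tau == 0%N) || (0 < k)%N); last first.
    have tauE : tau = 1%N by move: tau1 tk; case: (tau) => [|[|]].
    have -> : k = 0%N by move: tk; rewrite negb_or -leqNgt leqn0 => /andP[_ /eqP].
    by rewrite hf//; move: fG; apply: filterS => t ft; exact: esym.
  have GN : {ae leb, forall t, `|G k t| <= N}.
    have [k0|k0] := posnP k; last first.
      have := GM k; rewrite k0 kj => /(_ isT); apply: filterS => t GMt.
      by rewrite !le_max GMt orbT.
    move: tk; rewrite {}k0 ltnn orbF => /eqP tau0.
    by move: fG; apply: filterS => t <-; rewrite !le_max fb.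
  move: (Gd k kj) GN; apply: filterS2 => t Gdt GNt.
  have [rt|rt] := ltP r `|t|; first by rewrite hb// Gdt.
  rewrite /h /b ltNge rt/= GNt ifF//.
  by move: tk => /orP[/eqP ->|]; [rewrite andbF|rewrite lt0n => /negPf ->].
have lh k : (k <= j)%N -> locally_bounded (h k).
  move=> kj; have [tk|tk] := boolP ((tau == 0%N) || (0 < k)%N).
    by move=> c; exists N => t _; exact: hM.
  have tauE : tau = 1%N by move: tau1 tk; case: (tau) => [|[|]].
  have -> : k = 0%N by move: tk; rewrite negb_or -leqNgt leqn0 => /andP[_ /eqP].
  rewrite hf// => c.
  have : compact (f @` `[- c, c]).
    apply: continuous_compact; last exact: segment_compact.
    by apply: continuous_subspaceT; exact: fc.
  move=> /compact_bounded[K [_ /(_ (K + 1))]]; rewrite ltrDl ltr01 => /(_ isT) fK.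
  by exists (K + 1) => t tc; apply: fK; exists t => //=; rewrite in_itv/= -ler_norml.
exists h, N; split => //.
- by move: fG (aeh 0%N (leq0n _)); apply: filterS2 => t -> ->.
move=> k kj; split.
- by apply: mh; exact: ltnW.
- exact: mh.
- by apply: lh; exact: ltnW.
- exact: lh.
move=> phi tphi.
have aeM (i : nat) psi : (i <= j)%N -> test_fun1 psi ->
    \int[leb]_t (h i t * psi t) = \int[leb]_t (G i t * psi t).
  move=> ij tpsi; have [mpsi _ _] := test_fun1_bounded_csupp1 tpsi.
  congr fine; apply: ae_eq_integral => //.
  - by apply/measurable_EFinP; apply: measurable_funM => //; exact: mh.
  - by apply/measurable_EFinP; apply: measurable_funM => //; exact: (lG i ij).1.
  - by move: (aeh i ij); apply: filterS => t -> _.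
rewrite aeM ?(ltnW kj)//; last exact: test_fun1_derive.
by rewrite GG'// aeM.
Qed.

End admissible_chain.

(** * The bumps *)

Section profile.
Context {R : realType}.
Local Notation leb := (@lebesgue_measure R).

Lemma decay_ge0 (kind : pu_kind) (D t : R) : 0 <= decay kind D t.
Proof. by case: kind => //=; rewrite ?expR_ge0 ?powR_ge0. Qed.

Lemma decay_le (kind : pu_kind) (D s t : R) : 0 < D -> 0 < s -> s <= t ->
  decay kind D t <= decay kind D s.
Proof.
move=> D0 s0 st; case: kind => //=.
  by rewrite ler_expR lerN2 ler_pM2l.
rewrite !powRN lef_pV2 ?posrE ?powR_gt0//; last exact: lt_le_trans st.
by apply: ge0_ler_powR => //; rewrite ?nnegrE ltW// (lt_le_trans s0).
Qed.

(* The k-th derivative of the profile E, when g is the k-th derivative of rho. *)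
Definition dprofile (tau : nat) (s : R) (k : nat) (g : R -> R) (y : R) : R :=
  if tau == 0%N then s ^+ k * g (s * y + s * (3 / 2))
  else s ^+ k * s^-1 * (g (s * y + s * 2) - g (s * y + s)).

Lemma psi_dprofile tau (f : R -> R) (A B s y : R) : s != 0 ->
  psi tau f A B s y = (B - A)^-1 * (dprofile tau s 0 f y - dprofile tau s 0 f (y - 3)).
Proof.
move=> s0; rewrite /psi /dprofile; case: ifP => _.
  by rewrite expr0 !mul1r; congr (_ * (f _ - f _)); field.
rewrite expr0 mul1r (_ : s * (y + 2) = s * y + s * 2); last by ring.
rewrite (_ : s * (y + 1) = s * y + s); last by ring.
rewrite (_ : s * (y - 1) = s * (y - 3) + s * 2); last by ring.
rewrite (_ : s * (y - 2) = s * (y - 3) + s); last by ring.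
by rewrite invfM; ring.
Qed.

Lemma eq_weak_deriv1 (f g f' g' : R -> R) : f =1 f' -> g =1 g' ->
  weak_deriv1 f g -> weak_deriv1 f' g'.
Proof. by move=> /funext -> /funext ->. Qed.

Lemma dprofile_weak tau s (g g' : R -> R) k : 0 < s -> weak_deriv1 g g' ->
  weak_deriv1 (dprofile tau s k g) (dprofile tau s k.+1 g').
Proof.
move=> s0 gg'; rewrite /dprofile; case: (tau == 0%N).
  have w := weak_deriv1Z (s ^+ k) (weak_deriv1_affine (s * (3 / 2)) s0 gg').
  apply: eq_weak_deriv1 w => y.
    by [].
  by rewrite exprS; ring.
have w2 := weak_deriv1_affine (s * 2) s0 gg'.
have w1 := weak_deriv1Z (-1) (weak_deriv1_affine s s0 gg').
have w := weak_deriv1Z (s ^+ k * s^-1) (weak_deriv1D w2 w1).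
apply: eq_weak_deriv1 w => y.
  by rewrite mulN1r.
by rewrite mulN1r exprS; ring.
Qed.

Lemma ae_affine (P : R -> Prop) (a b : R) : 0 < a ->
  {ae leb, forall t, P t} -> {ae leb, forall t, P (a * t + b)}.
Proof.
move=> a0 [Z [mZ Z0 PZ]]; exists ((fun t => a * t + b) @^-1` Z); split.
- by rewrite -[X in measurable X]setTI; exact: measurable_affine.
- have := lebesgue_measure_affine b a0 mZ; rewrite [X in X = _ -> _]Z0 => /esym/eqP.
  by rewrite mule_eq0 eqe gt_eqF//= => /eqP.
by move=> t /= Pt; exact: PZ.
Qed.

Lemma ae_dprofile tau s (f g : R -> R) : 0 < s ->
  {ae leb, forall t, f t = g t} ->
  {ae leb, forall t, dprofile tau s 0 f t = dprofile tau s 0 g t}.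
Proof.
move=> s0 fg; have FF := ae_filter_ringOfSetsType leb.
rewrite /dprofile; case: (tau == 0%N).
  by move: (ae_affine (s * (3 / 2)) s0 fg); apply: filterS => t ->.
by move: (ae_affine (s * 2) s0 fg) (ae_affine s s0 fg); apply: filterS2 => t -> ->.
Qed.

End profile.

(** * Uniform bounds and decay of the profile *)

Section profile_bounds.
Context {R : realType}.
Local Notation leb := (@lebesgue_measure R).

Lemma bounded_funE (f : R -> R) : bounded_fun f ->
  exists2 M : R, 0 <= M & forall t, `|f t| <= M.
Proof.
move=> [M [_ /(_ (M + 1))]]; rewrite ltrDl ltr01 => /(_ isT) fM.
have fM' t : `|f t| <= M + 1 by exact: fM.
by exists (M + 1) => //; apply: le_trans (fM' 0).
Qed.

Lemma lipschitzE (f : R -> R) : lipschitz f ->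
  exists2 L : R, 0 <= L & forall t u, `|f t - f u| <= L * `|t - u|.
Proof.
move=> [M [_ /(_ (M + 1))]]; rewrite ltrDl ltr01 => /(_ isT) fM.
have fM' t u : `|f t - f u| <= (M + 1) * `|t - u| by exact: (fM (t, u)).
exists (M + 1) => //; have := fM' 1 0; rewrite subr0 normr1 mulr1.
exact: le_trans.
Qed.

Lemma lipschitz_continuous (f : R -> R) : lipschitz f -> continuous f.
Proof.
move=> /lipschitzE[L L0 fL] t; apply/cvgrPdist_le => e e0.
have L1 : 0 < L + 1 by rewrite ltr_wpDl.
apply/nbhs_ballP; exists (e / (L + 1)) => /=; first exact: divr_gt0.
move=> u; rewrite /ball/= ltr_pdivlMr// => /ltW tu.
apply: le_trans (fL t u) _; apply: le_trans tu.
by rewrite mulrC ler_wpM2l// lerDl.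
Qed.

(* The mean value theorem turns the decay of [f^(tau)] into that of the profile. *)
Lemma dprofile0_near (tau : nat) (f : R -> R) (L s y eps : R) : (tau <= 1)%N -> 0 < s ->
  (forall t, s * y + s <= t <= s * y + s * 2 ->
    (tau = 1%N -> derivable f t 1) /\ `|L - derive1n tau f t| <= eps) ->
  `|L - dprofile tau s 0 f y| <= eps.
Proof.
rewrite /dprofile; case: tau => [|[|//]] _ s0 H /=.
  rewrite expr0 mul1r; apply: (H _ _).2.
  by apply/andP; split; lra.
set p := s * y + s; set q := s * y + s * 2.
have pq : p < q by rewrite ltrD2l ltr_pMr// ltr1n.
have fd t : t \in `]p, q[ -> is_derive t 1 f (derive1 f t).
  rewrite in_itv/= => /andP[/ltW pt /ltW tq].
  by apply: derivable_is_derive; apply: (H t _).1 => //; rewrite pt tq.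
have fc : {within `[p, q], continuous f}.
  apply: continuous_in_subspaceT => t; rewrite inE/= in_itv/= => tpq.
  by apply/differentiable_continuous/derivable1_diffP; apply: (H t _).1.
have [c cpq ->] := MVT pq fd fc.
have -> : q - p = s by rewrite /p /q; ring.
rewrite expr0 mul1r mulrCA mulVf ?gt_eqF// mulr1.
apply: (H c _).2; move: cpq; rewrite in_itv/= => /andP[/ltW pc /ltW cq].
by rewrite pc cq.
Qed.

(** For [tau = 1] the division by [s] lowers [s ^+ k] to [s ^+ (k - 1)], a true subtraction as
    [k >= 1]; the factor 2 comes from the two values of [g]. *)
Lemma dprofile_le (tau : nat) (g : R -> R) (s y eps : R) k : (tau <= 1)%N ->
  (tau <= k)%N -> 0 < s ->
  (forall t, s * y + s <= t <= s * y + s * 2 -> `|g t| <= eps) ->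
  `|dprofile tau s k g y| <= s ^+ (k - tau) * (2 * eps).
Proof.
move=> tau1 tk s0 H; have sk m : 0 <= s ^+ m by rewrite exprn_ge0// ltW.
rewrite /dprofile; case: tau tau1 tk => [|[|//]] _ tk.
  rewrite eqxx subn0 /= normrM (ger0_norm (sk k)) ler_pM2l ?exprn_gt0//.
  have gy : `|g (s * y + s * (3 / 2))| <= eps.
    by apply: H; apply/andP; split; lra.
  by apply: (le_trans gy); have := le_trans (normr_ge0 _) gy; lra.
case: k tk => [//|k _] /=; rewrite subn1 exprSr mulfK ?gt_eqF//.
rewrite normrM (ger0_norm (sk k)) ler_pM2l ?exprn_gt0//.
have g1 : `|g (s * y + s)| <= eps.
  by apply: H; rewrite lexx lerD2l ler_pMr// ler1n.
have g2 : `|g (s * y + s * 2)| <= eps.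
  by apply: H; rewrite lexx lerD2l ler_pMr// ler1n.
by apply: le_trans (ler_normB _ _) _; lra.
Qed.

(** This is all that the bumps retain of admissibility. In the zones [0 <= y] and [y <= -3] the
    arguments of [f] have absolute value at least [s], hence leave [[-r, r]]. The chain [e] is
    promised for [j > 0] only: its order 0 would make [f] measurable up to a null set. *)
Lemma profile_facts (kind : pu_kind) (j tau : nat) (f : R -> R) (A B : R) :
  (tau <= 1)%N -> pu_admissible kind j tau f A B ->
  exists K D S : R, [/\ 0 < K, 0 < D, 0 < S & forall s, 1 <= s -> S <= s ->
  [/\ forall y, `|dprofile tau s 0 f y| <= K,
      forall y, 0 <= y -> `|B - dprofile tau s 0 f y| <= K * decay kind D s,
      forall y, y <= - 3 -> `|A - dprofile tau s 0 f y| <= K * decay kind D s &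
      (0 < j)%N -> exists e : nat -> R -> R,
      [/\ {ae leb, forall t, dprofile tau s 0 f t = e 0%N t},
          forall k, (k < j)%N -> weak_deriv1 (e k) (e k.+1),
          forall y, 0 <= y \/ y <= - 3 -> e 0%N y = dprofile tau s 0 f y,
          forall k y, (k <= j)%N -> `|e k y| <= K * s ^+ (k - tau) &
          forall k y, (0 < k <= j)%N -> 0 <= y \/ y <= - 3 ->
            `|e k y| <= K * s ^+ (k - tau) * decay kind D s]]].
Proof.
move=> tau1 [[fb fl] fW AB [r [C [D [r0 C0 D0 [fd fcont fB fA fk]]]]]].
have [Mf Mf0 fM] : exists2 Mf : R, 0 <= Mf & tau = 0%N -> forall t, `|f t| <= Mf.
  have [/eqP|] := boolP (tau == 0%N); last by move=> /eqP taue; exists 0.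
  by move=> /fb/bounded_funE[M M0 fM]; exists M.
have [L L0 fL] : exists2 L : R, 0 <= L & tau = 1%N -> forall t u, `|f t - f u| <= L * `|t - u|.
  have [/eqP|] := boolP (tau == 1%N); last by move=> /eqP taue; exists 0.
  by move=> /fl/lipschitzE[M M0 fM']; exists M.
have dec t : r < t -> decay kind D t <= decay kind D r.
  by move=> /ltW; exact: decay_le.
pose Mo := `|A| + `|B| + C * decay kind D r.
have Cr0 : 0 <= C * decay kind D r by rewrite mulr_ge0 ?decay_ge0// ltW.
have fo (t : R) k : r < `|t| -> (0 < k <= j)%N -> `|derive1n k f t| <= Mo.
  move=> rt /andP[k0 kj]; have [tk|kt] := ltnP tau k.
    have Ck : C * decay kind D `|t| <= C * decay kind D r by rewrite ler_wpM2l ?dec// ltW.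
    apply: le_trans (fk t k rt _) _; first by rewrite tk.
    by rewrite /Mo; apply: le_trans Ck _; rewrite lerDr addr_ge0.
  (* The remaining case is [k = tau = 1], where closeness to [B] or [A] gives the bound. *)
  have tauk : tau = k by apply/eqP; rewrite eqn_leq kt andbT (leq_trans tau1).
  move: rt; rewrite -tauk ltr_normr => /orP[rt|rt].
    have Bt := le_trans (fB t rt) (ler_wpM2l (ltW C0) (dec t rt)).
    rewrite -[derive1n _ _ _](subKr B); apply: le_trans (ler_normB _ _) _.
    by rewrite /Mo; have := normr_ge0 A; lra.
  have rt' : t < - r by rewrite ltrNr.
  have At := le_trans (fA t rt') (ler_wpM2l (ltW C0) (dec (- t) rt)).
  rewrite -[derive1n _ _ _](subKr A); apply: le_trans (ler_normB _ _) _.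
  by rewrite /Mo; have := normr_ge0 B; lra.
have [h [M [M0 hM]]] : exists (h : nat -> R -> R) (M : R), 0 <= M /\ ((0 < j)%N ->
    [/\ {ae leb, forall t, f t = h 0%N t},
      tau = 1%N -> h 0%N = f,
      forall k t, r < `|t| -> h k t = derive1n k f t,
      forall k, (k < j)%N -> weak_deriv1 (h k) (h k.+1) &
      forall k t, (tau == 0%N) || (0 < k)%N -> (k <= j)%N -> `|h k t| <= M]).
  have [j0|j0] := posnP j; first by exists (fun=> f), 0; split => //; rewrite j0.
  have [||||h [M hM]] := @admissible_chain R j tau f r Mf Mo tau1 (ltW r0) j0 (fW j0) fM.
  - by move=> /fl; exact: lipschitz_continuous.
  - by move=> t k rt kj; apply: fd => //; rewrite (leq_trans kj)// leq_maxl.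
  - by move=> t k rt kj; exact: fcont.
  - by move=> t k rt kj; exact: fo.
  exists h, M; split => //; have [_ _ _ _ /(_ j 0)] := hM.
  by rewrite j0 orbT leqnn => /(_ isT isT); exact: le_trans.
(* [2 Mf + L] bounds the profile, [2 M] its derivatives and [2 C] their decay; the 1 ensures
   positivity. The threshold [r + 1] gives [s > r]. *)
exists (2 * Mf + L + 2 * M + 2 * C + 1), D, (r + 1); split => //.
- by rewrite ltr_wpDl// !addr_ge0// mulr_ge0// ltW.
- by rewrite addr_gt0.
move=> s s1 rs1; set K := (_ + 1).
have s0 : 0 < s by exact: lt_le_trans s1.
have rs : r < s by apply: lt_le_trans rs1; rewrite ltrDl.
set dl := decay kind D s; have dl0 : 0 <= dl by exact: decay_ge0.
have decs t : s <= t -> C * decay kind D t <= C * dl.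
  by move=> st; rewrite ler_wpM2l ?(ltW C0)//; exact: decay_le.
have KC : C * dl <= K * dl.
  by rewrite ler_wpM2r// /K; lra.
have range y t : 0 <= y \/ y <= - 3 -> s * y + s <= t <= s * y + s * 2 ->
    (0 <= y /\ s <= t) \/ (y <= - 3 /\ t <= - s).
  move=> [y0|y0] /andP[t1 t2]; [left|right]; split => //.
    by apply: le_trans t1; rewrite lerDr mulr_ge0// ltW.
  (* Here [s y + 2 s <= -3 s + 2 s = -s]. *)
  apply: le_trans t2 _; have : s * y <= s * - 3 by rewrite ler_pM2l.
  lra.
have outr t : s <= t \/ t <= - s -> r < `|t|.
  rewrite ltr_normr => -[st|st]; apply/orP; [left|right]; first exact: lt_le_trans st.
  by rewrite ltrNr; apply: le_lt_trans st _; rewrite ltrN2.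
have nearB t : s <= t -> `|B - derive1n tau f t| <= C * dl.
  by move=> st; apply: le_trans (fB t (lt_le_trans rs st)) (decs t st).
have nearA t : t <= - s -> `|A - derive1n tau f t| <= C * dl.
  move=> st; have st' : s <= - t by rewrite lerNr.
  apply: le_trans (fA t _) (decs _ st').
  by apply: le_lt_trans st _; rewrite ltrN2.
have dft t : s <= t \/ t <= - s -> tau = 1%N -> derivable f t 1.
  by move=> /outr rt taue; apply: (fd t 0%N rt); rewrite taue leq_maxr.
have fbd y : `|dprofile tau s 0 f y| <= 2 * Mf + L.
  move: (fM) (fL) tau1; rewrite /dprofile; case: (tau) => [|[|//]] fM' fL' _ /=.
    rewrite expr0 mul1r; apply: le_trans (fM' erefl _) _; lra.
  rewrite expr0 mul1r normrM gtr0_norm ?invr_gt0// ler_pdivrMl//.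
  apply: le_trans (fL' erefl _ _) _.
  rewrite (_ : _ - _ = s); last by ring.
  by rewrite gtr0_norm// mulrC ler_pM2l// lerDr mulr_ge0.
split.
- by move=> y; apply: le_trans (fbd y) _; rewrite /K; lra.
- move=> y y0; apply: le_trans KC; apply: dprofile0_near => // t tr.
  have [[_ st]|[y3 _]] := range y t (or_introl y0) tr; last by lra.
  by split; [apply: dft; left|exact: nearB].
- move=> y y0; apply: le_trans KC; apply: dprofile0_near => // t tr.
  have [[y3 _]|[_ st]] := range y t (or_intror y0) tr; first by lra.
  by split; [apply: dft; right|exact: nearA].
move=> j0; have [fh h0 hf hw hb] := hM j0.
exists (fun k => dprofile tau s k (h k)); split.
- exact: ae_dprofile.
- by move=> k kj; apply: dprofile_weak => //; exact: hw.
- move=> y yy; have hfE t : s * y + s <= t <= s * y + s * 2 -> h 0%N t = f t.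
    move=> tr; have st : s <= t \/ t <= - s by case: (range y t yy tr) => -[_]; [left|right].
    by rewrite hf//; exact: outr.
  rewrite /dprofile !hfE//; apply/andP; split; lra.
(* The other case is [tau = 1], [k = 0]: the values of [f] may be unbounded, and the Lipschitz
   constant bounds the quotient instead. *)
- move=> k y kj; have [tk|tk] := boolP ((tau == 0%N) || (0 < k)%N).
    have tauk : (tau <= k)%N by move: tk => /orP[/eqP ->//|]; exact: leq_trans.
    apply: le_trans (@dprofile_le tau (h k) s y M k tau1 tauk s0 _) _.
      by move=> t _; exact: hb.
    by rewrite mulrC ler_wpM2r ?exprn_ge0 ?(ltW s0)// /K; lra.
  have tauE : tau = 1%N by move: tau1 tk; case: (tau) => [|[|]].
  have kE : k = 0%N by move: tk; rewrite negb_or -leqNgt leqn0 => /andP[_ /eqP].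
  rewrite kE h0// sub0n expr0 mulr1; apply: le_trans (fbd y) _; rewrite /K; lra.
- move=> k y /andP[k0 kj] yy.
  have tauk : (tau <= k)%N by exact: leq_trans k0.
  have -> : K * s ^+ (k - tau) * dl = s ^+ (k - tau) * (K * dl) by ring.
  apply: (@le_trans _ _ (s ^+ (k - tau) * (2 * (C * dl)))); last first.
    rewrite ler_wpM2l ?exprn_ge0 ?(ltW s0)// mulrA ler_wpM2r// /K; lra.
  have [tk|kt] := ltnP tau k.
    apply: dprofile_le => // t tr.
    have st : s <= t \/ t <= - s by case: (range y t yy tr) => -[_]; [left|right].
    rewrite hf; last exact: outr.
    apply: le_trans (fk t k (outr t st) _) _; first by rewrite tk.
    apply: decs; rewrite ler_normr; apply/orP.
    by case: st => st; [left|right; rewrite lerNr].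
  have tkE : tau = k by apply/eqP; rewrite eqn_leq kt tauk.
  have tauE : tau = 1%N by move: tau1 k0; rewrite tkE; case: (k) => [|[|]].
  (* For [k = tau = 1] the function [h k] tends to [B] or [A], but it enters through a difference,
     which is unchanged when that limit is subtracted. *)
  have shift (c : R) : dprofile tau s k (h k) y = dprofile tau s k (fun t => h k t - c) y.
    by rewrite /dprofile tauE /=; congr (_ * _); ring.
  case: yy => y0.
    rewrite (shift B); apply: dprofile_le => // t tr.
    have [[_ st]|[y3 _]] := range y t (or_introl y0) tr; last by lra.
    by rewrite distrC hf ?(nearB t st) -?tkE ?nearB//; apply: outr; left.
  rewrite (shift A); apply: dprofile_le => // t tr.
  have [[y3 _]|[_ st]] := range y t (or_intror y0) tr; first by lra.
  by rewrite distrC hf -?tkE ?nearA//; apply: outr; right.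
Qed.

End profile_bounds.

(** * Estimates for products of one-dimensional factors *)

Section products.
Context {R : realType}.

(** Truncated subtraction satisfies [(a - tau) + (b - tau) <= (a + b) - tau]. Hence the powers of
    [s] from the factors stay within the one allowed for the total order. *)
Lemma sum_subn_le d (al : 'I_d -> nat) tau :
  (\sum_(l < d) (al l - tau) <= (\sum_(l < d) al l) - tau)%N.
Proof.
elim: d al => [|d IH] al; first by rewrite !big_ord0.
rewrite !big_ord_recl; apply: leq_trans (leq_add (leqnn _) (IH _)) _.
by move: (al ord0) (\sum_(i < d) _)%N => a b; lia.
Qed.

Variables (d tau k : nat) (al : 'I_d -> nat) (K n s : R).
Hypotheses (K1 : 1 <= K) (n1 : 1 <= n) (s1 : 1 <= s) (alk : (morder al <= k)%N).

Let K0 : 0 <= K. Proof. exact: le_trans K1. Qed.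
Let n0 : 0 <= n. Proof. exact: le_trans n1. Qed.
Let s0 : 0 <= s. Proof. exact: le_trans s1. Qed.

Lemma prod_order_le :
  \prod_(l < d) (K * n ^+ al l * s ^+ (al l - tau)) <= K ^+ d * n ^+ k * s ^+ (k - tau).
Proof.
rewrite !big_split /= prodr_const card_ord !prodrXr.
rewrite ler_pM ?mulr_ge0 ?exprn_ge0//.
  by rewrite ler_wpM2l ?exprn_ge0// ler_weXn2l.
rewrite ler_weXn2l//; apply: leq_trans (sum_subn_le al tau) _.
exact: leq_sub2r.
Qed.

Variable F : 'I_d -> R.
Hypothesis FK : forall l, `|F l| <= K * n ^+ al l * s ^+ (al l - tau).

Lemma normr_prod_order_le : `|\prod_(l < d) F l| <= K ^+ d * n ^+ k * s ^+ (k - tau).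
Proof.
apply: le_trans prod_order_le; rewrite normr_prod; apply: ler_prod => l _.
by rewrite normr_ge0 FK.
Qed.

(** One small factor makes the product small. It is applied with [l0] a coordinate in which the
    point is far from the node, or one in which the derivative has positive order. *)
Lemma normr_prod_order_small l0 (eps : R) :
  `|F l0| <= K * n ^+ al l0 * s ^+ (al l0 - tau) * eps ->
  `|\prod_(l < d) F l| <= K ^+ d * n ^+ k * s ^+ (k - tau) * eps.
Proof.
move=> Fl0; have c0 l : 0 <= K * n ^+ al l * s ^+ (al l - tau).
  by rewrite !mulr_ge0 ?exprn_ge0.
have c1 l : 0 < K * n ^+ al l * s ^+ (al l - tau).
  by rewrite !mulr_gt0 ?exprn_gt0// (lt_le_trans ltr01).
have eps0 : 0 <= eps.
  by rewrite -(pmulr_rge0 _ (c1 l0)); exact: le_trans Fl0.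
apply: (@le_trans _ _ (\prod_(l < d) (K * n ^+ al l * s ^+ (al l - tau)) * eps)).
  rewrite normr_prod (bigD1 l0)//= [X in _ <= X * _](bigD1 l0)//= mulrAC.
  rewrite ler_pM//; first by rewrite prodr_ge0.
  by apply: ler_prod => l _; rewrite normr_ge0 FK.
by rewrite ler_wpM2r// prod_order_le.
Qed.

End products.

(** Factors are peeled off by [1 - F0 P = (1 - F0) + F0 (1 - P)]; each of the [d] steps contributes
    at most [K ^+ d * eps]. *)
Lemma one_minus_prod_le (R : realType) d (K eps : R) (F : 'I_d -> R) : 1 <= K ->
  (forall l, `|F l| <= K) -> (forall l, `|1 - F l| <= K * eps) ->
  `|1 - \prod_(l < d) F l| <= d%:R * K ^+ d * eps.
Proof.
move=> K1; have K0 : 0 <= K by exact: le_trans K1.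
elim: d F => [|d IH] F FK Feps; first by rewrite big_ord0 subrr normr0 !mul0r.
have eps0 : 0 <= eps.
  rewrite -(pmulr_rge0 _ (lt_le_trans ltr01 K1)); exact: le_trans (Feps ord0).
rewrite big_ord_recl; set P := \prod_(i < d) _.
have -> : 1 - F ord0 * P = (1 - F ord0) + F ord0 * (1 - P) by ring.
apply: le_trans (ler_normD _ _) _; rewrite normrM.
have IHP : `|1 - P| <= d%:R * K ^+ d * eps by exact: IH.
apply: (@le_trans _ _ (K * eps + K * (d%:R * K ^+ d * eps))).
  by rewrite lerD ?Feps// ler_pM ?FK.
rewrite -natr1 mulrDl mul1r mulrDl exprS addrC lerD//.
  by rewrite le_eqVlt; apply/orP; left; apply/eqP; ring.
by rewrite ler_wpM2r// ler_peMr// exprn_ege1.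
Qed.

Lemma morder_gt0 d (al : 'I_d -> nat) : (0 < morder al)%N -> exists l, (0 < al l)%N.
Proof.
move=> al0; apply/existsP; move: al0; apply: contraTT.
rewrite negb_exists => /forallP al0.
rewrite -leqNgt leqn0 /morder sum_nat_eq0; apply/forallP => l.
by rewrite implyTb -leqn0 leqNgt al0.
Qed.

(* The constant function 1 is a tensor product of functions with weak derivative 0. *)
Lemma Rintegral_mderiv (R : realType) d (al : 'I_d -> nat) (phi : 'cV[R]_d -> R) :
  (0 < morder al)%N -> test_fun phi -> \int[lebesgue d]_x (mderiv al phi x) = 0.
Proof.
move=> al0 tphi; pose h (l : 'I_d) (i : nat) : R -> R := fun=> (i == 0%N)%:R.
have wh l i : weak_deriv1 (h l i) (h l i.+1) by exact: weak_deriv1_cst.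
have mh l i : measurable_fun setT (h l i) /\ locally_bounded (h l i).
  by have [? _ ? _ _] := wh l i.
have := tensor_mderiv (h := h) (fun l i _ => mh l i)
  (fun l i (_ : (i < al l)%N) => wh l i) tphi.
rewrite (_ : \int[_]_x _ = \int[lebesgue d]_x (mderiv al phi x)); last first.
  by apply: eq_Rintegral => x _; rewrite big1 ?mul1r.
move=> ->.
rewrite (_ : \int[_]_x _ = 0) ?mulr0//.
have [l all] := morder_gt0 al0.
rewrite (_ : (fun x => _) = (fun=> 0)).
  by rewrite Rintegral_cst// mul0r.
by apply/funext => x; rewrite (bigD1 l)//= /h eqn0Ngt all !mul0r.
Qed.

(** * Sobolev norms of tensor products *)

Section Wnorm.
Context {R : realType} {d : nat}.
Local Notation leb := (@lebesgue_measure R).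
Implicit Types (f : 'cV[R]_d -> R) (Om : set 'cV[R]_d).

(** The norm of a weak derivative is an infimum over its representatives, so one well-chosen
    representative per index bounds it. *)
Lemma Wnorm_le Om k f (M : R) : 0 <= M -> (forall x, Om x -> `|f x| <= M) ->
  (forall al, (0 < morder al <= k)%N ->
    exists2 g, weak_derivative Om al f g & forall x, Om x -> `|g x| <= M) ->
  (Wnorm Om k f <= M%:E)%E.
Proof.
move=> M0 fM gM; rewrite /Wnorm ge_max; apply/andP; split.
  exact: Linfty_norm_le.
apply: ge_ereal_sup => _ [al /= alk <-].
have [g wg gb] := gM al alk.
by apply: ge_ereal_inf; exists (Linfty_norm Om g); [exists g|exact: Linfty_norm_le].
Qed.

Variables (k : nat) (t : 'I_d -> R -> R) (eta : 'I_d -> nat -> R -> R).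
Hypothesis t_eta : forall l, {ae leb, forall u, t l u = eta l 0%N u}.
Hypothesis weta : forall l i, (i < k)%N -> weak_deriv1 (eta l i) (eta l i.+1).
Hypothesis beta : forall l i, (i <= k)%N -> bounded_on_R (eta l i).

Let measurable_eta l i : (0 < k)%N -> (i <= k)%N -> measurable_fun setT (eta l i).
Proof.
move=> k0; rewrite leq_eqVlt => /predU1P[->|ik]; last by have [] := weta l ik.
by rewrite -(prednK k0); have [] := @weta l k.-1 _; rewrite ?prednK.
Qed.

Let locally_bounded_eta l i : (i <= k)%N -> locally_bounded (eta l i).
Proof. by move=> ik c; have [M etaM] := beta l ik; exists M => u _. Qed.

Let ae_prod : {ae lebesgue d, forall x : 'cV[R]_d,
  \prod_(l < d) t l (x l ord0) = \prod_(l < d) eta l 0%N (x l ord0)}.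
Proof.
have FF := ae_filter_ringOfSetsType (lebesgue (R := R) d).
have : {ae lebesgue d, forall x : 'cV[R]_d,
    forall l : 'I_d, t l (x l ord0) = eta l 0%N (x l ord0)}.
  apply: filter_forall => l; exact: (ae_coord l (t_eta l)).
by apply: filterS => x tx; apply: eq_bigr => l _.
Qed.

Let measurable_prod (be : 'I_d -> nat) : (0 < k)%N -> (forall l, (be l <= k)%N) ->
  measurable_fun setT (fun x : 'cV[R]_d => \prod_(l < d) eta l (be l) (x l ord0)).
Proof.
move=> k0 bek; apply: measurable_prod => l _.
by apply: measurableT_comp (measurable_coord _); exact: measurable_eta.
Qed.

Let bounded_prod (be : 'I_d -> nat) : (forall l, (be l <= k)%N) ->
  bounded_on_R (fun x : 'cV[R]_d => \prod_(l < d) eta l (be l) (x l ord0)).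
Proof.
move=> bek; have /choice[M etaM] : forall l, exists M : R, forall u, `|eta l (be l) u| <= M.
  by move=> l; exact: beta.
exists (\prod_(l < d) M l) => x; rewrite normr_prod; apply: ler_prod => l _.
by rewrite normr_ge0 etaM.
Qed.

Let al_le (al : 'I_d -> nat) l : (morder al <= k)%N -> (al l <= k)%N.
Proof. by apply: leq_trans; rewrite /morder (bigD1 l)//= leq_addr. Qed.

Let tensor_eta al phi : (0 < morder al <= k)%N -> test_fun phi ->
  \int[lebesgue d]_x ((\prod_(l < d) eta l 0%N (x l ord0)) * mderiv al phi x) =
  (-1) ^+ morder al *
    \int[lebesgue d]_x ((\prod_(l < d) eta l (al l) (x l ord0)) * phi x).
Proof.
move=> /andP[al0 alk] tphi; have k0 := leq_trans al0 alk.
apply: tensor_mderiv => // l i ial; have ik := leq_trans ial (al_le l alk).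
- by split; [exact: measurable_eta|exact: locally_bounded_eta].
- exact: weta.
Qed.

(** [t] holds the actual factors, possibly not Borel, and [eta l 0] a representative of each. The
    representatives supply both the function [f0] of the definition and the derivative. *)
Lemma tensor_weak_derivative Om f al : (0 < morder al <= k)%N ->
  (forall x, Om x -> f x = \prod_(l < d) t l (x l ord0)) ->
  weak_derivative Om al f (fun x => \prod_(l < d) eta l (al l) (x l ord0)).
Proof.
move=> al0k ft; have /andP[al0 alk] := al0k; have k0 := leq_trans al0 alk.
have FF := ae_filter_ringOfSetsType (lebesgue (R := R) d).
apply: (@weak_derivative_bounded _ _ _ _ _ (fun x => \prod_(l < d) eta l 0%N (x l ord0))).
- by move: ae_prod; apply: filterS => x tx /ft ->.
- exact: (@measurable_prod (fun=> 0%N)).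
- exact: (@bounded_prod (fun=> 0%N)).
- by apply: measurable_prod => // l; exact: al_le.
- by apply: bounded_prod => // l; exact: al_le.
- by move=> phi; exact: tensor_eta.
Qed.

(** The 1 contributes the integral of a derivative of positive order of a test function, which is
    0. *)
Lemma one_minus_tensor_weak_derivative Om f al : (0 < morder al <= k)%N ->
  (forall x, Om x -> f x = 1 - \prod_(l < d) t l (x l ord0)) ->
  weak_derivative Om al f (fun x => - \prod_(l < d) eta l (al l) (x l ord0)).
Proof.
move=> al0k ft; have /andP[al0 alk] := al0k; have k0 := leq_trans al0 alk.
have FF := ae_filter_ringOfSetsType (lebesgue (R := R) d).
pose P0 (x : 'cV[R]_d) := \prod_(l < d) eta l 0%N (x l ord0).
have mP0 : measurable_fun setT P0 by exact: (@measurable_prod (fun=> 0%N)).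
have bP0 : bounded_on_R P0 by exact: (@bounded_prod (fun=> 0%N)).
have mP := measurable_prod k0 (fun l => al_le l alk).
have bP := bounded_prod (fun l => al_le l alk).
apply: (@weak_derivative_bounded _ _ _ _ _ (fun x => 1 - P0 x)).
- by move: ae_prod; apply: filterS => x tx /ft ->; rewrite tx.
- exact: measurable_funB.
- have [M PM] := bP0; exists (1 + M) => x.
  by apply: le_trans (ler_normB _ _) _; rewrite normr1 lerD2l.
- exact: measurableT_comp.
- by have [M PM] := bP; exists M => x; rewrite normrN.
move=> phi tphi.
have nmd : bounded_csupp (mderiv al phi) by rewrite mderivE; exact/test_fun_bounded_csupp/test_fun_foldr.
have int1 := Rintegral_mderiv al0 tphi.
under eq_Rintegral do rewrite mulrBl mul1r.
under [in RHS]eq_Rintegral do rewrite mulNr -mulN1r.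
rewrite RintegralB//; last 2 first.
- exact: bounded_csupp_integrable.
- by apply: bounded_csupp_integrable; exact: bounded_csupp_boundedM.
rewrite int1 sub0r tensor_eta// RintegralZl//; first by rewrite mulN1r mulrN.
by apply: bounded_csupp_integrable; apply: bounded_csupp_boundedM => //; exact: test_fun_bounded_csupp.
Qed.

End Wnorm.

(** * One-dimensional bumps and their telescoped sums *)

Section pu_bump1.
Context {R : realType}.
Local Notation leb := (@lebesgue_measure R).
Variables (A B : R).
Hypothesis AB : A < B.

Let BA0 : 0 < B - A. Proof. by rewrite subr_gt0. Qed.
Let BAV0 : 0 < (B - A)^-1. Proof. by rewrite invr_gt0. Qed.

(* For a = 3 N and k = 0, the choice c = 3 m, w = 3 gives the factors of the
   bumps, and c = 0, w = 3 (N + 1) their sum over m. *)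
Definition pu_bump1 (a c w : R) (k : nat) (g : R -> R) (x : R) : R :=
  a ^+ k * (B - A)^-1 * (g (a * x - c) - g (a * x - c - w)).

Lemma bump_weak a c w k (g g' : R -> R) : 0 < a -> weak_deriv1 g g' ->
  weak_deriv1 (pu_bump1 a c w k g) (pu_bump1 a c w k.+1 g').
Proof.
move=> a0 gg'.
have w1 := weak_deriv1_affine (- c) a0 gg'.
have w2 := weak_deriv1Z (-1) (weak_deriv1_affine (- c - w) a0 gg').
have wk := weak_deriv1Z (a ^+ k * (B - A)^-1) (weak_deriv1D w1 w2).
apply: eq_weak_deriv1 wk => x; first by rewrite mulN1r addrA.
by rewrite mulN1r /pu_bump1 exprS addrA; ring.
Qed.

Lemma ae_bump a c w (f g : R -> R) : 0 < a -> {ae leb, forall t, f t = g t} ->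
  {ae leb, forall t, pu_bump1 a c w 0 f t = pu_bump1 a c w 0 g t}.
Proof.
move=> a0 fg; have FF := ae_filter_ringOfSetsType leb.
move: (ae_affine (- c) a0 fg) (ae_affine (- c - w) a0 fg).
by apply: filterS2 => t h1 h2; rewrite /pu_bump1 h1 -addrA h2.
Qed.

Lemma psi_bump tau (f : R -> R) (s x : R) (N m : nat) : s != 0 -> (0 < N)%N ->
  psi tau f A B s (3 * N%:R * (x - m%:R / N%:R)) =
  pu_bump1 (3 * N%:R) (3 * m%:R) 3 0 (dprofile tau s 0 f) x.
Proof.
move=> s0 N0; have Nn0 : N%:R != 0 :> R by rewrite pnatr_eq0 -lt0n.
rewrite psi_dprofile// /pu_bump1 expr0 mul1r.
by rewrite (_ : 3 * N%:R * (x - _) = 3 * N%:R * x - 3 * m%:R)//; field.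
Qed.

Lemma sum_bump a (g : R -> R) (x : R) n :
  \sum_(i < n) pu_bump1 a (3 * i%:R) 3 0 g x = pu_bump1 a 0 (3 * n%:R) 0 g x.
Proof.
rewrite /pu_bump1 -mulr_sumr; congr (_ * _).
elim: n => [|n IH]; first by rewrite big_ord0 mulr0 !subr0 subrr.
rewrite big_ord_recr /= IH !subr0.
have -> : a * x - 3 * n.+1%:R = a * x - 3 * n%:R - 3 by rewrite -[n.+1%:R]natr1; ring.
by rewrite addrA subrK.
Qed.

Lemma bump_le a c w k (g : R -> R) x (eps : R) : 0 <= a ->
  `|g (a * x - c)| <= eps -> `|g (a * x - c - w)| <= eps ->
  `|pu_bump1 a c w k g x| <= a ^+ k * (2 * eps / (B - A)).
Proof.
move=> a0 g1 g2; rewrite /pu_bump1 normrM normrM (gtr0_norm BAV0).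
rewrite ger0_norm ?exprn_ge0// -mulrA ler_wpM2l ?exprn_ge0//.
rewrite mulrC ler_wpM2r ?(ltW BAV0)//.
by apply: le_trans (ler_normB _ _) _; lra.
Qed.

(** Both values are close to the same limit [L], which cancels in their difference. *)
Lemma bump0_near (L a c w : R) (g : R -> R) x (eps : R) :
  `|L - g (a * x - c)| <= eps -> `|L - g (a * x - c - w)| <= eps ->
  `|pu_bump1 a c w 0 g x| <= 2 * eps / (B - A).
Proof.
move=> g1 g2; rewrite /pu_bump1 expr0 mul1r normrM (gtr0_norm BAV0).
rewrite mulrC ler_wpM2r ?(ltW BAV0)//.
rewrite (_ : g _ - g _ = (L - g (a * x - c - w)) - (L - g (a * x - c))); last by ring.
by apply: le_trans (ler_normB _ _) _; lra.
Qed.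

(** The two values are close to different limits, whose difference [B - A] the normalization turns
    into 1. *)
Lemma one_minus_bump (a c w : R) (g : R -> R) x (eps : R) :
  `|B - g (a * x - c)| <= eps -> `|A - g (a * x - c - w)| <= eps ->
  `|1 - pu_bump1 a c w 0 g x| <= 2 * eps / (B - A).
Proof.
move=> g1 g2; rewrite /pu_bump1 expr0 mul1r.
rewrite (_ : 1 - _ = (B - A)^-1 * ((B - g (a * x - c)) - (A - g (a * x - c - w)))); last first.
  by field; rewrite gt_eqF.
rewrite normrM (gtr0_norm BAV0) mulrC ler_wpM2r ?(ltW BAV0)//.
by apply: le_trans (ler_normB _ _) _; lra.
Qed.

Variables (j tau N : nat) (K s dl : R) (P : R -> R) (e : nat -> R -> R).
Hypotheses (K0 : 0 < K) (s1 : 1 <= s) (dl0 : 0 <= dl) (N0 : (0 < N)%N).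
Hypothesis PK : forall y, `|P y| <= K.
Hypothesis PB : forall y, 0 <= y -> `|B - P y| <= K * dl.
Hypothesis PA : forall y, y <= - 3 -> `|A - P y| <= K * dl.

(** [2 K / (B - A)] bounds a normalized difference of two profile values, [3 ^+ j] absorbs the 3 of
    [(3 N) ^+ k], and the 1 makes the constant at least 1, as the product estimates require. *)
Definition bump_const : R := 3 ^+ j * (2 * K / (B - A)) + 1.

Let a : R := 3 * N%:R.
Let a0 : 0 < a. Proof. by rewrite mulr_gt0// ltr0n. Qed.
Let s0 : 0 <= s. Proof. exact: le_trans s1. Qed.
Let KBA0 : 0 <= 2 * K / (B - A). Proof. by rewrite !mulr_ge0 ?ltW. Qed.

Lemma bump_const_ge1 : 1 <= bump_const.
Proof. by rewrite /bump_const lerDr mulr_ge0// exprn_ge0. Qed.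

Let KBA_le k : (k <= j)%N -> 3 ^+ k * (2 * K / (B - A)) <= bump_const.
Proof.
move=> kj; apply: (@le_trans _ _ (3 ^+ j * (2 * K / (B - A)))); last by rewrite lerDl.
by rewrite ler_wpM2r// ler_weXn2l// ler1n.
Qed.

Let KBA_le0 : 2 * K / (B - A) <= bump_const.
Proof. by have := KBA_le (leq0n j); rewrite expr0 mul1r. Qed.

Lemma bump0_le c w x : `|pu_bump1 a c w 0 P x| <= bump_const.
Proof.
apply: (@le_trans _ _ (a ^+ 0 * (2 * K / (B - A)))); last by rewrite expr0 mul1r.
by apply: bump_le; rewrite ?PK// ltW.
Qed.

(** The arguments [a x - c] and [a x - c - 3] are then both nonnegative or both at most [-3], so
    that they share a limit. *)
Lemma bump0_far c x : 3 <= `|a * x - c| -> `|pu_bump1 a c 3 0 P x| <= bump_const * dl.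
Proof.
move=> far; apply: (@le_trans _ _ (2 * (K * dl) / (B - A))); last first.
  rewrite (_ : 2 * _ / _ = 2 * K / (B - A) * dl); last by ring.
  by rewrite ler_wpM2r.
move: far; rewrite ler_normr => /orP[far|far].
  by apply: (@bump0_near B); apply: PB; lra.
by apply: (@bump0_near A); apply: PA; lra.
Qed.

(** On []0, 1[] one has [3 N x >= 0] and [3 N x - 3 (N + 1) <= -3]: with the nodes from 0 to [N],
    the two ends of the telescoped sum fall in opposite zones. *)
Lemma one_minus_bump_le x : 0 < x < 1 ->
  `|1 - pu_bump1 a 0 (3 * N.+1%:R) 0 P x| <= bump_const * dl.
Proof.
move=> /andP[x0 x1]; apply: (@le_trans _ _ (2 * (K * dl) / (B - A))); last first.
  rewrite (_ : 2 * _ / _ = 2 * K / (B - A) * dl); last by ring.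
  by rewrite ler_wpM2r.
apply: one_minus_bump; first by apply: PB; rewrite subr0 mulr_ge0// ltW.
apply: PA; rewrite subr0 -[N.+1%:R]natr1 mulrDr mulr1 opprD addrA -/a.
by rewrite -[X in _ <= X]add0r lerD2r subr_le0 ler_piMr// ltW.
Qed.

Hypothesis ek : forall k y, (k <= j)%N -> `|e k y| <= K * s ^+ (k - tau).
Hypothesis efar : forall k y, (0 < k <= j)%N -> 0 <= y \/ y <= - 3 ->
  `|e k y| <= K * s ^+ (k - tau) * dl.

Lemma bump_chain_le k c w x : (k <= j)%N ->
  `|pu_bump1 a c w k (e k) x| <= bump_const * N%:R ^+ k * s ^+ (k - tau).
Proof.
move=> kj; have h := bump_le k (ltW a0) (ek (a * x - c) kj) (ek (a * x - c - w) kj).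
apply: le_trans h _.
rewrite /a exprMn.
rewrite [X in X <= _](_ : _ = 3 ^+ k * (2 * K / (B - A)) *
  (N%:R ^+ k * s ^+ (k - tau))); last by ring.
rewrite -[X in _ <= X]mulrA.
by apply: ler_wpM2r; rewrite ?KBA_le// mulr_ge0// exprn_ge0.
Qed.

(** Derivatives are small in both zones, so, unlike for the values, the two arguments may lie in
    opposite ones; this is the situation of the telescoped sum. *)
Lemma bump_chain_far k c w x : (0 < k <= j)%N ->
  0 <= a * x - c \/ a * x - c <= - 3 ->
  0 <= a * x - c - w \/ a * x - c - w <= - 3 ->
  `|pu_bump1 a c w k (e k) x| <= bump_const * N%:R ^+ k * s ^+ (k - tau) * dl.
Proof.
move=> k0j y1 y2; have /andP[_ kj] := k0j.
have h := bump_le k (ltW a0) (efar k0j y1) (efar k0j y2).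
apply: le_trans h _.
rewrite /a exprMn.
rewrite [X in X <= _](_ : _ = 3 ^+ k * (2 * K / (B - A)) *
  (N%:R ^+ k * s ^+ (k - tau) * dl)); last by ring.
rewrite [X in _ <= X](_ : _ = bump_const * (N%:R ^+ k * s ^+ (k - tau) * dl)); last by ring.
by apply: ler_wpM2r; rewrite ?KBA_le// !mulr_ge0// exprn_ge0.
Qed.

End pu_bump1.

(** * Realization of the bumps by two-layer networks *)

Section bump_network.
Context {R : realType}.

Lemma mx_norm_le m n (W : 'M[R]_(m, n)) (c : R) : 0 <= c ->
  (forall i j, `|W i j| <= c) -> `|W| <= c.
Proof.
move=> c0 Wc; rewrite [leLHS]/Num.Def.normr /= mx_normrE.
by apply: bigmax_le => // -[i j] _; exact: Wc.
Qed.

Lemma nb_nonzero_le m n (W : 'M[R]_(m, n)) : (nb_nonzero W <= m * n)%N.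
Proof. by apply: leq_trans (max_card _) _; rewrite card_prod !card_ord. Qed.

(* The neurons of one coordinate; two of the four are idle if tau = 0. *)
Definition psi_coef (tau : nat) (s : R) (A B : R) (p : bool * bool) : R :=
  if tau == 0%N then (if p.2 then 0 else (-1) ^+ p.1 * (B - A)^-1)
  else (-1) ^+ p.2 * (s * (B - A))^-1.

(** [p.1] is the sign of the shift. For [tau = 1], [p.2] selects the inner shift 1, whose
    coefficient is negative, instead of the outer shift 2. *)
Definition psi_shift (tau : nat) (p : bool * bool) : R :=
  if tau == 0%N then (-1) ^+ p.1 * (3 / 2)
  else (-1) ^+ p.1 * (if p.2 then 1 else 2).

Lemma psi_neurons tau (f : R -> R) (A B s y : R) :
  psi tau f A B s y =
  \sum_(p : bool * bool) psi_coef tau s A B p * f (s * (y + psi_shift tau p)).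
Proof.
rewrite -(pair_bigA _
  (fun a b => psi_coef tau s A B (a, b) * f (s * (y + psi_shift tau (a, b))))).
rewrite /= !big_bool /psi /psi_coef /psi_shift /=; case: (tau == 0%N).
  rewrite !expr0 !expr1 !mul1r !mulN1r.
  by move: (f _) (f _) => u v; ring.
rewrite !expr0 !expr1 !mul1r !mulN1r.
by move: (f _) (f _) (f _) (f _) ((s * (B - A))^-1) => u v w z c; ring.
Qed.

(** The hidden layer has [4 d] neurons, four per coordinate. The count takes all entries as nonzero:
    [4 d d + 4 d] in the first layer and [4 d d + d] in the second. As [s] and [N] are at least 1,
    the weights are bounded by [3 N s], [s (2 + 3 N) <= 5 s N] and [1 / (B - A)]. *)
Lemma bump_network (d tau N : nat) (f : R -> R) (A B s : R) (m : {ffun 'I_d -> 'I_N.+1}) :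
  (0 < d)%N -> (0 < N)%N -> 1 <= s -> A < B ->
  exists Phi : @network R d d,
  [/\ nb_layers Phi = 2%N, (nb_nonzero_weights Phi <= 8 * d * d + 5 * d)%N,
      forall x l, realization f Phi x l ord0 =
        psi tau f A B s (3 * N%:R * (x l ord0 - (m l)%:R / N%:R)) &
      max_weight Phi <= (5 + (B - A)^-1) * s * N%:R].
Proof.
move=> d0 N0 s1 AB.
have BA0 : 0 < (B - A)^-1 by rewrite invr_gt0 subr_gt0.
have N1 : 1 <= N%:R :> R by rewrite ler1n.
have s0 : 0 < s by exact: lt_le_trans s1.
pose I : finType := ('I_d * (bool * bool))%type.
pose n := #|{: I}|.
have nE : n = (4 * d)%N by rewrite /n !card_prod card_ord card_bool mulnC.
have n0 : (0 < n)%N by rewrite nE muln_gt0.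
pose iv (i : 'I_n) : I := enum_val i.
pose W1 : 'M[R]_(n, d) := \matrix_(i, l) (((iv i).1 == l)%:R * (3 * N%:R * s)).
pose b1 : 'cV[R]_n := \col_i (s * (psi_shift tau (iv i).2 - 3 * (m (iv i).1)%:R)).
pose W2 : 'M[R]_(d, n) := \matrix_(l, i) (((iv i).1 == l)%:R * psi_coef tau s A B (iv i).2).
exists (HiddenLayer W1 b1 n0 (OutputLayer W2 0)); split => //=.
- move: (nb_nonzero_le W1) (nb_nonzero_le b1) (nb_nonzero_le W2).
  move: (nb_nonzero_le (0 : 'cV[R]_d)).
  by move: (nb_nonzero W1) (nb_nonzero b1) (nb_nonzero W2) (nb_nonzero _); nia.
- move=> x l; rewrite psi_neurons mxE [X in _ + X]mxE addr0 mxE.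
  pose G (q : I) := (q.1 == l)%:R * psi_coef tau s A B q.2 *
    f (s * (3 * N%:R * (x q.1 ord0 - (m q.1)%:R / N%:R) + psi_shift tau q.2)).
  transitivity (\sum_(i < n) G (iv i)).
    apply: eq_bigr => i _; rewrite !mxE /G; congr (_ * f _).
    rewrite (bigD1 (iv i).1)//= big1; last first.
      by move=> k ki; rewrite !mxE eq_sym (negPf ki) !mul0r.
    rewrite !mxE eqxx mul1r addr0; field.
    by rewrite pnatr_eq0 -lt0n.
  rewrite -(big_enum_val G) /=.
  rewrite -(pair_bigA _ (fun a p => G (a, p))) /= (bigD1 l)//= [X in _ + X]big1 ?addr0.
    by apply: eq_bigr => p _; rewrite /G /= eqxx mul1r.
  by move=> k kl; apply: big1 => p _; rewrite /G /= (negPf kl) !mul0r.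
have Bs : (B - A)^-1 <= (5 + (B - A)^-1) * s * N%:R.
  apply: (@le_trans _ _ (5 + (B - A)^-1)); first by rewrite lerDr.
  have c0 : 0 <= 5 + (B - A)^-1 by rewrite addr_ge0// ltW.
  by rewrite -mulrA ler_peMr// mulr_ege1.
have sN5 : 5 * (s * N%:R) <= (5 + (B - A)^-1) * s * N%:R.
  by rewrite -mulrA ler_wpM2r ?lerDl ?(ltW BA0)// mulr_ge0// ltW.
have sN0 : 0 <= s * N%:R by rewrite mulr_ge0// ltW.
have c0 : 0 <= (5 + (B - A)^-1) * s * N%:R by exact: le_trans (ltW BA0) Bs.
have sg (b : bool) : `|(-1) ^+ b : R| = 1 by rewrite normrX normrN1 expr1n.
rewrite !ge_max; apply/andP; split; apply/andP; split.
- apply: mx_norm_le => // i l; rewrite mxE normrM; case: (_ == _); last by rewrite normr0 mul0r.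
  rewrite normr1 mul1r ger0_norm ?mulr_ge0 ?(ltW s0)//.
  by apply: le_trans sN5; rewrite -mulrA [N%:R * s]mulrC ler_wpM2r// ler_nat.
- apply: mx_norm_le => // i j; rewrite mxE normrM (gtr0_norm s0).
  apply: le_trans sN5; rewrite mulrCA ler_pM2l//.
  apply: le_trans (ler_normB _ _) _.
  have sh : `|psi_shift tau (iv i).2| <= 2.
    rewrite /psi_shift; case: (tau == 0%N); rewrite normrM sg mul1r ger0_norm//; first lra.
      by case: ifP => _; lra.
    by case: ifP => _; lra.
  have mN : (m (iv i).1)%:R <= N%:R :> R by rewrite ler_nat -ltnS.
  have m0 : 0 <= (m (iv i).1)%:R :> R by [].
  have m3 : `|3 * (m (iv i).1)%:R : R| = 3 * (m (iv i).1)%:R by rewrite ger0_norm ?mulr_ge0.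
  by rewrite m3; lra.
- apply: mx_norm_le => // l i; rewrite mxE normrM.
  apply: le_trans Bs; case: (_ == _); last by rewrite normr0 mul0r ltW.
  rewrite normr1 mul1r /psi_coef; case: (tau == 0%N).
    case: (iv i).2.2; first by rewrite normr0 ltW.
    by rewrite normrM sg mul1r gtr0_norm.
  rewrite normrM sg mul1r gtr0_norm ?invr_gt0 ?mulr_gt0 ?subr_gt0//.
  by rewrite invfM ler_piMl ?invf_le1 ?(ltW BA0).
- by rewrite normr0.
Qed.

End bump_network.

(** * Assembly of the partition of unity *)

Section partition.
Context {R : realType}.
Local Notation leb := (@lebesgue_measure R).

(** The sup norm is attained in some coordinate, and scaling by [3 N] turns the distance [1/N] into
    the 3 that [bump0_far] asks for. *)
Lemma far_from_nodeP d N (m : {ffun 'I_d -> 'I_N.+1}) (x : 'cV[R]_d) : (0 < N)%N ->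
  far_from_node m x ->
  exists l, 3 <= `|3 * N%:R * x l ord0 - 3 * (m l)%:R|.
Proof.
move=> N0; have n0 : 0 < N%:R :> R by rewrite ltr0n.
rewrite /far_from_node /= => far; apply/existsP; move: far; apply: contraTT.
rewrite negb_exists => /forallP near; rewrite -ltNge.
rewrite [ltLHS]/Num.Def.normr /= mx_normrE; apply: bigmax_lt; first by rewrite invr_gt0.
move=> [l i] _ /=; rewrite (ord1 i) !mxE -[ltRHS]mul1r ltr_pdivlMr//.
have := near l; rewrite -ltNge.
rewrite (_ : 3 * N%:R * _ - _ = 3 * ((x l ord0 - (m l)%:R / N%:R) * N%:R)); last first.
  by field; rewrite gt_eqF.
by rewrite normrM (gtr0_norm (x := 3))// normrM (gtr0_norm n0) gtr_pMr.
Qed.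

(** Expanding the product of the [d] one-dimensional sums gives exactly one term per multi-index
    [m]; each of these sums telescopes. *)
Lemma sum_pu_bump d tau (f : R -> R) (A B : R) N s (x : 'cV[R]_d) :
  s != 0 -> (0 < N)%N ->
  \sum_(m : {ffun 'I_d -> 'I_N.+1}) pu_bump tau f A B s m x =
  \prod_(l < d) pu_bump1 A B (3 * N%:R) 0 (3 * N.+1%:R) 0 (dprofile tau s 0 f) (x l ord0).
Proof.
move=> s0 N0; rewrite /pu_bump -(bigA_distr_bigA (fun (l : 'I_d) (i : 'I_N.+1) =>
  psi tau f A B s (3 * N%:R * (x l ord0 - i%:R / N%:R)))).
apply: eq_bigr => l _; rewrite -sum_bump.
by apply: eq_bigr => i _; rewrite psi_bump.
Qed.

End partition.

Theorem lemma4p5 (R : realType) (kind : pu_kind) (d j tau : nat)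
    (rho : R -> R) (A B : R) :
  (0 < d)%N -> (tau <= 1)%N ->
  pu_admissible kind j tau rho A B ->
  partition_of_unity_with rho kind j tau
    (fun N s m => @pu_bump R d tau rho A B N s m).
Proof.
move=> d0 tau1 adm; have [_ _ AB _] := adm.
have [K [D [S [K0 D0 S0 facts]]]] := profile_facts tau1 adm.
have BA0 : 0 < (B - A)^-1 by rewrite invr_gt0 subr_gt0.
pose K2 := bump_const A B j K.
have K21 : 1 <= K2 by exact: bump_const_ge1.
have K20 : 0 <= K2 by exact: le_trans K21.
pose cnt : R := (8 * d * d + 5 * d)%:R.
(* The terms serve, in this order, products and 1 minus a product, a single network component, the
   number of weights and their size. *)
pose C : R := d.+1%:R * K2 ^+ d + K2 + cnt + (5 + (B - A)^-1).
have cnt0 : 0 <= cnt by [].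
have Kd0 : 0 <= d%:R * K2 ^+ d by rewrite mulr_ge0 ?exprn_ge0.
have Kd1 : 0 <= K2 ^+ d by rewrite exprn_ge0.
have CE : C = d%:R * K2 ^+ d + K2 ^+ d + K2 + cnt + (5 + (B - A)^-1).
  by rewrite /C -natr1 mulrDl mul1r.
exists D, S, (fun=> C); split => //; first by move=> _; rewrite CE; lra.
move=> N s k N0 s1 Ss kj /=; set M := C * N%:R ^+ k * s ^+ (k - tau).
have [PK PB PA ex] := facts s s1 Ss.
set P := dprofile tau s 0 rho in PK PB PA.
have s0 : 0 < s by exact: lt_le_trans s1.
have N1 : 1 <= N%:R :> R by rewrite ler1n.
set dl := decay kind D s; have dl0 : 0 <= dl by exact: decay_ge0.
pose E : R := N%:R ^+ k * s ^+ (k - tau).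
have E1 : 1 <= E by rewrite mulr_ege1// exprn_ege1.
have E0 : 0 <= E by exact: le_trans E1.
have CM (c : R) : 0 <= c -> c <= C -> c * N%:R ^+ k * s ^+ (k - tau) <= M.
  by move=> c0 cC; rewrite /M -!mulrA ler_wpM2r.
have CM1 (c : R) : 0 <= c -> c <= C -> c <= M.
  by move=> c0 cC; apply: le_trans (CM c c0 cC); rewrite -mulrA ler_peMr.
have KdC : K2 ^+ d <= C by rewrite CE; lra.
have dKdC : d%:R * K2 ^+ d <= C by rewrite CE; lra.
have M0 : 0 <= M by apply: le_trans (CM1 _ Kd1 KdC).
pose a : R := 3 * N%:R.
have a0 : 0 < a by rewrite mulr_gt0// ltr0n.
(* For [j = 0] a dummy chain is taken; multi-indices of positive order do not occur then. *)
have [e eP] : exists e : nat -> R -> R, (0 < j)%N ->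
    [/\ {ae @lebesgue_measure R, forall t, P t = e 0%N t},
        forall k, (k < j)%N -> weak_deriv1 (e k) (e k.+1),
        forall y, 0 <= y \/ y <= - 3 -> e 0%N y = P y,
        forall k y, (k <= j)%N -> `|e k y| <= K * s ^+ (k - tau) &
        forall k y, (0 < k <= j)%N -> 0 <= y \/ y <= - 3 ->
          `|e k y| <= K * s ^+ (k - tau) * dl].
  by have [j0|/ex[e eP]] := posnP j; [exists (fun=> id); rewrite j0|exists e].
pose b c w i := pu_bump1 A B a c w i (e i).
pose bP c w := pu_bump1 A B a c w 0 P.
have bPK c w x : `|bP c w x| <= K2 by exact: bump0_le.
have bK i c w x : (0 < j)%N -> (i <= j)%N ->
    `|b c w i x| <= K2 * N%:R ^+ i * s ^+ (i - tau).
  by move=> /eP[_ _ _ ek _] ij; exact: bump_chain_le.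
have bw i c w : (i < j)%N -> weak_deriv1 (b c w i) (b c w i.+1).
  move=> ij; have [_ ew _ _ _] := eP (leq_ltn_trans (leq0n i) ij).
  by apply: bump_weak => //; exact: ew.
have bae c w : (0 < j)%N -> {ae @lebesgue_measure R, forall t, bP c w t = b c w 0%N t}.
  by move=> /eP[eae _ _ _ _]; exact: ae_bump.
have bdd i c w : (0 < j)%N -> (i <= j)%N -> bounded_on_R (b c w i).
  by move=> j0 ij; exists (K2 * N%:R ^+ i * s ^+ (i - tau)) => x; exact: bK.
have psiE (m : nat) (x : R) :
    psi tau rho A B s (3 * N%:R * (x - m%:R / N%:R)) = bP (3 * m%:R) 3 x.
  by rewrite psi_bump// gt_eqF.
have pu_bumpE (m : {ffun 'I_d -> 'I_N.+1}) (x : 'cV[R]_d) :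
    pu_bump tau rho A B s m x = \prod_(l < d) bP (3 * (m l)%:R) 3 (x l ord0).
  by rewrite /pu_bump; apply: eq_bigr => l _; rewrite psiE.
have order0 : (@morder d (fun=> 0%N) <= k)%N by rewrite /morder big1.
have bP_ord c w x : `|bP c w x| <= K2 * N%:R ^+ 0 * s ^+ (0 - tau).
  by rewrite sub0n !expr0 !mulr1.
have pos al : (0 < @morder d al <= k)%N -> (0 < k)%N /\ (0 < j)%N.
  by move=> /andP[al0 alk]; split; [|apply: leq_trans kj]; exact: leq_trans alk.
have al_le (al : 'I_d -> nat) l : (morder al <= k)%N -> (al l <= j)%N.
  move=> alk; apply: leq_trans kj; apply: leq_trans alk.
  by rewrite /morder (bigD1 l)//= leq_addr.
have bfar i c x : (0 < j)%N -> (i <= j)%N -> 3 <= `|a * x - c| ->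
    `|b c 3 i x| <= K2 * N%:R ^+ i * s ^+ (i - tau) * dl.
  move=> j0 ij far; have [_ _ e0 _ efar] := eP j0.
  have [y1 y2] : (0 <= a * x - c \/ a * x - c <= - 3) /\
      (0 <= a * x - c - 3 \/ a * x - c - 3 <= - 3).
    by move: far; rewrite ler_normr => /orP[far|far]; split; (left; lra) || (right; lra).
  (* Order 0 of the chain does not tend to 0, but in both zones it equals the profile, for which the
     common limit cancels. *)
  have [i0|i0] := posnP i; last by apply: bump_chain_far => //; rewrite i0.
  rewrite {}i0 sub0n !expr0 !mulr1 /b /pu_bump1 !e0//.
  exact: (bump0_far AB).
have bsum i x : (0 < j)%N -> (0 < i <= j)%N -> 0 < x < 1 ->
    `|b 0 (3 * N.+1%:R) i x| <= K2 * N%:R ^+ i * s ^+ (i - tau) * dl.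
  move=> j0 ij /andP[x0 x1]; have [_ _ _ _ efar] := eP j0.
  apply: bump_chain_far => //; rewrite subr0; first by left; rewrite mulr_ge0// ltW.
  right; rewrite -[N.+1%:R]natr1 mulrDr mulr1 opprD addrA.
  by rewrite -[X in _ <= X]add0r lerD2r subr_le0 ler_piMr// ltW.
split.
- move=> m; apply: Wnorm_le => // [x _|al al0k].
    rewrite pu_bumpE; apply: (@le_trans _ _ (K2 ^+ d * N%:R ^+ k * s ^+ (k - tau))).
      exact: (normr_prod_order_le K21 N1 s1 order0).
    exact: CM.
  have [k0 j0] := pos al al0k; have /andP[_ alk] := al0k.
  exists (fun x => \prod_(l < d) b (3 * (m l)%:R) 3 (al l) (x l ord0)).
    apply: (@tensor_weak_derivative _ _ k (fun l => bP (3 * (m l)%:R) 3)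
      (fun l => b (3 * (m l)%:R) 3)) => //.
    + by move=> l; exact: bae.
    + by move=> l i ik; apply: bw; exact: leq_trans kj.
    + by move=> l i ik; apply: bdd => //; exact: leq_trans kj.
  move=> x _; apply: le_trans (CM _ Kd1 KdC).
  by apply: (normr_prod_order_le K21 N1 s1 alk) => l; apply: bK => //; exact: al_le.
(* The coordinate [l0] provides the small factor whatever the order of derivation in it, including
   0; the other factors are merely bounded. *)
- move=> m; apply: Wnorm_le => [|x /interior_subset/(far_from_nodeP N0)[l0 far]|al al0k].
  + by rewrite mulr_ge0.
  + rewrite pu_bumpE; apply: (@le_trans _ _ (K2 ^+ d * N%:R ^+ k * s ^+ (k - tau) * dl)).
      apply: (normr_prod_order_small K21 N1 s1 order0 _ (l0 := l0)) => //.
      by rewrite sub0n !expr0 !mulr1; exact: bump0_far.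
    by rewrite ler_wpM2r// CM.
  have [k0 j0] := pos al al0k; have /andP[_ alk] := al0k.
  exists (fun x => \prod_(l < d) b (3 * (m l)%:R) 3 (al l) (x l ord0)).
    apply: (@tensor_weak_derivative _ _ k (fun l => bP (3 * (m l)%:R) 3)
      (fun l => b (3 * (m l)%:R) 3)) => //.
    + by move=> l; exact: bae.
    + by move=> l i ik; apply: bw; exact: leq_trans kj.
    + by move=> l i ik; apply: bdd => //; exact: leq_trans kj.
  move=> x /interior_subset/(far_from_nodeP N0)[l0 far].
  apply: (@le_trans _ _ (K2 ^+ d * N%:R ^+ k * s ^+ (k - tau) * dl)).
    apply: (normr_prod_order_small K21 N1 s1 alk _ (l0 := l0)).
      by move=> l; apply: bK => //; exact: al_le.
    by apply: bfar => //; exact: al_le.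
  by rewrite ler_wpM2r// CM.
- have sumE x : @unit_cube R d x ->
      \1_(@unit_cube R d) x - \sum_(m : {ffun 'I_d -> 'I_N.+1}) pu_bump tau rho A B s m x =
      1 - \prod_(l < d) bP 0 (3 * N.+1%:R) (x l ord0).
    move=> cx; rewrite indicE mem_set//; congr (_ - _).
    by apply: sum_pu_bump => //; rewrite gt_eqF.
  apply: Wnorm_le => [|x cx|al al0k].
  + by rewrite mulr_ge0.
  + rewrite sumE//; apply: (@le_trans _ _ (d%:R * K2 ^+ d * dl)).
      by apply: one_minus_prod_le => // l; apply: one_minus_bump_le => //; exact: cx.
    by rewrite ler_wpM2r// CM1.
  have [k0 j0] := pos al al0k; have /andP[al0 alk] := al0k.
  exists (fun x => - \prod_(l < d) b 0 (3 * N.+1%:R) (al l) (x l ord0)).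
    apply: (@one_minus_tensor_weak_derivative _ _ k (fun l => bP 0 (3 * N.+1%:R))
      (fun l => b 0 (3 * N.+1%:R))) => //.
    + by move=> l; exact: bae.
    + by move=> l i ik; apply: bw; exact: leq_trans kj.
    + by move=> l i ik; apply: bdd => //; exact: leq_trans kj.
  move=> x cx; rewrite normrN.
  (* In a coordinate of order 0 the telescoped sum is close to 1, so the small factor is sought
     where the order is positive. *)
  have [l0 all0] := morder_gt0 al0.
  apply: (@le_trans _ _ (K2 ^+ d * N%:R ^+ k * s ^+ (k - tau) * dl)).
    apply: (normr_prod_order_small K21 N1 s1 alk _ (l0 := l0)).
      by move=> l; apply: bK => //; exact: al_le.
    by apply: bsum => //; rewrite all0 al_le.
  by rewrite ler_wpM2r// CM.
- move=> m; have [Phi [L2 nz real mw]] := bump_network tau rho m d0 N0 s1 AB.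
  exists Phi; split => //.
  + by apply: (@le_trans _ _ cnt); [rewrite ler_nat|rewrite CE; lra].
  + by move=> x; rewrite pu_bumpE; apply: eq_bigr => l _; rewrite real psiE.
  + rewrite /Wnorm_vec; apply: bigmax_le => [|l _]; first by rewrite lee_fin.
    (* A network component depends on one coordinate; with factors 1 in the others it becomes a
       tensor product, to which the same lemma applies. *)
    have realE x : realization rho Phi x l ord0 =
        \prod_(i < d) (if i == l then bP (3 * (m l)%:R) 3 else (fun=> 1)) (x i ord0).
      rewrite real psiE (bigD1 l)//= eqxx big1 ?mulr1// => i il.
      by rewrite (negPf il).
    apply: Wnorm_le => // [x _|al al0k].
      by rewrite real psiE; apply: le_trans (bPK _ _ _) _; apply: CM1 => //; rewrite CE; lra.
    have [k0 j0] := pos al al0k; have /andP[_ alk] := al0k.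
    pose eta (i : 'I_d) q : R -> R :=
      if i == l then b (3 * (m l)%:R) 3 q else (fun=> (q == 0%N)%:R).
    exists (fun x => \prod_(i < d) eta i (al i) (x i ord0)).
      apply: (@tensor_weak_derivative _ _ k
        (fun i => if i == l then bP (3 * (m l)%:R) 3 else (fun=> 1)) eta) => //.
      * move=> i; rewrite /eta; case: ifP => _; first exact: bae.
        have FF := ae_filter_ringOfSetsType (@lebesgue_measure R).
        exact: nearW.
      * move=> i q qk; rewrite /eta; case: ifP => _; last exact: weak_deriv1_cst.
        by apply: bw; exact: leq_trans kj.
      * move=> i q qk; rewrite /eta; case: ifP => _; last first.
          by exists 1 => t; case: (q == 0%N); rewrite ?normr1 ?normr0.
        by apply: bdd => //; exact: leq_trans kj.
    move=> x _; apply: le_trans (CM _ Kd1 KdC).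
    apply: (normr_prod_order_le K21 N1 s1 alk) => i; rewrite /eta; case: ifP => _.
      by apply: bK => //; exact: al_le.
    (* The constant factors obey the common bound because [K2], [N] and [s] are all at least 1. *)
    apply: (@le_trans _ _ 1); first by case: (al i == 0%N); rewrite ?normr1 ?normr0.
    by rewrite !mulr_ege1// exprn_ege1.
  + apply: le_trans mw _; rewrite -!mulrA ler_wpM2r//.
      by rewrite mulr_ge0// ltW.
    by rewrite CE; lra.
Qed.
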